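(* Consider first-passage percolation on $\mathbb{Z}^d$ with nonnegative i.i.d. edge weights with common distribution $\mu$, where $\mu$ has no mass larger than or equal to $p_c(d)$ at the infimum of its support. Assume that the model has global exponents in the sense of Chatterjee, given by real numbers $\chi_a,\chi_b,\xi_a,\xi_b$, and that $\chi := \chi_a=\chi_b>0$. Then $$\chi \le 2\xi_a-1 .$$
   Context: Setting. Let $d\ge 2$. To each nearest-neighbor edge $e$ of $\mathbb{Z}^d$ attach a nonnegative random variable $\tau_e$ (its passage time); the $\tau_e$ are i.i.d. with distribution $\mu$. $p_c(d)$ is the critical probability of bond percolation on $\mathbb{Z}^d$. The standing assumption is $\mu(\{\inf\operatorname{supp}\mu\})<p_c(d)$. A path is a sequence of nearest-neighbor edges $e_1,e_2,\dots$ such that $e_n$ and $e_{n+1}$ share exactly one endpoint. For a finite path $\gamma$, $\tau(\gamma)=\sum_{e\in\gamma}\tau_e$. For $x\in\mathbb{R}^d$ let $x'$ be the unique vertex of $\mathbb{Z}^d$ with $x\in x'+[0,1)^d$. For $x,y\in\mathbb{R}^d$, $\tau(x,y)=\inf_\gamma\tau(\gamma)$, the infimum being over all paths $\gamma$ containing both $x'$ and $y'$ (so $\tau(x,y)=0$ if $x'=y'$). A minimizing path for $\tau(x,y)$ is called a geodesic from $x$ to $y$. $D(0,v)$ is the maximum Euclidean distance between the set of all geodesics from $0$ to $v$ and the line segment joining $0$ to $v$, i.e. the maximum, over all points on all geodesics from $0$ to $v$, of the Euclidean distance from that point to the segment. $|\cdot|$ is the Euclidean norm. Definition (global exponents in the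 sense of Chatterjee). The model has global exponents in the sense of Chatterjee if there exist real numbers $\chi_a,\chi_b,\xi_a,\xi_b$ such that: (1) for each choice of $\chi'>\chi_a$ and $\xi'>\xi_a$ there exists $\alpha>0$ with $$\sup_{v\in\mathbb{Z}^d\setminus\{0\}}\mathbb{E}\exp\Big(\alpha\frac{|\tau(0,v)-\mathbb{E}\tau(0,v)|}{|v|^{\chi'}}\Big)<\infty\quad\text{and}\quad \sup_{v\in\mathbb{Z}^d\setminus\{0\}}\mathbb{E}\exp\Big(\alpha\frac{D(0,v)}{|v|^{\xi'}}\Big)<\infty;$$ (2) for each choice of $\chi''<\chi_b$ and all $\xi''<\xi_b$, $$\inf_{v\in\mathbb{Z}^d\setminus\{0\}}\frac{\operatorname{Var}(\tau(0,v))}{|v|^{2\chi''}}>0\quad\text{and}\quad \inf_{v\in\mathbb{Z}^d\setminus\{0\}}\frac{\mathbb{E}(D(0,v))}{|v|^{\xi''}}>0.$$ *)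

(* Defs.v *)
From HB Require Import structures.
From mathcomp Require Import all_boot all_order all_algebra.
From mathcomp Require Import all_classical all_reals all_analysis.

Set Implicit Arguments.
Unset Strict Implicit.
Unset Printing Implicit Defensive.
Import Order.TTheory GRing.Theory Num.Theory numFieldNormedType.Exports.
Local Open Scope classical_set_scope.
Local Open Scope ring_scope.

(* The vertices of Z^d are the row vectors 'rV[int]_d. The pair (x, i) encodes
   the edge joining x and x + e_i, so that every unordered pair of nearest
   neighbors is encoded exactly once. *)
Definition edge (d : nat) := ('rV[int]_d * 'I_d)%type.

Definition endpoints (d : nat) (e : edge d) : seq 'rV[int]_d :=
  [:: e.1; e.1 + delta_mx 0 e.2].

Definition share_one_endpoint (d : nat) (e f : edge d) : bool :=
  count [in endpoints f] (endpoints e) == 1%N.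

(* A finite path is a sequence of edges; the empty sequence plays the role of
   the trivial path sitting at any single vertex. *)
Definition is_path (d : nat) (g : seq (edge d)) : bool :=
  sorted (@share_one_endpoint d) g.

Definition visits (d : nat) (g : seq (edge d)) (x : 'rV[int]_d) : bool :=
  has (fun e => x \in endpoints e) g.

Definition path_containing (d : nat) (x y : 'rV[int]_d) (g : seq (edge d)) :
    bool :=
  if g is [::] then x == y else [&& is_path g, visits g x & visits g y].

Definition mutually_independent (disp disp' : measure_display)
    (T : measurableType disp) (T' : measurableType disp') (R : realType)
    (P : probability T R) (I : choiceType) (X : I -> {RV P >-> T'}) : Prop :=
  forall (s : seq I) (A : I -> set T'), uniq s ->
    (forall i, measurable (A i)) ->
    P (\bigcap_(i in [set` s]) X i @^-1` A i) =
    (\prod_(i <- s) P (X i @^-1` A i))%E.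

Definition iid (disp disp' : measure_display)
    (T : measurableType disp) (T' : measurableType disp') (R : realType)
    (P : probability T R) (I : choiceType) (X : I -> {RV P >-> T'})
    (mu : probability T' R) : Prop :=
  mutually_independent X /\
  forall i (A : set T'), measurable A -> distribution P (X i) A = mu A.

Definition open_cluster (d : nat) (o : edge d -> bool) (x : 'rV[int]_d) :
    set 'rV[int]_d :=
  [set y | exists g : seq (edge d), path_containing x y g /\ all o g].

(* sup {p : theta(p) = 0}, where theta(p) is the probability that the origin
   lies in an infinite open cluster. This probability depends only on the joint
   law of the edge states, so it does not matter which realization of the
   i.i.d. Bernoulli(p) family is used; quantifying over all of them avoids
   singling out one. *)
Definition critical_probability (R : realType) (d : nat) : R :=
  sup [set p : R | 0 <= p <= 1 /\
    forall (disp : measure_display) (T : measurableType disp)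
      (P : probability T R) (X : edge d -> {RV P >-> bool}),
      iid X (bernoulli_prob p) ->
      P [set w | infinite_set (open_cluster (fun e => X e w) 0)] = 0%E].

Definition msupport (R : realType) (mu : probability R R) : set R :=
  [set x | forall U : set R, open U -> U x -> (0 < mu U)%E].

(* The norm `|_| of the library on row vectors is the sup norm. *)
Definition euclidean_norm (R : realType) (d : nat) (x : 'rV[R]_d) : R :=
  Num.sqrt (\sum_i x 0 i ^+ 2).

Definition to_real (R : realType) (d : nat) (v : 'rV[int]_d) : 'rV[R]_d :=
  map_mx intr v.

Definition vertex_norm (R : realType) (d : nat) (v : 'rV[int]_d) : R :=
  euclidean_norm (to_real R v).

Definition segment (R : realType) (d : nat) (x y : 'rV[R]_d) : set 'rV[R]_d :=
  [set x + t *: (y - x) | t in `[0, 1]].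

Definition dist_to (R : realType) (d : nat) (S : set 'rV[R]_d)
    (p : 'rV[R]_d) : R :=
  inf [set euclidean_norm (p - q) | q in S].

Section fpp.
Variables (R : realType) (d : nat).
Variable t : edge d -> R.

Definition path_time (g : seq (edge d)) : R := \sum_(e <- g) t e.

Definition passage_time (x y : 'rV[int]_d) : R :=
  inf [set path_time g | g in [set g | path_containing x y g]].

Definition geodesic (x y : 'rV[int]_d) (g : seq (edge d)) : Prop :=
  path_containing x y g /\ path_time g = passage_time x y.

Definition edge_segment (e : edge d) : set 'rV[R]_d :=
  segment (to_real R e.1) (to_real R (e.1 + delta_mx 0 e.2)).

Definition geodesic_points (x y : 'rV[int]_d) : set 'rV[R]_d :=
  [set p | exists (g : seq (edge d)) (e : edge d),
    [/\ geodesic x y g, e \in g & edge_segment e p]].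

(* Extended-real valued because geodesics may fail to exist, or be unbounded,
   on an exceptional event. *)
Definition geodesic_deviation (v : 'rV[int]_d) : \bar R :=
  ereal_sup [set (dist_to (segment 0 (to_real R v)) p)%:E
            | p in geodesic_points 0 v].

End fpp.

Section exponents.
Variables (R : realType) (d : nat) (disp : measure_display).
Variables (T : measurableType disp) (P : probability T R).
Variable tau : edge d -> {RV P >-> R}.
Local Open Scope ereal_scope.

Definition fpp_time (v : 'rV[int]_d) (w : T) : R :=
  passage_time (fun e => tau e w) 0%R v.

Definition fpp_deviation (v : 'rV[int]_d) (w : T) : \bar R :=
  geodesic_deviation (fun e => tau e w) v.

Definition upper_exponents (chi_a xi_a : R) : Prop :=
  forall chi' xi' : R, (chi_a < chi')%R -> (xi_a < xi')%R ->
  exists alpha : R, [/\ (0 < alpha)%R,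
    ereal_sup [set \int[P]_w expeR ((alpha / vertex_norm R v `^ chi')%:E *
                 `|(fpp_time v w)%:E - 'E_P[fpp_time v]|)
              | v in [set v : 'rV[int]_d | v != 0%R]] < +oo &
    ereal_sup [set \int[P]_w expeR ((alpha / vertex_norm R v `^ xi')%:E *
                 fpp_deviation v w)
              | v in [set v : 'rV[int]_d | v != 0%R]] < +oo].

Definition lower_exponents (chi_b xi_b : R) : Prop :=
  forall chi'' xi'' : R, (chi'' < chi_b)%R -> (xi'' < xi_b)%R ->
    0 < ereal_inf [set 'V_P[fpp_time v] *
                     ((vertex_norm R v `^ (2 * chi''))^-1)%:E
                  | v in [set v : 'rV[int]_d | v != 0%R]] /\
    0 < ereal_inf [set (\int[P]_w fpp_deviation v w) *
                     ((vertex_norm R v `^ xi'')^-1)%:E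
                  | v in [set v : 'rV[int]_d | v != 0%R]].

Definition global_exponents (chi_a chi_b xi_a xi_b : R) : Prop :=
  upper_exponents chi_a xi_a /\ lower_exponents chi_b xi_b.

End exponents.

(* Main.v *)
Require Import Defs.
From HB Require Import structures.
From mathcomp Require Import all_boot all_order all_algebra.
From mathcomp Require Import all_classical all_reals all_analysis.
From mathcomp Require Import measurable_realfun.
From mathcomp Require Import ring lra zify.

Set Implicit Arguments.
Unset Strict Implicit.
Unset Printing Implicit Defensive.
Import Order.TTheory GRing.Theory Num.Theory numFieldNormedType.Exports.
Local Open Scope classical_set_scope.
Local Open Scope ring_scope.

(** Write [T x y] for passage times, [f v] for the mean of [T 0 v], and suppose
    that [chi > 2 xi - 1].  If [1 <= xi] this is absurd, because comparing
    [T 0 (n e)] with a sum of [n] unit steps bounds its variance by a multiple of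
    [n ^ 2], so [chi <= 1] ([variance_exponent_le1]).  Let then [xi < 1].

    Choose a vertex [v] of norm about [m], put [V = N v] with [N] about
    [m `^ kap], and let [y] be orthogonal to [v] up to rounding and somewhat
    longer than twice the width [m `^ sig] of a tube which, with high probability,
    contains the geodesic from [0] to [V]; here [sig] lies between [xi] and
    [(1 + chi) / 2].  The segments from [0] to [V] and from [y] to [y + V] have
    disjoint tubes, so [T 0 V] and [T y (y + V)] agree with high probability with
    two independent random variables of the same law.
    On the other hand the geodesic of the second passage time passes near [y + v]
    and [y + V - v]; rerouting its two ends to [0] and [V] shows that
    [T 0 V - T y (y + V)] is at most the sum of two differences of passage times
    over distances of order [m] ([reroute_ends]).  Their fluctuations are of order
    [m `^ chi], much smaller than [|V| `^ chi].  If the means are also that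
    close, two independent copies of [T 0 V] differ by at most some [s] much
    smaller than [|V| `^ chi], hence [T 0 V] is concentrated within [2 s] of a
    median ([passage_time_concentration]), which contradicts the lower bound on
    its variance.

    The means are close if [f] is flat near [v]: moving by [y] in a direction
    orthogonal to [v] should change [f] by at most [|y| ^ 2 / m] plus an error of
    order [m `^ chi'], where [chi'] is slightly larger than [chi].  The first term
    is of order [m `^ (2 sig - 1)], and this is where [2 xi - 1 < chi] is used.
    The vertex [v] is a maximum point of [f w - |w| ^ 2 / m]: this gives
    an upper bound by a paraboloid touching the graph of [f] at [v], and the
    inequality [f (v + u) + f (v - u) >= f (2 v)] turns it into a lower bound as
    soon as [f (2 v) >= 2 f v - O(m `^ chi')] ([flat_vertex]).

    That last estimate is a bound on nonrandom fluctuations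
    ([nonrandom_fluctuation_bound]).  It follows from the fact that the geodesic
    from [0] to [w] passes near [w / 2], so that [f w] is nearly [f a + f (w - a)]
    for some [a] close to [w / 2] ([mean_time_split]): iterating, [2 ^ k v] is cut
    into pieces of the size of [v] on which [f] is nearly linear, and a vector is
    rebuilt from at most [d + 1] of these pieces and a remainder half its size.

    Concerning probability, the hypotheses are used through polynomial tail
    estimates of arbitrary degree, which survive union bounds over boxes
    ([uniform_fluctuation], [tube_probability]).  That geodesics exist almost
    surely follows from the positivity of the mean deviation
    ([geodesic_exists_ae]). *)

(** * Euclidean geometry and the lattice *)

Section euclidean_geometry.
Variables (R : realType) (d : nat).
Implicit Types (x y z : 'rV[R]_d) (u v w : 'rV[int]_d).

Definition dot x y : R := \sum_i x 0 i * y 0 i.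

Local Notation enorm := (@euclidean_norm R d).

Lemma dotC x y : dot x y = dot y x.
Proof. by apply: eq_bigr => i _; rewrite mulrC. Qed.

Lemma dotDl x y z : dot (x + y) z = dot x z + dot y z.
Proof. by rewrite -big_split; apply: eq_bigr => i _; rewrite mxE mulrDl. Qed.

Lemma dotZl c x y : dot (c *: x) y = c * dot x y.
Proof. by rewrite mulr_sumr; apply: eq_bigr => i _; rewrite mxE mulrA. Qed.

Lemma dotDr x y z : dot x (y + z) = dot x y + dot x z.
Proof. by rewrite !(dotC x) dotDl. Qed.

Lemma dotZr c x y : dot x (c *: y) = c * dot x y.
Proof. by rewrite !(dotC x) dotZl. Qed.

Lemma dotNl x y : dot (- x) y = - dot x y.
Proof. by rewrite -scaleN1r dotZl mulN1r. Qed.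

Lemma dotNr x y : dot x (- y) = - dot x y.
Proof. by rewrite -scaleN1r dotZr mulN1r. Qed.

Lemma dot_ge0 x : 0 <= dot x x.
Proof. by apply: sumr_ge0 => i _; rewrite -expr2 sqr_ge0. Qed.

Lemma enorm_ge0 x : 0 <= enorm x. Proof. exact: sqrtr_ge0. Qed.

Lemma sqr_enorm x : enorm x ^+ 2 = dot x x.
Proof.
rewrite /euclidean_norm sqr_sqrtr.
  by apply: eq_bigr => i _; rewrite expr2.
by apply: sumr_ge0 => i _; rewrite sqr_ge0.
Qed.

Lemma enormZ c x : enorm (c *: x) = `|c| * enorm x.
Proof.
rewrite /euclidean_norm; under eq_bigr do rewrite mxE exprMn.
by rewrite -mulr_sumr sqrtrM ?sqr_ge0 // sqrtr_sqr.
Qed.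

Lemma enormN x : enorm (- x) = enorm x.
Proof. by rewrite -scaleN1r enormZ normrN1 mul1r. Qed.

Lemma enorm0 : enorm 0 = 0.
Proof. by rewrite -(scale0r 0) enormZ normr0 mul0r. Qed.

Lemma cauchy_schwarz x y : dot x y <= enorm x * enorm y.
Proof.
have h t : 0 <= dot x x - 2 * t * dot x y + t ^+ 2 * dot y y.
  have := dot_ge0 (x - t *: y).
  by rewrite dotDl !dotDr !dotNl !dotNr dotZl dotZr dotZl dotZr (dotC y x); nra.
have [/eqP y0|yN0] := boolP (dot y y == 0).
  have -> : dot x y = 0.
    apply/eqP/negPn/negP => xy0.
    have := h ((dot x x + 1) / (2 * dot x y)).
    rewrite y0 mulr0 addr0.
    have -> : 2 * ((dot x x + 1) / (2 * dot x y)) * dot x y = dot x x + 1 by field.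
    lra.
  by rewrite mulr_ge0 ?enorm_ge0.
have yp : 0 < dot y y by rewrite lt_def yN0 dot_ge0.
apply: ler_normlW; rewrite -(@ler_pXn2r _ 2) // ?nnegrE ?normr_ge0 ?mulr_ge0 ?enorm_ge0 //.
rewrite exprMn !sqr_enorm real_normK ?num_real //.
have := h (dot x y / dot y y).
have -> : dot x x - 2 * (dot x y / dot y y) * dot x y
  + (dot x y / dot y y) ^+ 2 * dot y y = dot x x - dot x y ^+ 2 / dot y y.
  by field.
by rewrite subr_ge0 ler_pdivrMr.
Qed.

Lemma enormD x y : enorm (x + y) <= enorm x + enorm y.
Proof.
rewrite -(@ler_pXn2r _ 2) // ?nnegrE ?addr_ge0 ?enorm_ge0 //.
rewrite sqrrD !sqr_enorm dotDl !dotDr (dotC y x).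
have := cauchy_schwarz x y; lra.
Qed.

Lemma enormB x y : enorm (x - y) <= enorm x + enorm y.
Proof. by rewrite -(enormN y) enormD. Qed.

Lemma enorm_sum (I : Type) (r : seq I) (P : pred I) (F : I -> 'rV[R]_d) :
  enorm (\sum_(i <- r | P i) F i) <= \sum_(i <- r | P i) enorm (F i).
Proof.
elim/big_rec2: _ => [|i y x _ IH]; first by rewrite enorm0.
by rewrite (le_trans (enormD _ _)) // lerD2l.
Qed.

Lemma enormBC x y : enorm (x - y) = enorm (y - x).
Proof. by rewrite -enormN opprB. Qed.

Lemma normr_dot x y : `|dot x y| <= enorm x * enorm y.
Proof.
by rewrite ler_norml cauchy_schwarz andbT lerNl -dotNl -(enormN x) cauchy_schwarz.
Qed.

Lemma enorm_coord x i : `|x 0 i| <= enorm x.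
Proof.
rewrite -sqrtr_sqr ler_wsqrtr // (bigD1 i) //= lerDl.
by apply: sumr_ge0 => j _; rewrite sqr_ge0.
Qed.

Lemma enorm_eq0 x : enorm x = 0 -> x = 0.
Proof.
move=> x0; apply/rowP => i; rewrite mxE; apply/eqP.
by rewrite -normr_le0 -x0 enorm_coord.
Qed.

Lemma enorm_le_coord x c : (forall i, `|x 0 i| <= c) -> enorm x <= d%:R * c.
Proof.
move=> h; case: (posnP d) => [d0|dp].
  rewrite /euclidean_norm big1 ?sqrtr0 ?d0 ?mul0r // => i _.
  by exfalso; have := ltn_ord i; rewrite [X in (_ < X)%N]d0 ltn0.
have c0 : 0 <= c by apply: le_trans (h (Ordinal dp)).
rewrite -(@ler_pXn2r _ 2) // ?nnegrE ?enorm_ge0 ?mulr_ge0 //.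
rewrite sqr_enorm exprMn; apply: (@le_trans _ _ (\sum_(i < d) c ^+ 2)).
  apply: ler_sum => i _; rewrite -expr2 -(real_normK (num_real _)).
  by rewrite ler_pXn2r // nnegrE.
rewrite sumr_const card_ord -[_ *+ d]mulr_natl ler_wpM2r ?sqr_ge0 //.
by rewrite -natrX ler_nat -{1}(expn1 d) leq_pexp2l.
Qed.

End euclidean_geometry.

Section lattice.
Variables (R : realType) (d : nat).
Implicit Types (u v w : 'rV[int]_d).
Local Notation rv := (@to_real R d).
Local Notation vn := (@vertex_norm R d).

Lemma to_realD u v : rv (u + v) = rv u + rv v. Proof. exact: map_mxD. Qed.
Lemma to_realN u : rv (- u) = - rv u. Proof. exact: map_mxN. Qed.
Lemma to_realB u v : rv (u - v) = rv u - rv v. Proof. exact: map_mxB. Qed.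
Lemma to_real0 : rv 0 = 0. Proof. exact: map_mx0. Qed.
Lemma to_realMn u n : rv (u *+ n) = n%:R *: rv u.
Proof. by rewrite scaler_nat; elim: n => [|n IH]; rewrite ?mulr0n ?to_real0 // !mulrS to_realD IH. Qed.

Lemma to_real_sum (I : Type) (r : seq I) (P : pred I) (F : I -> 'rV[int]_d) :
  rv (\sum_(i <- r | P i) F i) = \sum_(i <- r | P i) rv (F i).
Proof. exact: (big_morph _ to_realD to_real0). Qed.

Lemma vnormD u v : vn (u + v) <= vn u + vn v.
Proof. by rewrite /vertex_norm to_realD enormD. Qed.
Lemma vnormB u v : vn (u - v) <= vn u + vn v.
Proof. by rewrite /vertex_norm to_realB enormB. Qed.
Lemma vnormN v : vn (- v) = vn v.
Proof. by rewrite /vertex_norm to_realN enormN. Qed.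
Lemma vnorm0 : vn 0 = 0.
Proof. by rewrite /vertex_norm to_real0 enorm0. Qed.
Lemma vnorm_ge0 v : 0 <= vn v. Proof. exact: enorm_ge0. Qed.
Lemma vnormMn v n : vn (v *+ n) = n%:R * vn v.
Proof. by rewrite /vertex_norm to_realMn enormZ ger0_norm. Qed.

Lemma vnorm_coord v i : `|v 0 i|%:~R <= vn v.
Proof. by rewrite intr_norm; have := enorm_coord (rv v) i; rewrite mxE. Qed.

Lemma vnorm_ge1 v : v != 0 -> 1 <= vn v.
Proof.
move=> vN0; have [i vi] : exists i, v 0 i != 0.
  apply/existsP; rewrite -[[exists _, _]]negbK negb_exists; apply/negP => /forallP h.
  by move/negP: vN0; apply; apply/eqP/rowP => i; rewrite mxE; apply/eqP; have := h i; rewrite negbK.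
apply: le_trans (vnorm_coord v i).
by rewrite -[1](mulr1z 1) ler_int; lia.
Qed.

Lemma vnorm_gt0 v : v != 0 -> 0 < vn v.
Proof. by move/vnorm_ge1; apply: lt_le_trans. Qed.

Lemma vnorm_delta (i : 'I_d) : vn (delta_mx 0 i) = 1.
Proof.
rewrite /vertex_norm /euclidean_norm (bigD1 i) //= big1 ?addr0.
  by rewrite !mxE !eqxx expr1n sqrtr1.
by move=> j ji; rewrite !mxE (negPf ji) andbF expr0n.
Qed.

Lemma sqr_vnormD u v :
  vn (u + v) ^+ 2 = vn u ^+ 2 + 2 * dot (rv u) (rv v) + vn v ^+ 2.
Proof.
rewrite /vertex_norm to_realD !sqr_enorm dotDl !dotDr (dotC (rv v) (rv u)); ring.
Qed.

Definition cube (k : nat) : seq 'rV[int]_d :=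
  [seq \row_i ((f i : nat)%:Z - k%:Z) | f : {ffun 'I_d -> 'I_(k.*2.+1)}].

Lemma size_cube k : size (cube k) = (k.*2.+1 ^ d)%N.
Proof. by rewrite size_map -cardE card_ffun !card_ord. Qed.

Lemma mem_cube k v : vn v <= k%:R -> v \in cube k.
Proof.
move=> vk; have vik i : `|v 0 i| <= k%:Z.
  by have := le_trans (vnorm_coord v i) vk; rewrite -[k%:R]/(k%:Z%:~R) ler_int.
have lt_i (i : 'I_d) : (`|(v 0 i + k%:Z)%R|%N < k.*2.+1)%N by have := vik i; lia.
apply/mapP; exists [ffun i => Ordinal (lt_i i)]; first by rewrite mem_enum.
by apply/rowP => i; rewrite mxE ffunE /=; have := vik i; lia.
Qed.

Lemma round_vector (x : 'rV[R]_d) : exists v, euclidean_norm (rv v - x) <= d%:R.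
Proof.
exists (\row_i Num.floor (x 0 i)); rewrite -[leRHS]mulr1.
apply: enorm_le_coord => i; rewrite !mxE ler_norml.
by have := floor_le (x 0 i); have := floorD1_gt (x 0 i); rewrite intrD; lra.
Qed.

End lattice.

(** If more than [d + 1] weights are nonzero, the vectors [(u_i, 1)] that carry
    them are linearly dependent, and the weights can be moved along a dependency
    in the direction that does not increase the cost until one of them
    vanishes.  The extra coordinate [1] makes the coefficients of the dependency
    sum to zero, so that some of them are positive. *)
Lemma conic_caratheodory (R : realType) (n d : nat) (u : 'I_n -> 'rV[R]_d)
    (c p : 'I_n -> R) : (forall i, 0 <= p i) ->
  exists q : 'I_n -> R, [/\ forall i, 0 <= q i,
    \sum_i q i *: u i = \sum_i p i *: u i,
    \sum_i q i * c i <= \sum_i p i * c i &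
    (#|[set i | q i != 0%R]%SET| <= d.+1)%N].
Proof.
have [N] := ubnP #|[set i | p i != 0%R]%SET|; elim: N p => // N IH p ltN p0.
have [small|big] := leqP #|[set i | p i != 0]%SET| d.+1; first by exists p.
set S := [set i | p i != 0]%SET in ltN big.
pose A : 'M[R]_(#|S|, d + 1) := \matrix_(k < #|S|) row_mx (u (enum_val k)) (1 : 'rV_1).
have : kermx A != 0.
  rewrite kermx_eq0 /row_free; apply/negP => /eqP rA.
  by have := rank_leq_col A; rewrite rA addn1 leqNgt big.
case/rowV0Pn => b /sub_kermxP bA b0.
pose e i : R := \sum_(k < #|S| | enum_val k == i) b 0 k.
have eE k : e (enum_val k) = b 0 k.
  rewrite /e (big_pred1 k) // => k'; apply/eqP/eqP => [/enum_val_inj//|->//].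
have eS i : i \notin S -> e i = 0.
  move=> iS; rewrite /e big_pred0 // => k; apply/eqP => ki.
  by move: iS; rewrite -ki enum_valP.
have sumE (V : lmodType R) (F : 'I_n -> V) :
    \sum_i e i *: F i = \sum_k b 0 k *: F (enum_val k).
  rewrite (bigID (mem S)) /= [X in _ + X]big1 ?addr0; last first.
    by move=> i iS; rewrite eS ?scale0r.
  rewrite big_enum_val; apply: eq_bigr => k _; by rewrite eE.
have dep1 : \sum_i e i *: u i = 0.
  rewrite sumE; have /(congr1 lsubmx) := bA; rewrite mulmx_sum_row linear_sum /= linear0.
  move=> h; rewrite -[RHS]h; apply: eq_bigr => k _.
  by rewrite linearZ /= rowK row_mxKl.
have dep2 : \sum_i e i = 0.
  under eq_bigr do rewrite -[e _]mulr1.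
  have := sumE R^o (fun=> 1); rewrite /GRing.scale /= => ->.
  have /(congr1 rsubmx) := bA; rewrite mulmx_sum_row linear_sum /= linear0.
  move/(congr1 (fun M : 'rV[R]_1 => M 0 0)); rewrite summxE mxE => h; rewrite -[RHS]h.
  by apply: eq_bigr => k _; rewrite linearZ /= rowK row_mxKr !mxE.
have eN0 : exists i, e i != 0.
  case: (pickP (fun k => b 0 k != 0)) => [k bk|bz]; first by exists (enum_val k); rewrite eE.
  by move/negP: b0; case; apply/eqP/rowP => k; rewrite mxE; apply/eqP/negbFE/bz.
(* moving the weights along a suitably oriented dependency *)
suff key (a : 'I_n -> R) : (forall i, i \notin S -> a i = 0) ->
    \sum_i a i *: u i = 0 -> \sum_i a i = 0 -> (exists i, a i != 0) ->
    0 <= \sum_i a i * c i ->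
    exists q : 'I_n -> R, [/\ forall i, 0 <= q i,
      \sum_i q i *: u i = \sum_i p i *: u i,
      \sum_i q i * c i <= \sum_i p i * c i &
      (#|[set i | q i != 0%R]%SET| <= d.+1)%N].
  have [ge|lt] := leP 0 (\sum_i e i * c i); first exact: (key e).
  apply: (key (fun i => - e i)).
  - by move=> i /eS ->; rewrite oppr0.
  - by under eq_bigr do rewrite scaleNr; rewrite sumrN dep1 oppr0.
  - by rewrite sumrN dep2 oppr0.
  - by case: eN0 => i ei; exists i; rewrite oppr_eq0.
  - by under eq_bigr do rewrite mulNr; rewrite sumrN oppr_ge0 ltW.
move=> aS a1 a2 aN0 ac.
have [i0 ai0] : exists i, 0 < a i.
  case: (pickP (fun i => 0 < a i)) => [i ai|no]; first by exists i.
  case: aN0 => i /eqP; case; apply/eqP.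
  have npos j : 0 <= - a j by rewrite oppr_ge0 leNgt no.
  have : \sum_j - a j == 0 by rewrite sumrN a2 oppr0.
  by rewrite psumr_eq0 // => /allP/(_ i); rewrite mem_index_enum oppr_eq0 => /(_ isT).
have [j aj jmin] := @arg_minP _ R _ i0 (fun i => 0 < a i) (fun i => p i / a i) ai0.
pose t := p j / a j; have t0 : 0 <= t by rewrite divr_ge0 // ltW.
pose q i := p i - t * a i.
have q0 i : 0 <= q i.
  rewrite subr_ge0; have [ai|ai] := ltP 0 (a i).
    by rewrite -ler_pdivlMr // jmin.
  by apply: le_trans (p0 i); rewrite mulr_ge0_le0.
have qj : q j = 0 by rewrite /q /t divfK ?subrr // gt_eqF.
have subS : [set i | q i != 0]%SET \proper S.
  apply/properP; split.
    apply/fintype.subsetP => i; rewrite !inE; apply: contraNN => /eqP pi0.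
    by rewrite /q pi0 aS ?mulr0 ?subr0 // inE pi0 eqxx.
  exists j; rewrite !inE ?qj ?eqxx //.
  by apply: contraTN aj => /eqP pj; rewrite aS ?ltxx // inE pj eqxx.
have ltq : (#|[set i | q i != 0%R]%SET| < N)%N.
  by apply: leq_trans (proper_card subS) _; rewrite -ltnS.
case: (IH q ltq q0) => q' [q'0 q'u q'c q'S]; exists q'; split => //.
  rewrite q'u /q; under eq_bigr do rewrite scalerBl -scalerA.
  by rewrite sumrB -scaler_sumr a1 scaler0 subr0.
apply: le_trans q'c _; rewrite /q; under eq_bigr do rewrite mulrBl -mulrA.
by rewrite sumrB -mulr_sumr lerBlDr lerDl mulr_ge0.
Qed.

(** * Subadditive functions and nonrandom fluctuations *)

Section power_asymptotics.
Variable R : realType.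
Implicit Types a b C x : R.

Lemma powR_dominates C a b : a < b ->
  exists M : R, 1 <= M /\ forall x, M <= x -> C * x `^ a <= x `^ b.
Proof.
move=> ab; have ba : 0 < b - a by rewrite subr_gt0.
exists (Num.max 1 (`|C| `^ (b - a)^-1)); split; first by rewrite le_max lexx.
move=> x; rewrite ge_max => /andP[x1 Cx].
have x0 : 0 < x by apply: lt_le_trans x1.
have -> : x `^ b = x `^ (b - a) * x `^ a.
  by rewrite -powRD ?subrK // (gt_eqF x0) implybT.
rewrite ler_wpM2r ?powR_ge0 //; apply: le_trans (ler_norm C) _.
have := @ge0_ler_powR R (b - a) (ltW ba) (`|C| `^ (b - a)^-1) x.
rewrite !nnegrE powR_ge0 (ltW x0) => /(_ isT isT Cx).
by rewrite -powRrM mulVf ?gt_eqF // powRr1.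
Qed.

Lemma powR_exprn x a n : 0 <= x -> (x ^+ n) `^ a = (x `^ a) ^+ n.
Proof.
by move=> x0; rewrite -powR_mulrn // -powRrM mulrC powRrM powR_mulrn ?powR_ge0.
Qed.

Lemma ltr_powR x a b : 1 < x -> a < b -> x `^ a < x `^ b.
Proof.
move=> x1 ab; have x0 : 0 < x by apply: lt_trans x1.
by rewrite /powR gt_eqF // ltr_expR ltr_pM2r // ln_gt0.
Qed.

End power_asymptotics.

Lemma seq_argmax (R : realDomainType) (T : eqType) (s : seq T) (h : T -> R) :
  s != [::] -> exists x, x \in s /\ forall y, y \in s -> h y <= h x.
Proof.
elim: s => // a s IH _; have [->|/IH[x [xs hx]]] := eqVneq s [::].
  by exists a; rewrite inE eqxx; split => // y; rewrite inE => /eqP ->.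
have [ax|xa] := leP (h a) (h x); [exists x|exists a]; rewrite inE ?xs ?eqxx ?orbT.
  by split => // y; rewrite inE => /orP[/eqP ->//|/hx].
by split => // y; rewrite inE => /orP[/eqP ->//|/hx yx]; rewrite (le_trans yx) // ltW.
Qed.

Section nonrandom_fluctuations.
Variables (R : realType) (d : nat).
Implicit Types (u v w : 'rV[int]_d).
Local Notation rv := (@to_real R d).
Local Notation vn := (@vertex_norm R d).
Variables (f : 'rV[int]_d -> R) (Cf : R).
Hypothesis f_ge0 : forall v, 0 <= f v.
Hypothesis f_sub : forall u v, f (u + v) <= f u + f v.
Hypothesis f_le : forall v, f v <= Cf * vn v.

Let Cf_ge0 : 0 <= Cf \/ forall v, vn v = 0.
Proof.
have [|lt] := leP 0 Cf; [by left|right => v].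
apply/eqP; rewrite eq_le vnorm_ge0 andbT leNgt; apply/negP => v0.
by have := le_trans (f_ge0 v) (f_le v); rewrite leNgt nmulr_rlt0 ?v0.
Qed.

Lemma subadd0 : f 0 = 0.
Proof. by apply/eqP; rewrite eq_le f_ge0 andbT; have := f_le 0; rewrite vnorm0 mulr0. Qed.

Lemma subadd_Mn v n : f (v *+ n) <= n%:R * f v.
Proof.
elim: n => [|n IH]; first by rewrite mulr0n subadd0 mul0r.
by rewrite mulrS (le_trans (f_sub _ _)) // -natr1 mulrDl mul1r addrC lerD.
Qed.

Lemma subadd_sum (I : Type) (r : seq I) (F : I -> 'rV[int]_d) (n : I -> nat) :
  f (\sum_(i <- r) F i *+ n i) <= \sum_(i <- r) (n i)%:R * f (F i).
Proof.
elim: r => [|i r IH]; first by rewrite !big_nil subadd0.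
by rewrite !big_cons (le_trans (f_sub _ _)) // lerD // subadd_Mn.
Qed.

(** By subadditivity [f (2 ^ k v) / 2 ^ k] is nonincreasing in [k], so that this
    infimum is a limit: the time constant in the direction [v] when [f] is the
    mean passage time. *)
Definition time_constant v : R :=
  inf [set f (v *+ 2 ^ k) / 2 ^+ k | k in [set: nat]].
Local Notation g := time_constant.

Let has_inf_g v : has_inf [set f (v *+ 2 ^ k) / 2 ^+ k | k in [set: nat]].
Proof.
split; first by exists (f (v *+ 2 ^ 0) / 2 ^+ 0); exists 0%N.
by exists 0 => _ [k _ <-]; rewrite divr_ge0 // exprn_ge0.
Qed.

Lemma time_constant_le v k : g v <= f (v *+ 2 ^ k) / 2 ^+ k.
Proof. by apply: ge_inf; [case: (has_inf_g v)|exists k]. Qed.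

Lemma le_time_constant v a : (forall k, a <= f (v *+ 2 ^ k) / 2 ^+ k) -> a <= g v.
Proof.
by move=> h; apply: lb_le_inf; [case: (has_inf_g v)|move=> _ [k _ <-]].
Qed.

Lemma time_constant_ge0 v : 0 <= g v.
Proof. by apply: le_time_constant => k; rewrite divr_ge0 // exprn_ge0. Qed.

Lemma time_constant_adherent v e : 0 < e ->
  exists k, f (v *+ 2 ^ k) / 2 ^+ k < g v + e.
Proof. by move=> /inf_adherent/(_ (has_inf_g v))[_ [k _ <-]]; exists k. Qed.

Lemma time_constant_double v : g v <= f (v *+ 2) / 2.
Proof. exact: (time_constant_le v 1). Qed.

Lemma time_constant_pow v j : 2 ^+ j * g v <= g (v *+ 2 ^ j).
Proof.
apply: le_time_constant => k; rewrite -mulrnA -expnD.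
rewrite ler_pdivlMr ?exprn_gt0 // mulrAC -exprD -ler_pdivlMl ?exprn_gt0 //.
by rewrite mulrC; apply: time_constant_le.
Qed.

Lemma time_constantD u w : g (u + w) <= g u + f w.
Proof.
rewrite -lerBlDr; apply: le_time_constant => k; rewrite lerBlDr.
apply: le_trans (time_constant_le _ k) _.
rewrite ler_pdivrMr ?exprn_gt0 // mulrDl divfK ?gt_eqF ?exprn_gt0 //.
rewrite mulrnDl (le_trans (f_sub _ _)) // lerD2l.
by have := subadd_Mn w (2 ^ k); rewrite natrX mulrC.
Qed.

(** The rounding errors in the coefficients of [2 ^ k x] are bounded vectors,
    and their cost disappears after dividing by [2 ^ k]. *)
Lemma time_constant_conic n (q : 'I_n -> 'rV[int]_d) (c : 'I_n -> R) x :
  (forall i, 0 <= c i) -> rv x = \sum_i c i *: rv (q i) ->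
  g x <= \sum_i c i * f (q i).
Proof.
move=> c0 xE; set B := \sum_i vn (q i).
case: Cf_ge0 => [Cf0|vn0]; last first.
  apply: le_trans (time_constant_le _ 0) _.
  rewrite expr0 divr1; apply: le_trans (f_le _) _; rewrite vn0 mulr0.
  by apply: sumr_ge0 => i _; rewrite mulr_ge0.
apply/ler_addgt0Pr => e e0.
have [k ke] : exists k, Cf * B <= e * 2 ^+ k.
  have [k kP] : exists k : nat, Cf * B / e < k%:R.
    exists (Num.truncn (Cf * B / e)).+1; exact: truncnS_gt.
  exists k; rewrite -ler_pdivrMl // [e^-1 * _]mulrC; apply/ltW/(lt_le_trans kP).
  by rewrite -natrX ler_nat ltnW // ltn_expl.
apply: le_trans (time_constant_le _ k) _.
rewrite ler_pdivrMr ?exprn_gt0 // mulrDl.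
pose m i := Num.truncn (2 ^+ k * c i).
have mP i : (m i)%:R <= 2 ^+ k * c i < (m i)%:R + 1.
  by rewrite natr1 truncn_itv // mulr_ge0 // exprn_ge0.
set s := \sum_i q i *+ m i; rewrite -(subrK s (x *+ 2 ^ k)).
rewrite addrC (le_trans (f_sub _ _)) // lerD //.
  apply: le_trans (subadd_sum _ _ _) _; rewrite mulr_suml.
  apply: ler_sum => i _; rewrite mulrAC ler_wpM2r //.
  by rewrite mulrC; case/andP: (mP i).
apply: le_trans ke; apply: le_trans (f_le _) _; rewrite ler_wpM2l //.
rewrite /vertex_norm to_realB to_realMn xE /s.
rewrite to_real_sum scaler_sumr -sumrB; apply: le_trans (enorm_sum _ _ _) _.
apply: ler_sum => i _; rewrite to_realMn natrX scalerA -scalerBl enormZ.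
rewrite ler_piMl ?vnorm_ge0 //; have /andP[] := mP i.
by rewrite ler_norml; lra.
Qed.

Section splitting.
Variables (chi theta M0 : R).
Hypotheses (chi_gt0 : 0 < chi) (chi_lt1 : chi < 1) (theta_lt1 : theta < 1).
Hypothesis theta_ge0 : 0 <= theta.
Hypothesis f_split : forall w, M0 <= vn w ->
  exists a, vn (a *+ 2 - w) <= vn w `^ theta /\
            f a + f (w - a) <= f w + vn w `^ chi.

Let beta : R := 2 `^ chi.
Let gamma : R := 2 `^ theta.

Let beta_gt0 : 0 < beta. Proof. by rewrite powR_gt0. Qed.
Let beta_lt2 : beta < 2.
Proof. by rewrite -[ltRHS]powRr1 // ltr_powR // ltr1n. Qed.
Let gamma_lt2 : gamma < 2.
Proof. by rewrite -[ltRHS]powRr1 // ltr_powR // ltr1n. Qed.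
Let gamma_ge0 : 0 <= gamma. Proof. exact: powR_ge0. Qed.

(** Halving [w] repeatedly.  The pieces at depth [j] have size about
    [2 ^ (k - j) rho], so the [2 ^ j] splittings made there lose
    [2 ^ j (2 ^ (k - j) rho) `^ chi] in total; because [chi < 1] the deepest
    level dominates the sum over [j].  The factor [1 + (gamma / 2) ^ k] leaves
    room for the halves to be unequal by [|w| `^ theta]. *)
Lemma dyadic_split : exists rho0 A : R, [/\ 0 < rho0, 0 <= A &
  forall rho, rho0 <= rho -> forall k w,
    vn w <= 2 ^+ k * rho * (1 + (gamma / 2) ^+ k) ->
    exists us : seq 'rV[int]_d, [/\ \sum_(u <- us) u = w,
      forall u, u \in us -> vn u <= 2 * rho &
      \sum_(u <- us) f u <= f w + A * rho `^ chi * (2 ^+ k - beta ^+ k)]].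
Proof.
have [M [M1 Mdom]] := powR_dominates (gamma ^+ 2 / (2 - gamma)) theta_lt1.
have A0 : 0 <= beta ^+ 2 / (2 - beta).
  by apply: divr_ge0; [rewrite exprn_ge0 // ltW|rewrite subr_ge0 ltW].
exists (Num.max M `|M0|), (beta ^+ 2 / (2 - beta)); split.
- by rewrite lt_max (lt_le_trans _ M1).
- exact: A0.
move=> rho; rewrite ge_max => /andP[Mrho M0rho].
set A := beta ^+ 2 / (2 - beta) in A0 *.
have rho0 : 0 < rho by apply: lt_le_trans Mrho; apply: lt_le_trans M1.
have ratio : 0 <= gamma / 2 <= 1.
  by rewrite divr_ge0 ?gamma_ge0 //= ler_pdivrMr // mul1r ltW.
elim=> [|k IH] w wle.
  exists [:: w]; rewrite !big_seq1 !expr0 subrr mulr0 addr0; split => // u.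
  rewrite inE => /eqP ->; move: wle; rewrite !expr0; lra.
have [small|large] := ltP (vn w) M0.
  exists [:: w]; rewrite !big_seq1; split => //.
    move=> u; rewrite inE => /eqP ->; have := ler_norm M0; lra.
  rewrite lerDl; apply: mulr_ge0; first by rewrite mulr_ge0 ?powR_ge0.
  by rewrite subr_ge0 ler_pXn2r ?nnegrE ?ltW.
have [a [a_mid a_cost]] := f_split large.
have wle2 : vn w <= 2 ^+ k.+1 * (2 * rho).
  apply: le_trans wle _; rewrite -mulrA ler_wpM2l ?exprn_ge0 //.
  by have := exprn_ile1 k.+1 (andP ratio).1 (andP ratio).2; nra.
have pow_w c : 0 <= c -> vn w `^ c <= (2 `^ c) ^+ k.+1 * (2 `^ c * rho `^ c).
  move=> c0; rewrite -powRM ?(ltW rho0) // -powR_exprn // -powRM ?exprn_ge0 //; last first.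
    by rewrite mulr_ge0 // ltW.
  apply: ge0_ler_powR => //; rewrite ?nnegrE ?vnorm_ge0 ?mulr_ge0 ?exprn_ge0 ?(ltW rho0) //.
have half (b : 'rV[int]_d) : vn (b *+ 2) <= vn w + vn w `^ theta ->
    vn b <= 2 ^+ k * rho * (1 + (gamma / 2) ^+ k).
  rewrite vnormMn => hb.
  have h1 := pow_w _ theta_ge0; rewrite -/gamma in h1.
  have h2 : gamma ^+ 2 * rho `^ theta <= (2 - gamma) * rho.
    have := Mdom _ Mrho; rewrite powRr1 ?(ltW rho0) // mulrAC ler_pdivrMr ?subr_gt0 //.
    by rewrite [rho * _]mulrC.
  have g0 : 0 <= gamma ^+ k by rewrite exprn_ge0.
  have h3 : gamma ^+ k * (gamma ^+ 2 * rho `^ theta) <= gamma ^+ k * ((2 - gamma) * rho).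
    exact: ler_wpM2l.
  have p2 : (2 : R) ^+ k != 0 by rewrite expf_neq0.
  move: wle; rewrite !exprMn !exprVn.
  have -> : 2 ^+ k.+1 * rho * (1 + gamma ^+ k.+1 / 2 ^+ k.+1) =
     2 * 2 ^+ k * rho + gamma * gamma ^+ k * rho.
    by rewrite !exprS; field; rewrite p2.
  have -> : 2 ^+ k * rho * (1 + gamma ^+ k / 2 ^+ k) = 2 ^+ k * rho + gamma ^+ k * rho.
    by field.
  move: h1; rewrite exprS; move: h3; rewrite expr2 => h3 h1 wle.
  have e1 : gamma * gamma ^+ k * (gamma * rho `^ theta) = gamma ^+ k * (gamma * gamma * rho `^ theta) by ring.
  rewrite e1 in h1.
  have e2 : gamma ^+ k * ((2 - gamma) * rho) = 2 * (gamma ^+ k * rho) - gamma * gamma ^+ k * rho by ring.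
  rewrite e2 in h3; lra.
have ha : vn a <= 2 ^+ k * rho * (1 + (gamma / 2) ^+ k).
  apply: half; have -> : a *+ 2 = w + (a *+ 2 - w) by rewrite addrC subrK.
  by rewrite (le_trans (vnormD _ _ _)) // lerD2l.
have hwa : vn (w - a) <= 2 ^+ k * rho * (1 + (gamma / 2) ^+ k).
  apply: half; have -> : (w - a) *+ 2 = w - (a *+ 2 - w).
    by rewrite mulrnBl mulr2n opprB addrA.
  by rewrite (le_trans (vnormB _ _ _)) // lerD2l.
have [us [us_sum us_le us_cost]] := IH a ha.
have [ws [ws_sum ws_le ws_cost]] := IH (w - a) hwa.
exists (us ++ ws); split.
- by rewrite big_cat us_sum ws_sum /= addrC subrK.
- by move=> u; rewrite mem_cat => /orP[/us_le|/ws_le].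
rewrite big_cat /=.
have h := pow_w _ (ltW chi_gt0); rewrite -/beta in h.
have -> : A * rho `^ chi * (2 ^+ k.+1 - beta ^+ k.+1) =
    2 * (A * rho `^ chi * (2 ^+ k - beta ^+ k)) + beta ^+ k.+1 * (beta * rho `^ chi).
  rewrite /A !exprS; field; apply/eqP => e; move: beta_lt2; lra.
lra.
Qed.

(** Write [v] up to rounding as [K v1].  Since [f (2 ^ k v1) / 2 ^ k] nearly
    equals the time constant of [v1], the pieces of [2 ^ k v1] show that [v1] is
    a convex combination of vectors of its own size at which [f] nearly agrees
    with a supporting functional of the time constant.  A combination of at most
    [d + 1] of them suffices; taking integer parts in [K] times its coefficients
    leaves a remainder of norm at most [|v| / 2], for which the estimate is
    already known, and these losses form a geometric series. *)
Lemma nonrandom_fluctuation_bound :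
  exists2 A : R, 0 <= A & forall v, f v <= g v + A * (vn v `^ chi + 1).
Proof.
have [rho0 [A0 [rho0_gt0 A0_ge0 pieces]]] := dyadic_split.
(* With [8 (d + 1) <= K], a remainder made of at most [d + 1] pieces of norm at
   most [4 |v| / K] has norm at most [|v| / 2]. *)
pose J := (8 * d.+1)%N; pose K : R := 2 ^+ J.
have K8 : 8 * d.+1%:R <= K.
  by rewrite /K -natrM -natrX ler_nat ltnW // ltn_expl.
have K_gt0 : 0 < K by rewrite exprn_gt0.
pose c : R := 2^-1 `^ chi.
have c0 : 0 <= c by rewrite powR_ge0.
have c1 : c < 1.
  have := @gt0_ltr_powR R chi chi_gt0 2^-1 1; rewrite !nnegrE powR1.
  by apply=> //; rewrite invf_lt1 // ltr1n.
pose L := `|Cf|; have L0 : 0 <= L by exact: normr_ge0.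
have fL v : f v <= L * vn v.
  by apply: le_trans (f_le v) _; rewrite ler_wpM2r ?vnorm_ge0 // ler_norm.
(* [E] is the loss of one step of the induction, and [A1] solves
   [E + c A1 = A1]. *)
pose E := 2 * L * (K * d%:R) + 1 + K * A0 * (2 / K) `^ chi.
have E0 : 0 <= E.
  by rewrite !addr_ge0 ?mulr_ge0 ?powR_ge0 // ltW.
pose A1 := E / (1 - c); pose M1 := K * d%:R + K * rho0 + 2.
have A10 : 0 <= A1 by rewrite divr_ge0 // subr_ge0 ltW.
have M1_ge : [/\ 2 <= M1, K * d%:R <= M1 & K * rho0 <= M1].
  have h1 : 0 <= K * d%:R by rewrite mulr_ge0 // ltW.
  have h2 : 0 <= K * rho0 by rewrite mulr_ge0 // ltW.
  by rewrite /M1; split; lra.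
case: M1_ge => M1_ge2 M1_ged M1_gerho.
have B0 : 0 <= L * M1 by rewrite mulr_ge0 //; lra.
suff claim j v : vn v <= 2 ^+ j -> f v <= g v + A1 * vn v `^ chi + L * M1.
  exists (A1 + L * M1) => [|v]; first exact: addr_ge0.
  have [j vj] : exists j : nat, vn v <= 2 ^+ j.
    exists (Num.truncn (vn v)).+1; apply/ltW; apply: lt_trans (truncnS_gt _) _.
    by rewrite -natrX ltr_nat ltn_expl.
  apply: le_trans (claim j v vj) _; rewrite -addrA lerD2l.
  by have := powR_ge0 (vn v) chi; nra.
have small u : vn u < M1 -> f u <= g u + A1 * vn u `^ chi + L * M1.
  move=> uM; have := fL u; have := time_constant_ge0 u.
  have h1 : 0 <= A1 * vn u `^ chi by rewrite mulr_ge0 ?powR_ge0.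
  have h2 : L * vn u <= L * M1 by rewrite ler_wpM2l // ltW.
  lra.
elim: j v => [|j IH] v vj.
  by apply: small; move: vj; rewrite expr0; lra.
have [/small//|vM] := ltP (vn v) M1.
set r := vn v in vM *.
have r1 : 1 <= r by lra.
have r0 : 0 < r by lra.
have [v1 v1P] := round_vector (K^-1 *: rv v).
pose w := v - v1 *+ 2 ^ J.
have KE : (2 ^ J)%:R = K by rewrite natrX.
have wle : vn w <= K * d%:R.
  rewrite /vertex_norm /w to_realB to_realMn KE enormBC.
  have -> : K *: rv v1 - rv v = K *: (rv v1 - K^-1 *: rv v).
    by rewrite scalerBr scalerA divff ?scale1r // gt_eqF.
  by rewrite enormZ gtr0_norm // ler_pM2l.
pose rho := 2 * r / K.
have v1le : vn v1 <= rho.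
  rewrite /vertex_norm -(subrK (K^-1 *: rv v) (rv v1)).
  apply: le_trans (enormD _ _) _; rewrite enormZ gtr0_norm ?invr_gt0 //.
  rewrite -[euclidean_norm (rv v)]/r /rho.
  have : d%:R <= r / K by rewrite ler_pdivlMr // mulrC; lra.
  have -> : 2 * r / K = r / K + K^-1 * r by ring.
  lra.
have rho_ge : rho0 <= rho by rewrite ler_pdivlMr // mulrC; lra.
have rho_gt0 : 0 < rho by apply: lt_le_trans rho_ge.
have Ki : 0 < K^-1 by rewrite invr_gt0.
have [k kP] := time_constant_adherent v1 Ki.
have beta_k : 0 <= (gamma / 2) ^+ k by rewrite exprn_ge0 // divr_ge0 // gamma_ge0.
have p2 : 0 < (2 : R) ^+ k by rewrite exprn_gt0.
have [|us [us_sum us_le us_cost]] := pieces rho rho_ge k (v1 *+ 2 ^ k).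
  rewrite vnormMn natrX -mulrA ler_pM2l //.
  apply: le_trans v1le _; rewrite ler_pMr //; lra.
pose n := size us; pose U (i : 'I_n) := us`_i.
have Uus i : U i \in us by rewrite mem_nth.
have sumU (V : nmodType) (F : 'rV[int]_d -> V) :
  \sum_(u <- us) F u = \sum_i F (U i) by rewrite (big_nth 0) big_mkord.
have [] := @conic_caratheodory R n d (fun i => rv (U i)) (fun i => f (U i)) (fun=> K / 2 ^+ k).
  by move=> _; rewrite divr_ge0 // ltW.
move=> q [q0 q_sum q_cost q_supp].
have q_sum' : \sum_i q i *: rv (U i) = K *: rv v1.
  rewrite q_sum -scaler_sumr -(sumU _ (fun u => rv u)) -to_real_sum us_sum.
  by rewrite to_realMn natrX scalerA divfK // gt_eqF.
pose m i := Num.truncn (q i).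
have mP i : 0 <= q i - (m i)%:R < 1.
  by have := truncn_itv (q0 i); rewrite -natr1 -/(m i); lra.
pose x := v1 *+ 2 ^ J - \sum_i U i *+ m i.
have xE : rv x = \sum_i (q i - (m i)%:R) *: rv (U i).
  rewrite /x to_realB to_realMn KE to_real_sum -q_sum' -sumrB.
  by apply: eq_bigr => i _; rewrite to_realMn scalerBl.
have xle : vn x <= r / 2.
  rewrite /vertex_norm xE; apply: le_trans (enorm_sum _ _ _) _.
  rewrite (bigID (fun i => q i != 0)) /= [X in _ + X]big1 ?addr0; last first.
    move=> i /negPn/eqP qi; rewrite qi /m qi truncn0 subrr scale0r enorm0 //.
  apply: le_trans (_ : \sum_(i | q i != 0) 2 * rho <= _).
    apply: ler_sum => i _; rewrite enormZ; have /andP[h1 h2] := mP i.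
    rewrite ger0_norm //; apply: le_trans (us_le _ (Uus i)).
    by rewrite ler_piMl ?enorm_ge0 // ltW.
  rewrite sumr_const -[_ *+ _]mulr_natl.
  have h : #|(fun i => q i != 0)|%:R <= (d.+1%:R : R).
    rewrite ler_nat; apply: leq_trans q_supp; rewrite cardsE //.
  apply: le_trans (ler_wpM2r _ h) _; first by lra.
  have -> : d.+1%:R * (2 * rho) = 4 * d.+1%:R * r / K by rewrite /rho; ring.
  rewrite ler_pdivrMr //.
  have := ler_wpM2r (ltW r0) K8; lra.
have gx : g x <= \sum_i (q i - (m i)%:R) * f (U i).
  by apply: time_constant_conic => // i; case/andP: (mP i).
have fx := IH x _; have {}fx : f x <= g x + A1 * vn x `^ chi + L * M1.
  by apply: fx; apply: le_trans xle _; rewrite ler_pdivrMr // -exprSr.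
have fKv1 : f (v1 *+ 2 ^ J) <= \sum_i (m i)%:R * f (U i) + f x.
  rewrite -(subrK (\sum_i U i *+ m i) (v1 *+ 2 ^ J)) -/x addrC.
  by rewrite (le_trans (f_sub _ _)) // lerD2r subadd_sum.
have mg : \sum_i (m i)%:R * f (U i) + g x <= \sum_i q i * f (U i).
  apply: le_trans (lerD (lexx _) gx) _; rewrite -big_split /=.
  by apply: ler_sum => i _; rewrite -mulrDl addrC subrK.
have cost : \sum_i q i * f (U i) <= K * g v1 + 1 + K * A0 * rho `^ chi.
  apply: le_trans q_cost _; rewrite -mulr_sumr -(sumU _ f).
  rewrite mulrAC ler_pdivrMr //.
  have h1 : f (v1 *+ 2 ^ k) <= (g v1 + K^-1) * 2 ^+ k by rewrite -ler_pdivrMr // ltW.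
  have h2 : \sum_(u <- us) f u <= (g v1 + K^-1 + A0 * rho `^ chi) * 2 ^+ k.
    apply: le_trans us_cost _.
    have : A0 * rho `^ chi * (2 ^+ k - beta ^+ k) <= A0 * rho `^ chi * 2 ^+ k.
      rewrite ler_wpM2l ?mulr_ge0 ?powR_ge0 // lerBlDr lerDl exprn_ge0 // ltW //.
    lra.
  apply: le_trans (ler_wpM2l (ltW K_gt0) h2) _; rewrite le_eqVlt; apply/orP; left.
  by apply/eqP; field; rewrite gt_eqF.
have gK : K * g v1 <= g v + L * (K * d%:R).
  apply: le_trans (time_constant_pow _ _) _.
  have -> : v1 *+ 2 ^ J = v + (- w) by rewrite /w opprB addrC subrK.
  apply: le_trans (time_constantD _ _) _; rewrite lerD2l.
  by apply: le_trans (fL _) _; rewrite vnormN ler_wpM2l.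
have fw : f v <= f (v1 *+ 2 ^ J) + L * (K * d%:R).
  rewrite -{1}(subrK (v1 *+ 2 ^ J) v) addrC (le_trans (f_sub _ _)) // lerD2l.
  by apply: le_trans (fL _) _; rewrite ler_wpM2l.
have xchi : vn x `^ chi <= c * r `^ chi.
  rewrite /c -powRM ?(ltW r0) // mulrC; apply: ge0_ler_powR; rewrite ?nnegrE ?vnorm_ge0 //.
  - exact: ltW.
  - by rewrite divr_ge0 // ltW.
have rchi1 : 1 <= r `^ chi.
  have h := @ge0_ler_powR R chi (ltW chi_gt0) 1 r.
  by rewrite powR1 in h; apply: h => //; rewrite nnegrE ltW.
have rhochi : rho `^ chi = (2 / K) `^ chi * r `^ chi.
  rewrite /rho -mulrA [r / K]mulrC mulrA powRM // ?(ltW r0) // divr_ge0 // ltW //.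
have last : E * r `^ chi + A1 * (c * r `^ chi) = A1 * r `^ chi.
  rewrite /A1; field; rewrite gt_eqF // subr_gt0 //.
have h1 : A1 * vn x `^ chi <= A1 * (c * r `^ chi) by rewrite ler_wpM2l.
have h2 : 2 * L * (K * d%:R) + 1 <= (2 * L * (K * d%:R) + 1) * r `^ chi.
  rewrite ler_peMr // addr_ge0 // !mulr_ge0 // ltW //.
rewrite -last /E; rewrite rhochi in cost; lra.
Qed.

End splitting.
End nonrandom_fluctuations.

(** * Flat vertices *)

(** A vertex [v] at scale [m] is flat when moving by [y], nearly orthogonally to
    [v], from any point [v + u] near [v] raises [f] by no more than the curvature
    term [(|u| + |y|) ^ 2 / m] and an error [m `^ eta]. *)
Definition has_flat_vertices (R : realType) (d : nat) (f : 'rV[int]_d -> R) (eta : R) : Prop :=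
  exists C c1 M : R, [/\ 0 < c1, 1 <= M, 0 <= C & forall m, M <= m ->
    exists v, [/\ c1 * m <= vertex_norm R v, vertex_norm R v <= C * m &
      forall u y, vertex_norm R u <= m -> vertex_norm R y <= m ->
        `|dot (to_real R v) (to_real R y)| <= d%:R * vertex_norm R v ->
        f (v + u + y) <= f (v + u) +
          C * (m `^ eta + (vertex_norm R u + vertex_norm R y) ^+ 2 / m)]].

Section flat_vertex.
Variables (R : realType) (d : nat).
Implicit Types (u v w : 'rV[int]_d).
Local Notation rv := (@to_real R d).
Local Notation vn := (@vertex_norm R d).
Variables (f : 'rV[int]_d -> R) (Cf A chi : R).
Hypothesis f_ge0 : forall v, 0 <= f v.
Hypothesis f_sub : forall u v, f (u + v) <= f u + f v.
Hypothesis f_le : forall v, f v <= Cf * vn v.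
Local Notation g := (time_constant f).
Hypotheses (chi_gt0 : 0 < chi) (A0 : 0 <= A).
Hypothesis fg : forall v, f v <= g v + A * (vn v `^ chi + 1).

(** The vertex [v] maximizes [f w - |w| ^ 2 / m], so that [f (v + z)] lies below
    the paraboloid touching the graph of [f] at [v].  The nonrandom fluctuation
    bound gives [f (v + u) + f (v - u) >= f (2 v) >= 2 f v - O(m `^ chi)], which
    turns the upper bound at [v - u] into a matching lower bound at [v + u].
    When the time constant vanishes identically, [f] itself is [O(m `^ chi)] and
    any vertex will do. *)
Lemma flat_vertex : (0 < d)%N -> has_flat_vertices f chi.
Proof.
move=> d_gt0.
have powle a b : 0 <= a -> a <= b -> a `^ chi <= b `^ chi.
  move=> a0 ab; apply: ge0_ler_powR; rewrite ?nnegrE ?(ltW chi_gt0) //.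
  exact: le_trans ab.
have pow1 m : 1 <= m -> 1 <= m `^ chi by move=> /(powle 1 m ler01); rewrite powR1.
have [g0|] := pselect (forall w, g w = 0).
  exists (A * (3 `^ chi + 1) + 1), (1 / 2), 2; split; [lra|lra| |].
    by rewrite addr_ge0 // mulr_ge0 // addr_ge0 ?powR_ge0.
  move=> m m2; have m0 : 0 <= m by lra.
  pose v : 'rV[int]_d := delta_mx 0 (Ordinal d_gt0) *+ Num.truncn m.
  have [mlo mhi] := andP (truncn_itv m0); rewrite -natr1 in mhi.
  have vE : vn v = (Num.truncn m)%:R by rewrite vnormMn vnorm_delta mulr1.
  have C0 : 0 <= A * (3 `^ chi + 1) by rewrite mulr_ge0 // addr_ge0 ?powR_ge0.
  exists v; rewrite vE; split; [lra|nra|move=> u y um ym _].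
  have le3 : vn (v + u + y) <= 3 * m.
    have := vnormD R (v + u) y; have := vnormD R v u; rewrite vE; lra.
  have := fg (v + u + y); rewrite g0 add0r.
  have := powle _ _ (vnorm_ge0 R _) le3; rewrite powRM //.
  have := pow1 m; have := f_ge0 (v + u).
  set X := vn (v + u + y) `^ chi; set t := m `^ chi; set s := 3 `^ chi => h1 h2 h3 h4.
  have t1 : 1 <= t by apply: h2; lra.
  have s0 : 0 <= s by rewrite powR_ge0.
  have q0 : 0 <= (vn u + vn y) ^+ 2 / m by rewrite divr_ge0 ?sqr_ge0.
  have h5 : A * (X + 1) <= A * (s * t + t) by rewrite ler_wpM2l //; lra.
  have h6 : 0 <= A * (s + 1) * ((vn u + vn y) ^+ 2 / m) by rewrite mulr_ge0.
  lra.
move=> /existsNP[w0 gw0]; have {gw0} g0 : 0 < g w0.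
  by rewrite lt_def (time_constant_ge0 f_ge0) andbT; apply/eqP.
set g0' := g w0 in g0.
have w0_gt0 : 0 < vn w0.
  apply: vnorm_gt0; apply/eqP => w00; move: g0; rewrite /g0' w00 ltNge.
  by rewrite (le_trans (time_constant_le f_ge0 _ 0)) // expr0 divr1 mulr1n (subadd0 f_ge0 f_le).
pose L := `|Cf| + 1; have L1 : 1 <= L by rewrite lerDr normr_ge0.
have fL v : f v <= L * vn v.
  apply: le_trans (f_le v) _; rewrite ler_wpM2r ?vnorm_ge0 //.
  by rewrite (le_trans (ler_norm Cf)) // lerDl.
pose N0 := vn w0 ^+ 2; have N0_gt0 : 0 < N0 by rewrite exprn_gt0.
pose c := g0' ^+ 2 / (8 * N0); have c_gt0 : 0 < c.
  by rewrite divr_gt0 ?exprn_gt0 // mulr_gt0.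
pose C := L + 2 * d%:R * L + 2 + 2 * A * (L `^ chi + 1).
have C_ge : [/\ L <= C, 2 * d%:R * L <= C, 2 <= C & 2 * A * (L `^ chi + 1) <= C].
  have h1 : 0 <= 2 * d%:R * L by rewrite !mulr_ge0 //; lra.
  have h2 : 0 <= 2 * A * (L `^ chi + 1) by rewrite !mulr_ge0 // addr_ge0 ?powR_ge0.
  by rewrite /C; split; lra.
exists C, (c / L), (Num.max 1 (2 * N0 / g0')); split.
- by rewrite divr_gt0 //; lra.
- by rewrite le_max lexx.
- by case: C_ge; lra.
move=> m; rewrite ge_max => /andP[m1 mg]; have m0 : 0 < m by lra.
pose h w := f w - vn w ^+ 2 / m.
(* As [f w] grows linearly along the multiples of [w0], at a distance of order [m]
   it exceeds [|w| ^ 2 / m] by a quantity of order [m]. *)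
have [k hk] : exists k, c * m <= h (w0 *+ 2 ^ k).
  pose t := g0' * m / (2 * N0).
  have t1 : 1 <= t.
    move: mg; rewrite ler_pdivrMr // => mg.
    by rewrite ler_pdivlMr ?mulr_gt0 // mul1r [g0' * m]mulrC.
  have [k /andP[klo khi]] : exists k : nat, 2 ^+ k <= t < 2 ^+ k.+1.
    exists (trunc_log 2 (Num.truncn t)).
    have tr : (0 < Num.truncn t)%N by rewrite truncn_gt0.
    have /andP[lo hi] := trunc_log_bounds (isT : (1 < 2)%N) tr.
    have /andP[h1 h2] := truncn_itv (le_trans ler01 t1).
    rewrite -!natrX (le_trans _ h1) ?ler_nat //=.
    by apply: lt_le_trans h2 _; rewrite ler_nat.
  exists k; rewrite /h vnormMn natrX exprMn -/N0.
  have h1 : 2 ^+ k * g0' <= f (w0 *+ 2 ^ k).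
    by rewrite mulrC -ler_pdivlMr ?exprn_gt0 // (time_constant_le f_ge0).
  set p := 2 ^+ k in klo h1 *; have p0 : 0 < p by rewrite exprn_gt0.
  have h2 : p ^+ 2 * N0 / m <= p * (g0' / 2).
    rewrite ler_pdivrMr // expr2 -!mulrA ler_pM2l //.
    move: klo; rewrite ler_pdivlMr ?mulr_gt0 //; lra.
  have h3 : c * m <= p * (g0' / 2).
    have -> : c * m = t / 2 * (g0' / 2) by rewrite /c /t; field; rewrite gt_eqF.
    rewrite ler_pM2r ?divr_gt0 //; move: khi; rewrite exprS -/p; lra.
  lra.
pose r := (Num.truncn (L * m)).+1.
have rP : L * m < r%:R by exact: truncnS_gt.
have outside w : w \notin cube d r -> h w <= 0.
  move=> wr; have {}wr : L * m < vn w.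
    apply: lt_trans rP _; rewrite ltNge; apply: contra wr; exact: mem_cube.
  rewrite /h subr_le0 ler_pdivlMr //; apply: le_trans (_ : L * m * vn w <= _).
    by rewrite mulrAC ler_pM2r.
  by rewrite expr2 ler_wpM2r ?vnorm_ge0 // ltW.
have [|v [_ vmax]] := seq_argmax (s := cube d r) h.
  by apply/eqP => e; have := size_cube d r; rewrite e /= => /esym/eqP; rewrite expn_eq0.
have cm_gt0 : 0 < c * m by rewrite mulr_gt0.
have hv : c * m <= h v.
  apply: (le_trans hk); apply: vmax; apply/negPn/negP => /outside.
  by rewrite leNgt (lt_le_trans cm_gt0 hk).
have {}vmax w : h w <= h v.
  have [/vmax//|/outside ho] := boolP (w \in cube d r).
  by apply: le_trans ho _; apply: le_trans hv; exact: ltW.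
have v_ge0 := vnorm_ge0 R v.
have q_ge0 : 0 <= vn v ^+ 2 / m by rewrite divr_ge0 ?sqr_ge0 // ltW.
have vlo : c / L * m <= vn v.
  rewrite mulrAC ler_pdivrMr; last by lra.
  rewrite mulrC; have := fL v; move: hv; rewrite /h; lra.
have v_gt0 : 0 < vn v by apply: lt_le_trans vlo; rewrite mulr_gt0 // divr_gt0 //; lra.
have vhi : vn v <= L * m.
  have : vn v ^+ 2 / m <= L * vn v by have := fL v; move: hv; rewrite /h; lra.
  by rewrite ler_pdivrMr // expr2 mulrAC ler_pM2r.
case: C_ge => C1 C2 C3 C4.
exists v; split => //; first by apply: le_trans vhi _; rewrite ler_pM2r.
move=> u y _ _ orth.
have upper z : f (v + z) <= f v + (2 * dot (rv v) (rv z) + vn z ^+ 2) / m.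
  have := vmax (v + z); rewrite /h sqr_vnormD.
  have -> : (vn v ^+ 2 + 2 * dot (rv v) (rv z) + vn z ^+ 2) / m =
    vn v ^+ 2 / m + (2 * dot (rv v) (rv z) + vn z ^+ 2) / m by ring.
  lra.
have up1 := upper (u + y); have up2 := upper (- u).
rewrite to_realN dotNr vnormN in up2; rewrite to_realD dotDr in up1.
have mid : f (v *+ 2) <= f (v + u) + f (v - u).
  have -> : v *+ 2 = (v + u) + (v - u) by rewrite addrACA subrr addr0 -mulr2n.
  exact: f_sub.
have dbl := time_constant_double f_ge0 v; rewrite ler_pdivlMr // in dbl.
have fgv := fg v.
have vchi : vn v `^ chi <= L `^ chi * m `^ chi.
  by rewrite -powRM; [exact: powle|lra|exact: ltW].
have m1chi := pow1 m m1.
have sq : vn (u + y) ^+ 2 <= (vn u + vn y) ^+ 2.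
  by rewrite ler_pXn2r ?nnegrE ?addr_ge0 ?vnorm_ge0 // vnormD.
have squ : vn u ^+ 2 <= (vn u + vn y) ^+ 2.
  by rewrite ler_pXn2r ?nnegrE ?addr_ge0 ?vnorm_ge0 // lerDl vnorm_ge0.
have ydot : 2 * dot (rv v) (rv y) / m <= 2 * d%:R * L.
  rewrite ler_pdivrMr // -!mulrA ler_pM2l //; apply: le_trans (ler_norm _) _.
  by apply: le_trans orth _; rewrite ler_wpM2l.
have sq2 : (vn (u + y) ^+ 2 + vn u ^+ 2) / m <= 2 * ((vn u + vn y) ^+ 2 / m).
  rewrite mulrA ler_pM2r ?invr_gt0 //; lra.
rewrite -addrA.
set S := (vn u + vn y) ^+ 2 / m in sq2 *.
have S0 : 0 <= S by rewrite /S divr_ge0 ?sqr_ge0 // ltW.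
have e1 : (2 * (dot (rv v) (rv u) + dot (rv v) (rv y)) + vn (u + y) ^+ 2) / m +
   (2 * - dot (rv v) (rv u) + vn u ^+ 2) / m =
   2 * dot (rv v) (rv y) / m + (vn (u + y) ^+ 2 + vn u ^+ 2) / m by ring.
have h1 : 2 * A * (vn v `^ chi + 1) <= 2 * A * (L `^ chi + 1) * m `^ chi.
  rewrite -[leRHS]mulrA ler_wpM2l ?mulr_ge0 //; lra.
have h2 : 2 * d%:R * L <= 2 * d%:R * L * m `^ chi.
  by rewrite ler_peMr // !mulr_ge0 //; lra.
have h3 : C * (m `^ chi + S) = L * m `^ chi + 2 * d%:R * L * m `^ chi + 2 * m `^ chi
   + 2 * A * (L `^ chi + 1) * m `^ chi + C * S by rewrite /C; ring.
have h4 : 2 * S <= C * S by rewrite ler_wpM2r.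
have h5 : 0 <= L * m `^ chi by rewrite mulr_ge0 ?powR_ge0 //; lra.
rewrite h3; lra.
Qed.

End flat_vertex.

(** * Lattice paths and passage times *)

Section lattice_paths.
Variable d : nat.
Implicit Types (x y z : 'rV[int]_d) (e f : edge d) (g h : seq (edge d)).

Definition link e x y : bool :=
  ((x == e.1) && (y == e.1 + delta_mx 0 e.2)) ||
  ((y == e.1) && (x == e.1 + delta_mx 0 e.2)).

Lemma mem_endpoints e z : (z \in endpoints e) = (z == e.1) || (z == e.1 + delta_mx 0 e.2).
Proof. by rewrite !inE. Qed.

Lemma link_mem e x y z : link e x y -> (z \in endpoints e) = (z == x) || (z == y).
Proof. by rewrite mem_endpoints; case/orP=> /andP[/eqP -> /eqP ->] //; rewrite orbC. Qed.

Lemma endpoints_link e x y :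
  x \in endpoints e -> y \in endpoints e -> x = y \/ link e x y.
Proof.
rewrite !mem_endpoints /link.
by case/orP=> /eqP ->; case/orP=> /eqP ->; rewrite ?eqxx ?orbT; auto.
Qed.

Lemma share_one_endpointP e f :
  share_one_endpoint e f -> exists2 z, z \in endpoints e & z \in endpoints f.
Proof. by move/eqP=> h; apply/hasP; rewrite has_count h. Qed.

Definition adj g x y := has (fun e => link e x y) g.

(** Chains of linked vertices, which unlike paths of edges can be concatenated
    freely. *)
Definition conn g x y := exists2 p, path (adj g) x p & last x p = y.

Lemma conn_refl g x : conn g x x.
Proof. by exists [::]. Qed.

Lemma conn_trans g x y z : conn g x y -> conn g y z -> conn g x z.
Proof.
move=> [p pp <-] [q qq <-]; exists (p ++ q); last by rewrite last_cat.
by rewrite cat_path pp.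
Qed.

Lemma conn_sub g h x y : {subset g <= h} -> conn g x y -> conn h x y.
Proof.
move=> gh [p pp <-]; exists p => //; apply: sub_path pp => a b.
by case/hasP=> e eg ab; apply/hasP; exists e => //; apply: gh.
Qed.

Lemma conn_endpoints g e x y :
  e \in g -> x \in endpoints e -> y \in endpoints e -> conn g x y.
Proof.
move=> eg xe ye; have [->|l] := endpoints_link xe ye; first exact: conn_refl.
by exists [:: y] => //=; rewrite andbT; apply/hasP; exists e.
Qed.

Lemma path_conn g x y : is_path g -> visits g x -> visits g y -> conn g x y.
Proof.
elim: g x y => // e [|f g] IH x y.
  by move=> _; rewrite /visits /= !orbF => xe ye; apply: (conn_endpoints (mem_head _ _)).
rewrite /is_path /= => /andP[/share_one_endpointP[z ze zf] pg].
have sub : {subset f :: g <= e :: f :: g} by move=> a ag; rewrite inE ag orbT.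
have zg : visits (f :: g) z by rewrite /visits /= zf.
have toz a : visits (e :: f :: g) a -> conn (e :: f :: g) a z /\ conn (e :: f :: g) z a.
  rewrite {1}/visits /= => /orP[ae|ag].
    by split; apply: (conn_endpoints (mem_head _ _)).
  by split; apply: (conn_sub sub); apply: IH.
by move=> /toz[xz _] /toz[_ zy]; apply: conn_trans zy.
Qed.

Lemma path_containing_conn g x y : path_containing x y g -> conn g x y.
Proof.
by case: g => [/eqP ->|e g /and3P[]]; [exact: conn_refl|exact: path_conn].
Qed.

(** Three successive edges of a path may meet at a single vertex, so a path need
    not run through its vertices in order.  A walk does, and when its vertices
    are distinct any segment of it is again a path. *)
Fixpoint walk x g (p : seq 'rV[int]_d) : bool :=
  match g, p with
  | [::], [::] => true
  | e :: g', y :: p' => link e x y && walk y g' p'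
  | _, _ => false
  end.

Lemma path_adj_walk g x p :
  path (adj g) x p -> exists2 h, walk x h p & {subset h <= g}.
Proof.
elim: p x => [|y p IH] x /=; first by exists [::].
case/andP=> /hasP[e eg exy] /IH[h hw hg]; exists (e :: h) => /=; first by rewrite exy.
by move=> a; rewrite inE => /orP[/eqP ->//|/hg].
Qed.

Lemma walk_endpoints x g p e z :
  walk x g p -> e \in g -> z \in endpoints e -> z \in x :: p.
Proof.
elim: g x p => // f g IH x [|y p] //= /andP[fxy w].
rewrite inE => /orP[/eqP ->|eg] ze.
  by move: ze; rewrite (link_mem _ fxy) !inE => /orP[]->; rewrite ?orbT.
by rewrite inE (IH y p w eg ze) orbT.
Qed.

Lemma walk_uniq x g p : walk x g p -> uniq (x :: p) -> uniq g.
Proof.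
elim: g x p => // e g IH x [|y p] //= /andP[exy w] /andP[xp up].
rewrite (IH y p w up) andbT; apply: contra xp => eg.
by apply: (walk_endpoints w eg); rewrite (link_mem _ exy) eqxx.
Qed.

Lemma walk_visits x g p z : walk x g p -> g != [::] -> z \in x :: p -> visits g z.
Proof.
elim: g x p => // e g IH x [|y p] //= /andP[exy w] _.
rewrite inE => /orP[/eqP ->|zp].
  by rewrite /visits /= (link_mem _ exy) eqxx.
rewrite /visits /=; have [g0|gN0] := eqVneq g [::].
  move: w zp; rewrite g0; case: p => // _; rewrite inE => /eqP ->.
  by rewrite (link_mem _ exy) eqxx orbT.
by apply/orP; right; apply: IH w gN0 zp.
Qed.

Lemma walk_is_path x g p : walk x g p -> uniq (x :: p) -> is_path g.
Proof.
elim: g x p => // e [|f g] IH x [|y [|z p]] //; first by rewrite /= andbF.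
move=> /= /andP[exy /andP[fyz w]] /andP[xyzp uyzp].
rewrite /is_path /=; apply/andP; split; last first.
  by apply: (IH y (z :: p)); rewrite //= fyz.
have xf : x \notin endpoints f.
  by move: xyzp; rewrite (link_mem _ fyz) !inE !negb_or => /and3P[-> ->].
have yf : y \in endpoints f by rewrite (link_mem _ fyz) eqxx.
rewrite /share_one_endpoint /=.
by case/orP: exy => /andP[/eqP <- /eqP <-]; rewrite (negPf xf) yf.
Qed.

Lemma walk_nil x g p : walk x g p -> (g == [::]) = (p == [::]).
Proof. by case: g p => [|e g] [|y p]. Qed.

Lemma walk_containing x g p :
  walk x g p -> uniq (x :: p) -> path_containing x (last x p) g.
Proof.
move=> w up; have gp := walk_nil w.
case: g w gp => [|e g] w gp; first by case: p w {gp up}; rewrite //= eqxx.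
rewrite /path_containing (walk_is_path w up) !(walk_visits w) ?mem_last //.
exact: mem_head.
Qed.

Lemma conn_walk g x y : conn g x y -> exists h p,
  [/\ walk x h p, uniq (x :: p), last x p = y & {subset h <= g}].
Proof.
move=> [p pp <-]; case/shortenP: pp => q /path_adj_walk[h hw hg] uq _.
by exists h, q.
Qed.

Lemma conn_containing g x y : conn g x y -> exists h,
  [/\ path_containing x y h, uniq h & {subset h <= g}].
Proof.
move/conn_walk=> [h [p [hw up <- hg]]]; exists h; split => //.
  exact: walk_containing.
exact: walk_uniq up.
Qed.

(** The infimum defining a passage time is taken over a nonempty set. *)
Lemma lattice_connected x y : exists g, path_containing x y g.
Proof.
pose C a b := exists g, conn g a b.
have Ctrans a b c : C a b -> C b c -> C a c.
  move=> [g gab] [h hbc]; exists (g ++ h); apply: (conn_trans (y := b)).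
    by apply: conn_sub gab => e; rewrite mem_cat => ->.
  by apply: conn_sub hbc => e; rewrite mem_cat orbC => ->.
have step a (i : 'I_d) : C a (a + delta_mx 0 i) /\ C (a + delta_mx 0 i) a.
  by split; exists [:: (a, i)]; apply: (conn_endpoints (mem_head _ _));
     rewrite mem_endpoints eqxx ?orbT.
have line a (i : 'I_d) (n : nat) : C a (a + delta_mx 0 i *+ n) /\ C a (a - delta_mx 0 i *+ n).
  elim: n => [|n [IH1 IH2]]; first by rewrite mulr0n subr0 addr0; split; exists [::]; exact: conn_refl.
  rewrite !mulrSr; split; first by apply: Ctrans IH1 _; rewrite addrA; case: (step (a + delta_mx 0 i *+ n) i).
  apply: Ctrans IH2 _; case: (step (a - (delta_mx 0 i *+ n + delta_mx 0 i)) i) => _.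
  by rewrite opprD addrA subrK.
have coord a (i : 'I_d) (k : int) : C a (a + k *: delta_mx 0 i).
  have [h1 h2] := line a i `|k|%N; rewrite (intEsign k).
  have -> (b : bool) : ((-1) ^+ b * `|k|%N%:Z) *: delta_mx 0 i =
     (-1) ^+ b *: (delta_mx 0 i *+ `|k|%N) :> 'rV[int]_d.
    by rewrite -scalerA -scaler_nat natz.
  by case: (k < 0); rewrite ?expr0 ?scale1r ?expr1 ?scaleN1r.
suff : C x y by move=> [g /conn_containing[h [hc _ _]]]; exists h.
have -> : y = x + \sum_i (y - x) 0 i *: delta_mx 0 i.
  by rewrite -row_sum_delta addrC subrK.
apply: (big_ind (fun s => forall a, C a (a + s))).
- by move=> a; rewrite addr0; exists [::]; exact: conn_refl.
- by move=> s1 s2 h1 h2 a; rewrite addrA; apply: Ctrans (h1 a) (h2 _).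
- by move=> i _ a; apply: coord.
Qed.

Definition shift_edge z e : edge d := (e.1 + z, e.2).

Lemma endpoints_shift z e : endpoints (shift_edge z e) = [seq a + z | a <- endpoints e].
Proof. by rewrite /endpoints /= addrAC. Qed.

Lemma mem_endpoints_shift z e x : (x + z \in endpoints (shift_edge z e)) = (x \in endpoints e).
Proof. by rewrite endpoints_shift (mem_map (addIr z)). Qed.

Lemma share_one_endpoint_shift z e f :
  share_one_endpoint (shift_edge z e) (shift_edge z f) = share_one_endpoint e f.
Proof.
rewrite /share_one_endpoint (endpoints_shift z e) count_map; congr (_ == _).
by apply: eq_count => a; rewrite /= mem_endpoints_shift.
Qed.

Lemma visits_shift z g x : visits (map (shift_edge z) g) (x + z) = visits g x.
Proof.
by rewrite /visits has_map; apply: eq_has => e; rewrite /= mem_endpoints_shift.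
Qed.

Lemma path_containing_shift z g x y :
  path_containing (x + z) (y + z) (map (shift_edge z) g) = path_containing x y g.
Proof.
case: g => [|e g]; first by rewrite /= (inj_eq (addIr z)).
set h := e :: g; have -> : path_containing (x + z) (y + z) (map (shift_edge z) h) =
  [&& is_path (map (shift_edge z) h), visits (map (shift_edge z) h) (x + z)
    & visits (map (shift_edge z) h) (y + z)] by [].
rewrite !visits_shift /path_containing /h; congr [&& _, _ & _].
rewrite /is_path /= path_map; apply: eq_path => a b; exact: share_one_endpoint_shift.
Qed.

Lemma shift_edgeK z : cancel (shift_edge z) (shift_edge (- z)).
Proof. by case=> a i; rewrite /shift_edge /= addrK. Qed.

Lemma shift_edgeNK z : cancel (shift_edge (- z)) (shift_edge z).
Proof. by case=> a i; rewrite /shift_edge /= subrK. Qed.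

End lattice_paths.

Section passage_times.
Variables (R : realType) (d : nat).
Implicit Types (x y z : 'rV[int]_d) (e f : edge d) (g h : seq (edge d)).

Lemma path_time_shift (t : edge d -> R) z g :
  path_time t (map (shift_edge z) g) = path_time (fun e => t (shift_edge z e)) g.
Proof. by rewrite /path_time big_map. Qed.

Lemma passage_time_shift (t : edge d -> R) x y z :
  passage_time t (x + z) (y + z) = passage_time (fun e => t (shift_edge z e)) x y.
Proof.
rewrite /passage_time; congr inf; apply/seteqP; split=> _ [g gp <-].
  exists (map (shift_edge (- z)) g).
    rewrite /= -(path_containing_shift z) -map_comp map_id_in // => e _.
    exact: shift_edgeNK.
  rewrite -path_time_shift -map_comp map_id_in // => e _; exact: shift_edgeNK.
exists (map (shift_edge z) g); first by rewrite /= path_containing_shift.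
exact: path_time_shift.
Qed.

Variable t : edge d -> R.
Hypothesis t_ge0 : forall e, 0 <= t e.
Local Notation T := (passage_time t).

Lemma path_time_ge0 g : 0 <= path_time t g.
Proof. by apply: sumr_ge0. Qed.

Lemma path_time_cat g h : path_time t (g ++ h) = path_time t g + path_time t h.
Proof. by rewrite /path_time big_cat. Qed.

Lemma path_time_sub g h : uniq g -> {subset g <= h} -> path_time t g <= path_time t h.
Proof.
rewrite /path_time; elim: g h => [|e g IH] h /=; first by rewrite big_nil sumr_ge0.
case/andP=> eg ug gh; have eh : e \in h by apply: gh; rewrite mem_head.
rewrite (perm_big _ (perm_to_rem eh)) !big_cons lerD2l IH // => a ag.
have := gh a; rewrite inE ag orbT (perm_mem (perm_to_rem eh)) inE => /(_ isT).
by case/orP=> // /eqP ae; move: eg; rewrite -ae ag.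
Qed.

Lemma passage_le x y g : path_containing x y g -> T x y <= path_time t g.
Proof.
move=> gp; apply: ge_inf; last by exists g.
by exists 0 => _ [h _ <-]; exact: path_time_ge0.
Qed.

Lemma le_passage x y c :
  (forall g, path_containing x y g -> c <= path_time t g) -> c <= T x y.
Proof.
move=> h; apply: lb_le_inf; last by move=> _ [g /h ? <-].
by have [g gp] := lattice_connected x y; exists (path_time t g), g.
Qed.

Lemma passage_ge0 x y : 0 <= T x y.
Proof. by apply: le_passage => g _; exact: path_time_ge0. Qed.

Lemma passage_ltP x y c : T x y < c <-> exists2 g, path_containing x y g & path_time t g < c.
Proof.
split=> [|[g gp]]; last exact/le_lt_trans/passage_le.
move=> lt; apply/not_exists2P => h; move: lt; apply/negP; rewrite -leNgt.
by apply: le_passage => g gp; rewrite leNgt; apply/negP => gc; case: (h g).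
Qed.

Lemma passage_self x : T x x = 0.
Proof.
apply/eqP; rewrite eq_le passage_ge0 andbT.
by have := @passage_le x x [::] (eqxx x); rewrite /path_time big_nil.
Qed.

Lemma passage_triangle x y z : T x z <= T x y + T y z.
Proof.
rewrite -lerBlDr; apply: le_passage => g gp; rewrite lerBlDr -lerBlDl.
apply: le_passage => h hp; rewrite lerBlDl -path_time_cat.
have /conn_containing[k [kp uk ksub]] : conn (g ++ h) x z.
  apply: (conn_trans (y := y)).
    apply: conn_sub (path_containing_conn gp) => e; by rewrite mem_cat => ->.
  by apply: conn_sub (path_containing_conn hp) => e; rewrite mem_cat orbC => ->.
by apply: le_trans (passage_le kp) _; apply: path_time_sub.
Qed.

Lemma walk_hit (L : 'rV[int]_d -> R) (c : R) x g p :
  (forall e a b, link e a b -> L b <= L a + 1) ->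
  walk x g p -> L x <= c + 1 -> c <= L (last x p) ->
  exists g1 g2 p1 p2, [/\ g = g1 ++ g2 /\ p = p1 ++ p2, walk x g1 p1,
    walk (last x p1) g2 p2 & c <= L (last x p1) <= c + 1].
Proof.
move=> Lstep; elim: p x g => [|y p IH] x g.
  case: g => // _ xc cx; exists [::], [::], [::], [::]; split => //=; by rewrite cx.
case: g => //= e g /andP[exy w] xc cl; have [cx|xc'] := leP c (L x).
  by exists [::], (e :: g), [::], (y :: p); rewrite /= exy cx.
have [|//|g1 [g2 [p1 [p2 [[-> ->] w1 w2 h]]]]] := IH y g w _.
  by apply: le_trans (Lstep _ _ _ exy) _; rewrite lerD2r ltW.
by exists (e :: g1), g2, (y :: p1), p2; rewrite /= exy.
Qed.

(** A path from [x] to [y] crosses the level sets [c1 <= c2] of a functional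
    that varies by at most one along an edge; cutting it at the crossings
    bounds its time from below. *)
Lemma path_time_split (L : 'rV[int]_d -> R) (c1 c2 : R) x y g :
  (forall e a b, link e a b -> L b <= L a + 1) ->
  path_containing x y g -> x != y -> L x <= c1 -> c1 <= c2 -> c2 <= L y ->
  exists a b, [/\ visits g a, visits g b, c1 <= L a <= c1 + 1,
    c2 <= L b <= c2 + 1 & T x a + T a b + T b y <= path_time t g].
Proof.
move=> Lstep /path_containing_conn/conn_walk[h [p [w up lp hg]]] xy Lx c12 Ly.
have [||g1 [g2 [p1 [p2 [[eg ep] w1 w2 La]]]]] := walk_hit (c := c1) Lstep w.
- by rewrite (le_trans Lx) // lerDl.
- by rewrite lp (le_trans c12).
have lp2 : last (last x p1) p2 = y by rewrite -last_cat -ep.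
have [||g3 [g4 [p3 [p4 [[eg2 ep2] w3 w4 Lb]]]]] := walk_hit (c := c2) Lstep w2.
- by case/andP: La => _ /le_trans; apply; rewrite lerD2r.
- by rewrite lp2.
set a := last x p1 in w2 w3 w4 lp2 La Lb *; set b := last a p3 in w4 Lb *.
have upa : uniq (a :: p2).
  by move: up; rewrite ep -cat_cons lastI cat_rcons cat_uniq => /and3P[].
have upb : uniq (b :: p4).
  by move: upa; rewrite ep2 -cat_cons lastI cat_rcons cat_uniq => /and3P[].
have up1 : uniq (x :: p1) by move: up; rewrite ep -cat_cons cat_uniq => /and3P[].
have up3 : uniq (a :: p3) by move: upa; rewrite ep2 -cat_cons cat_uniq => /and3P[].
have hN : h != [::].
  by rewrite (walk_nil w); apply: contra xy => /eqP p0; rewrite -lp p0.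
have vis z : z \in x :: p -> visits g z.
  by move=> /(walk_visits w hN)/hasP[e /hg eg' ze]; apply/hasP; exists e.
have ap : a \in x :: p by rewrite ep -cat_cons mem_cat mem_last.
exists a, b; split => //; first exact: vis.
  apply: vis; rewrite ep ep2 catA -cat_cons mem_cat.
  by rewrite /b /a -last_cat mem_last.
apply: le_trans (_ : path_time t h <= _); last first.
  by apply: path_time_sub => //; apply: walk_uniq up.
rewrite eg eg2 !path_time_cat addrA !lerD //.
- by apply: passage_le; apply: walk_containing.
- by apply: passage_le; apply: walk_containing.
- have -> : y = last b p4 by rewrite -lp2 ep2 last_cat.
  by apply: passage_le; apply: walk_containing.
Qed.

End passage_times.

(** * Independent families and their configurations *)

Section configurations.
Variables (R : realType) (I : choiceType).
Local Open Scope ereal_scope.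

Definition cylinder (A : I -> set R) : set (I -> R) := [set t | forall i, A i (t i)].

Definition cylinders : set (set (I -> R)) :=
  [set B | exists (s : seq I) (A : I -> set R),
    [/\ forall i, measurable (A i), forall i, i \notin s -> A i = setT &
        B = cylinder A]].

Definition config := g_sigma_algebraType cylinders.

Lemma cylindersI : setI_closed cylinders.
Proof.
move=> _ _ [s [A [mA As ->]]] [s' [A' [mA' As' ->]]].
exists (s ++ s'), (fun i => A i `&` A' i); split => [i|i|].
- exact: measurableI.
- by rewrite mem_cat negb_or => /andP[/As -> /As' ->]; rewrite setTI.
- by apply/seteqP; split=> t; [move=> [h1 h2] i|move=> h; split=> i; case: (h i)].
Qed.

Lemma measurable_coord i : measurable_fun setT (fun t : config => t i : R).
Proof.
move=> _ B mB; rewrite setTI; apply: sub_sigma_algebra.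
exists [:: i], (fun j => if j == i then B else setT); split => [j|j|].
- by case: ifP.
- by rewrite inE => /negPf ->.
- apply/seteqP; split=> t /=; last by move=> /(_ i); rewrite eqxx.
  by move=> ti j; case: ifP => // /eqP ->.
Qed.

Lemma measurable_config d (T : measurableType d) (X : T -> I -> R) :
  (forall i, measurable_fun setT (fun w => X w i)) ->
  measurable_fun setT (X : T -> config).
Proof.
move=> mX; apply: (@measurability _ _ T config setT X cylinders erefl) => _ [_ [s [A [mA As ->]]] <-].
rewrite setTI; have -> : X @^-1` cylinder A =
    \big[setI/setT]_(i <- s) (fun w => X w i) @^-1` A i.
  rewrite -bigcap_seq; apply/seteqP; split=> w /= h i; first by move=> _; apply: h.
  by have [is_|/As ->//] := boolP (i \in s); apply: h.
apply: bigsetI_measurable => i _; rewrite -[X in measurable X]setTI.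
exact: mX.
Qed.

Lemma preimage_config_measurable d (T : measurableType d) (X : T -> config) (B : set config) :
  measurable_fun setT X -> measurable B -> measurable (X @^-1` B).
Proof. by move=> mX mB; rewrite -[X in measurable X]setTI; exact: mX. Qed.

(** Cylinders are stable under intersection and generate the sigma-algebra of
    the space of configurations, so they determine the law of a family. *)
Lemma eq_config_law d (T : measurableType d) (P : probability T R) (X Y : T -> config) :
  measurable_fun setT X -> measurable_fun setT Y ->
  (forall B, cylinders B -> P (X @^-1` B) = P (Y @^-1` B)) ->
  forall B : set config, measurable B -> P (X @^-1` B) = P (Y @^-1` B).
Proof.
move=> mX mY h B mB.
apply: (@dynkin_induction _ config cylinders
  (fun B => P (X @^-1` B) = P (Y @^-1` B)) erefl cylindersI) => //.
- move=> S mS e; rewrite -(preimage_setC X S) -(preimage_setC Y S).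
  rewrite (probability_setC P (preimage_config_measurable mX mS)).
  by rewrite (probability_setC P (preimage_config_measurable mY mS)) e.
- move=> F mF tF e; rewrite (preimage_bigcup _ X) (preimage_bigcup _ Y).
  have dis (Z : T -> config) : trivIset setT (fun n => Z @^-1` F n).
    apply/trivIsetP => i j _ _ ij; rewrite -preimage_setI.
    by move/trivIsetP : tF => /(_ i j Logic.I Logic.I ij) ->; rewrite preimage_set0.
  rewrite (measure_bigcup P _ _ _ (dis X)); last first.
    by move=> n _; exact: preimage_config_measurable mX (mF n).
  rewrite (measure_bigcup P _ _ _ (dis Y)); last first.
    by move=> n _; exact: preimage_config_measurable mY (mF n).
  by apply: eq_eseriesr => n _; exact: e.
Qed.

Lemma config_law_indep d (T : measurableType d) (P : probability T R) (X : T -> config)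
    (C : set T) : measurable_fun setT X -> measurable C ->
  (forall B, cylinders B -> P (X @^-1` B `&` C) = P (X @^-1` B) * P C) ->
  forall B : set config, measurable B -> P (X @^-1` B `&` C) = P (X @^-1` B) * P C.
Proof.
move=> mX mC h B mB.
apply: (@dynkin_induction _ config cylinders
  (fun B => P (X @^-1` B `&` C) = P (X @^-1` B) * P C) erefl cylindersI) => //.
- by rewrite preimage_setT setTI probability_setT mul1e.
- move=> S mS e; rewrite -(preimage_setC X S).
  have mXS := preimage_config_measurable mX mS.
  rewrite setIC -setDE (measureD mC mXS); last by rewrite ltey_eq fin_num_measure.
  transitivity (P C - P (X @^-1` S) * P C).
    by congr (_ - _); rewrite (setIC C); exact: e.
  rewrite (probability_setC P mXS) muleBl ?mul1e ?fin_num_measure //.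
- move=> F mF tF e; rewrite (preimage_bigcup _ X) setI_bigcupl.
  have mXF n : measurable (X @^-1` F n) by exact: preimage_config_measurable.
  have dis : trivIset setT (fun n => X @^-1` F n).
    apply/trivIsetP => i j _ _ ij; rewrite -preimage_setI.
    by move/trivIsetP : tF => /(_ i j Logic.I Logic.I ij) ->; rewrite preimage_set0.
  rewrite (measure_bigcup P _ _ _ dis); last by move=> n _; exact: mXF.
  rewrite measure_bigcup; last 2 first.
  + by move=> n _; exact: measurableI (mXF n) mC.
  + exact: trivIset_setIr.
  have PC : P C = (fine (P C))%:E by rewrite fineK // fin_num_measure.
  rewrite PC muleC -nneseriesZl; last by move=> n _; exact: measure_ge0.
  by apply: eq_eseriesr => n _; rewrite -PC muleC; exact: e.
Qed.

Section iid.
Context d (T : measurableType d) (P : probability T R) (mu : probability R R).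
Variable X : I -> {RV P >-> R}.
Hypothesis X_iid : iid X mu.

Definition sample (w : T) : config := fun i => X i w.

Lemma measurable_sample : measurable_fun setT sample.
Proof. exact: measurable_config. Qed.

Lemma sample_cylinder s A : uniq s -> (forall i, measurable (A i)) ->
  (forall i, i \notin s -> A i = setT) ->
  P (sample @^-1` cylinder A) = \prod_(i <- s) mu (A i).
Proof.
move=> us mA As; case: X_iid => indep law.
have -> : sample @^-1` cylinder A = \bigcap_(i in [set` s]) X i @^-1` A i.
  apply/seteqP; split=> w /= h i; first by move=> _; apply: h.
  by have [is_|/As ->//] := boolP (i \in s); apply: h.
by rewrite indep //; apply: eq_bigr => i _; exact: law.
Qed.

(** Applied to translations of the lattice, this is the stationarity of the
    weights. *)
Lemma sample_reindex (r : I -> I) (r' : I -> I) : cancel r r' -> cancel r' r ->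
  forall B : set config, measurable B ->
  P ((fun w i => X (r i) w) @^-1` B) = P (sample @^-1` B).
Proof.
move=> rK r'K B mB.
apply: eq_config_law mB => [| |_ [s [A [mA As ->]]]].
- by apply: measurable_config => i; exact: measurable_funP.
- exact: measurable_sample.
have mem_r i : (i \in map r (undup s)) = (r' i \in s).
  by rewrite -[in LHS](r'K i) (mem_map (can_inj rK)) mem_undup.
have -> : (fun w i => X (r i) w) @^-1` cylinder A = sample @^-1` cylinder (A \o r').
  apply/seteqP; split=> w /= h i; first by have := h (r' i); rewrite r'K.
  by have := h (r i); rewrite /= rK.
rewrite (@sample_cylinder (map r (undup s))); last 3 first.
- by rewrite map_inj_uniq ?undup_uniq //; exact: can_inj rK.
- by move=> i; exact: mA.
- by move=> i; rewrite mem_r => /As.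
rewrite (@sample_cylinder (undup s)) ?undup_uniq //; last by move=> i; rewrite mem_undup; exact: As.
by rewrite big_map; apply: eq_bigr => i _; rewrite /= rK.
Qed.

(** Setting the weights outside [S] to zero makes independence of the weights in
    disjoint sets a statement about configurations over the same index type. *)
Definition restricted_sample (S : pred I) (w : T) : config :=
  fun i => if S i then X i w else 0%R.

Lemma measurable_restricted_sample S : measurable_fun setT (restricted_sample S).
Proof.
apply: measurable_config => i; rewrite /restricted_sample; case: (S i).
  exact: measurable_funP.
exact: measurable_cst.
Qed.

Let trace (S : pred I) (A : I -> set R) i : set R :=
  if S i then A i else if `[< A i 0%R >] then setT else set0.

Let trace_preimage S A : restricted_sample S @^-1` cylinder A = sample @^-1` cylinder (trace S A).
Proof.
apply/seteqP; split=> w /= h i; have := h i; rewrite /trace /restricted_sample /sample; case: (S i) => //.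
  by move=> /asboolP ->.
by case: asboolP.
Qed.

(** For a cylinder, one of the two factors at each index is the whole line or
    the empty set, so the probabilities multiply index by index. *)
Lemma restricted_sample_indep (S S' : pred I) : (forall i, S i -> ~~ S' i) ->
  forall B B' : set config, measurable B -> measurable B' ->
  P (restricted_sample S @^-1` B `&` restricted_sample S' @^-1` B') =
  P (restricted_sample S @^-1` B) * P (restricted_sample S' @^-1` B').
Proof.
move=> SS' B B' mB mB'.
have mS := measurable_restricted_sample S.
have mS' := measurable_restricted_sample S'.
apply: config_law_indep mB => //; first exact: preimage_config_measurable.
move=> C cC; rewrite setIC muleC; apply: config_law_indep mB' => //.
  by apply: preimage_config_measurable => //; exact: sub_sigma_algebra.
move: cC => [s [A [mA As ->]]] _ [s' [A' [mA' As' ->]]].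
rewrite !trace_preimage -preimage_setI.
have -> : cylinder (trace S' A') `&` cylinder (trace S A) =
    cylinder (fun i => trace S' A' i `&` trace S A i).
  by apply/seteqP; split=> t; [move=> [h1 h2] i|move=> h; split=> i; case: (h i)].
have mtr (U : pred I) D : (forall i, measurable (D i)) -> forall i, measurable (trace U D i).
  by move=> mD i; rewrite /trace; case: (U i) => //; case: asboolP.
have tr (U : pred I) (r : seq I) D : (forall i, i \notin r -> D i = setT) ->
    forall i, i \notin r -> trace U D i = setT.
  move=> h i /h Di; rewrite /trace Di; case: (U i) => //.
  by case: asboolP => // h0; case: h0.
pose r := undup (s ++ s').
have rs i : i \notin r -> i \notin s /\ i \notin s'.
  by rewrite mem_undup mem_cat negb_or => /andP[].
have ur : uniq r by exact: undup_uniq.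
have cyl1 := sample_cylinder ur (mtr S A mA) (fun i h => tr S s A As i (rs i h).1).
have cyl2 := sample_cylinder ur (mtr S' A' mA') (fun i h => tr S' s' A' As' i (rs i h).2).
rewrite cyl1 cyl2 (@sample_cylinder r) //; last 2 first.
- by move=> i; apply: measurableI; exact: mtr.
- by move=> i /rs[h h']; rewrite (tr _ _ _ As) ?(tr _ _ _ As') ?setIT.
rewrite -big_split /=; apply: eq_bigr => i _.
suff [[|]|[|]] : (trace S A i = setT \/ trace S A i = set0) \/
    (trace S' A' i = setT \/ trace S' A' i = set0).
- by move=> ->; rewrite setIT probability_setT mule1.
- by move=> ->; rewrite setI0 measure0 mule0.
- by move=> ->; rewrite setTI probability_setT mul1e.
- by move=> ->; rewrite set0I measure0 mul0e.
rewrite /trace; case: (boolP (S i)) => [/SS'/negPf ->|_]; [right|left];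
  by case: asboolP; auto.
Qed.

End iid.
End configurations.

(** * Probability estimates and measurability *)

Section probability_facts.
Context (R : realType) disp (T : measurableType disp) (P : probability T R).
Local Open Scope ereal_scope.

Definition pr (A : set T) : R := fine (P A).

Lemma prE A : measurable A -> P A = (pr A)%:E.
Proof. by move=> mA; rewrite /pr fineK // fin_num_measure. Qed.

Lemma pr_ge0 A : (0 <= pr A)%R.
Proof. by rewrite /pr fine_ge0. Qed.

Lemma le_pr A B : measurable A -> measurable B -> A `<=` B -> (pr A <= pr B)%R.
Proof.
move=> mA mB AB; rewrite -lee_fin -!prE //.
by apply: le_measure => //; rewrite inE.
Qed.

Lemma pr_setC A : measurable A -> pr (~` A) = (1 - pr A)%R.
Proof.
move=> mA; apply: EFin_inj; rewrite -prE ?probability_setC ?prE //.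
exact: measurableC.
Qed.

Lemma pr_setU A B : measurable A -> measurable B -> (pr (A `|` B) <= pr A + pr B)%R.
Proof.
move=> mA mB; rewrite -lee_fin EFinD -!prE //; last exact: measurableU.
exact: measureU2.
Qed.

Lemma pr_bigU (I : Type) (s : seq I) (F : I -> set T) : (forall i, measurable (F i)) ->
  (pr (\big[setU/set0]_(i <- s) F i) <= \sum_(i <- s) pr (F i))%R.
Proof.
move=> mF; elim: s => [|i s IH]; first by rewrite !big_nil /pr measure0.
rewrite !big_cons (le_trans (pr_setU _ _)) ?lerD2l //.
exact: bigsetU_measurable.
Qed.

Lemma pr_exists A : measurable A -> (0 < pr A)%R -> exists w, A w.
Proof.
move=> mA; apply: contraPP => /forallNP A0; rewrite (_ : A = set0) ?/pr ?measure0 ?ltxx //.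
by apply/seteqP; split.
Qed.

Lemma markov_pr (F : T -> \bar R) (A : set T) (c M : R) : measurable_fun setT F ->
  (forall w, 0 <= F w) -> \int[P]_w F w <= M%:E -> measurable A -> (0 < c)%R ->
  (forall w, A w -> c%:E <= F w) -> (pr A <= M / c)%R.
Proof.
move=> mF F0 FM mA c0 AF; rewrite ler_pdivlMr // -lee_fin EFinM -prE // muleC.
rewrite -(integral_cst P mA); apply: le_trans FM.
apply: (@le_trans _ _ (\int[P]_(w in A) F w)).
  apply: ge0_le_integral => //; first by move=> w _ /=; rewrite lee_fin ltW.
  exact: measurable_funTS.
exact: ge0_subset_integral.
Qed.

Lemma eq_law_integral (X Y : T -> R) (g : R -> \bar R) :
  measurable_fun setT X -> measurable_fun setT Y ->
  (forall B : set R, measurable B -> P (X @^-1` B) = P (Y @^-1` B)) ->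
  measurable_fun setT g -> (forall x, 0 <= g x) ->
  \int[P]_w g (X w) = \int[P]_w g (Y w).
Proof.
move=> mX mY law mg g0.
pose X' : {RV P >-> R} := HB.pack X (isMeasurableFun.Build _ _ _ _ X mX).
pose Y' : {RV P >-> R} := HB.pack Y (isMeasurableFun.Build _ _ _ _ Y mY).
have := @ge0_integral_distribution _ _ _ _ _ P X' g mg g0.
have := @ge0_integral_distribution _ _ _ _ _ P Y' g mg g0.
rewrite /comp /= => <- <-; apply: eq_measure_integral => A mA _; exact: law.
Qed.

Lemma measurable_expeR : measurable_fun setT (@expeR R).
Proof.
apply: (measurability _ (ErealGenOInfty.measurableE R)) => // _ [_ [r ->] <-].
rewrite setTI; have [r0|r0] := ltP r 0%R.
  rewrite (_ : _ @^-1` _ = setT) //; apply/seteqP; split=> x //= _.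
  by rewrite in_itv /= andbT (lt_le_trans _ (expeR_ge0 _)) // lte_fin.
have /expeR_total[y yE] : 0 <= r%:E by rewrite lee_fin.
rewrite (_ : _ @^-1` _ = `]y, +oo[%classic); first exact: emeasurable_itv.
by apply/seteqP; split=> x /=; rewrite !in_itv /= !andbT -yE lte_expeR.
Qed.

End probability_facts.

Section passage_time_measurability.
Variables (R : realType) (d : nat).
Local Notation config := (config R (edge d)).

(** Absolute values make the passage times of every configuration nonnegative,
    so that the theory of nonnegative weights applies to all of them. *)
Definition abs_weight (t : config) : edge d -> R := fun e => `|t e|.

Lemma abs_weight_ge0 t e : 0 <= abs_weight t e.
Proof. exact: normr_ge0. Qed.

Lemma measurable_path_time g :
  measurable_fun setT (fun t : config => path_time (abs_weight t) g).
Proof.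
apply: measurable_sum => e; apply: measurableT_comp; last exact: measurable_coord.
exact: normr_measurable.
Qed.

Lemma measurable_passage_time x y :
  measurable_fun setT (fun t : config => passage_time (abs_weight t) x y).
Proof.
apply: (measurability _ (RGenInftyO.measurableE R)) => // _ [_ [c ->] <-].
rewrite setTI (_ : _ @^-1` _ = \bigcup_(g : seq (edge d))
   (if path_containing x y g then [set t : config | path_time (abs_weight t) g < c] else set0)).
  apply: countable_bigcupT_measurable => [|g]; first exact: countableP.
  case: ifP => // _; rewrite (_ : [set t | _] =
     (fun t : config => path_time (abs_weight t) g) @^-1` `]-oo, c[%classic).
    by rewrite -[X in measurable X]setTI; apply: measurable_path_time.
  by apply/seteqP; split=> t /=; rewrite in_itv.
apply/seteqP; split=> t /=; rewrite in_itv /=.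
  move/(passage_ltP (abs_weight_ge0 t)) => [g gp gc]; exists g => //; by rewrite gp.
move=> [g _]; case: ifP => // gp gc.
by apply/(passage_ltP (abs_weight_ge0 t)); exists g.
Qed.

Definition fast_path (S : pred (edge d)) x y (c : R) : set config :=
  [set t | exists g, [/\ path_containing x y g, all S g & path_time (abs_weight t) g <= c]].

Definition geodesic_within (S : pred (edge d)) x y : set config :=
  [set t | exists g, [/\ path_containing x y g, all S g &
     path_time (abs_weight t) g <= passage_time (abs_weight t) x y]].

Let measurable_exists_path (Q : pred (seq (edge d))) (X : config -> R) :
  measurable_fun setT X ->
  measurable [set t : config | exists g, Q g /\ path_time (abs_weight t) g <= X t].
Proof.
move=> mX; rewrite (_ : [set t | _] = \bigcup_(g : seq (edge d))
   (if Q g then [set t : config | path_time (abs_weight t) g <= X t] else set0)).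
  apply: countable_bigcupT_measurable => [|g]; first exact: countableP.
  case: ifP => // _; rewrite -[X in measurable X]setTI.
  exact: measurable_fun_le measurableT (measurable_path_time g) mX.
apply/seteqP; split=> t /=; first by move=> [g [Qg gX]]; exists g => //; rewrite Qg.
by move=> [g _]; case: ifP => // Qg gX; exists g.
Qed.

Lemma measurable_fast_path S x y c : measurable (fast_path S x y c).
Proof.
rewrite (_ : fast_path _ _ _ _ = [set t : config | exists g,
    (path_containing x y g && all S g) /\ path_time (abs_weight t) g <= c]).
  by apply: measurable_exists_path; exact: measurable_cst.
by apply/seteqP; split=> t /= [g [gp]]; [move=> gS|move: gp => /andP[gp gS]]; exists g;
  rewrite ?gp ?gS.
Qed.

Lemma measurable_geodesic_within S x y : measurable (geodesic_within S x y).
Proof.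
rewrite (_ : geodesic_within _ _ _ = [set t : config | exists g,
    (path_containing x y g && all S g) /\
    path_time (abs_weight t) g <= passage_time (abs_weight t) x y]).
  by apply: measurable_exists_path; exact: measurable_passage_time.
by apply/seteqP; split=> t /= [g [gp]]; [move=> gS|move: gp => /andP[gp gS]]; exists g;
  rewrite ?gp ?gS.
Qed.

End passage_time_measurability.

(** * Mean passage times and fluctuations *)

Lemma subadditive_linear_bound (R : realType) (d : nat) (f : 'rV[int]_d -> R) :
  (forall v, 0 <= f v) -> (forall u v, f (u + v) <= f u + f v) -> f 0 = 0 ->
  exists C : R, forall v, f v <= C * vertex_norm R v.
Proof.
move=> f_ge0 f_sub f0.
have f_Mn v n : f (v *+ n) <= n%:R * f v.
  elim: n => [|n IH]; first by rewrite mulr0n f0 mul0r.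
  by rewrite mulrS (le_trans (f_sub _ _)) // -natr1 mulrDl mul1r addrC lerD.
exists (\sum_i (f (delta_mx 0 i) + f (- delta_mx 0 i))) => v.
rewrite {1}(row_sum_delta v) mulr_suml.
apply: (big_rec2 (fun (s : 'rV[int]_d) (c : R) => f s <= c)); first by rewrite f0.
move=> i s c _ sc; apply: le_trans (f_sub _ _) _; rewrite lerD //.
apply: (@le_trans _ _ ((`|v 0%R i|%N)%:R * (f (delta_mx 0 i) + f (- delta_mx 0 i)))).
  rewrite {1}(intEsign (v 0 i)).
  have -> (b : bool) (n : nat) : ((-1) ^+ b * n%:Z) *: delta_mx 0 i =
     (if b then - delta_mx 0 i else delta_mx 0 i) *+ n :> 'rV[int]_d.
    by rewrite mulrC -scalerA -[n%:Z]natz scaler_nat; case: b; rewrite ?scaleN1r ?scale1r.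
  by case: (v 0 i < 0); apply: (le_trans (f_Mn _ _)); apply: ler_wpM2l; rewrite ?lerDl ?lerDr.
rewrite mulrC ler_wpM2l ?addr_ge0 //.
by apply: le_trans (vnorm_coord R v i); rewrite -abszE.
Qed.

Section fpp_model.
Variables (R : realType) (d : nat) (disp : measure_display).
Variables (T : measurableType disp) (P : probability T R) (mu : probability R R).
Variable tau : edge d -> {RV P >-> R}.
Hypothesis tau_ge0 : forall e w, 0 <= tau e w.
Hypothesis tau_iid : iid tau mu.
Local Notation vn := (@vertex_norm R d).
Local Notation rv := (@to_real R d).
Local Notation pr := (pr P).

Definition ptime x y (w : T) : R := passage_time (fun e => tau e w) x y.

Lemma abs_weight_sample (r : edge d -> edge d) w : abs_weight (fun e => tau (r e) w) = (fun e => tau (r e) w).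
Proof. by apply/funext => e; rewrite /abs_weight ger0_norm. Qed.

Lemma ptimeE x y w : ptime x y w = passage_time (abs_weight (sample tau w)) x y.
Proof. by rewrite /sample (abs_weight_sample id). Qed.

Lemma measurable_ptime x y : measurable_fun setT (ptime x y).
Proof.
rewrite (_ : ptime x y = (fun t : config R (edge d) => passage_time (abs_weight t) x y) \o sample tau).
  apply: measurableT_comp; [exact: measurable_passage_time|exact: measurable_sample].
by apply/funext => w; rewrite ptimeE.
Qed.

Lemma shift_law z (B : set (config R (edge d))) : measurable B ->
  P [set w | B (fun e => tau (shift_edge z e) w)] = P [set w | B (sample tau w)].
Proof. exact: (sample_reindex tau_iid (shift_edgeK z) (shift_edgeNK z)). Qed.

Lemma ptime_shift x y z w :
  ptime (x + z) (y + z) w = passage_time (abs_weight (fun e => tau (shift_edge z e) w)) x y.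
Proof. by rewrite /ptime passage_time_shift (abs_weight_sample (shift_edge z)). Qed.

Lemma ptime_law x y z (B : set R) : measurable B ->
  P (ptime (x + z) (y + z) @^-1` B) = P (ptime x y @^-1` B).
Proof.
move=> mB; have mB' : measurable ((fun t : config R (edge d) => passage_time (abs_weight t) x y) @^-1` B).
  by rewrite -[X in measurable X]setTI; exact: measurable_passage_time.
have := shift_law z mB'; rewrite /preimage /= => h.
transitivity (P [set w | B (passage_time (abs_weight (fun e => tau (shift_edge z e) w)) x y)]).
  by congr (P _); apply/seteqP; split => w /=; rewrite ptime_shift.
by rewrite h; congr (P _); apply/seteqP; split => w /=; rewrite ptimeE.
Qed.

Lemma ptime_ge0 x y w : 0 <= ptime x y w.
Proof. exact: passage_ge0. Qed.

Lemma ptime_triangle x y z w : ptime x z w <= ptime x y w + ptime y z w.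
Proof. exact: passage_triangle. Qed.

Lemma ptime_self x w : ptime x x w = 0.
Proof. exact: passage_self. Qed.

Definition mean_time v : R := fine 'E_P[fpp_time tau v].
Local Notation f := mean_time.

Variables (chi xi chib xib : R).
Hypothesis h_up : upper_exponents tau chi xi.
Hypothesis h_low : lower_exponents tau chib xib.

Lemma exp_moments chi' xi' : chi < chi' -> xi < xi' -> exists alpha M : R,
  [/\ 0 < alpha, 0 <= M & forall v, v != 0 ->
   (\int[P]_w expeR ((alpha / vn v `^ chi')%:E *
                 `|(fpp_time tau v w)%:E - 'E_P[fpp_time tau v]|) <= M%:E)%E /\
   (\int[P]_w expeR ((alpha / vn v `^ xi')%:E * fpp_deviation tau v w) <= M%:E)%E].
Proof.
move=> /h_up/[apply] -[alpha [a0]].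
set S1 := ereal_sup _; set S2 := ereal_sup _ => h1 h2.
exists alpha, (Num.max 0 (Num.max (fine S1) (fine S2))); split => //.
  by rewrite le_max lexx.
have key (x S : \bar R) : (0 <= x -> x <= S -> S < +oo ->
    x <= (Num.max 0 (fine S))%:E)%E.
  move=> x0 xS Sy; have Sf : S \is a fin_num by rewrite ge0_fin_numE // (le_trans x0 xS).
  apply: le_trans xS _.
  by rewrite -[leLHS]fineK // lee_fin le_max lexx orbT.
have wid (x : \bar R) (a b c : R) : (x <= (Num.max a b)%:E)%E -> b <= c ->
    (x <= (Num.max a c)%:E)%E.
  move=> xab bc; apply: le_trans xab _.
  by rewrite lee_fin ge_max !le_max lexx /= bc orbT.
move=> v vN0; split.
  apply: (wid _ _ (fine S1)); last by rewrite le_max lexx.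
  apply: key => //; first by apply: integral_ge0 => w _; exact: expeR_ge0.
  by apply: ereal_sup_ubound; exists v.
apply: (wid _ _ (fine S2)); last by rewrite le_max lexx orbT.
apply: key => //; first by apply: integral_ge0 => w _; exact: expeR_ge0.
by apply: ereal_sup_ubound; exists v.
Qed.

(** An infinite mean would make the exponential moments of the centered passage
    time infinite. *)
Lemma mean_timeE v : ('E_P[fpp_time tau v] = (f v)%:E)%E.
Proof.
rewrite /f fineK //; have E0 : (0 <= 'E_P[fpp_time tau v])%E.
  by apply: expectation_ge0 => w; exact: ptime_ge0.
have [->|vN0] := eqVneq v 0.
  rewrite (_ : fpp_time tau 0 = cst 0) ?expectation_cst //.
  by apply/funext => w; exact: ptime_self.
have chi1 : chi < chi + 1 by rewrite ltrDl.
have xi1 : xi < xi + 1 by rewrite ltrDl.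
have [alpha [M [a0 M0 /(_ v vN0)[hM _]]]] := exp_moments chi1 xi1.
rewrite ge0_fin_numE // ltey; apply/eqP => Ey; move: hM; rewrite Ey.
have c0 : 0 < alpha / vn v `^ (chi + 1) by rewrite divr_gt0 // powR_gt0 // vnorm_gt0.
under eq_integral do rewrite /= gt0_muley ?lte_fin //=.
have -> : (\int[P]_w (+oo : \bar R) = +oo)%E.
  transitivity (+oo * P setT)%E; first exact: integral_cst.
  by rewrite probability_setT mule1.
by rewrite leye_eq.
Qed.

Lemma mean_time_integral v x : (\int[P]_w (ptime x (x + v) w)%:E = (f v)%:E)%E.
Proof.
rewrite -mean_timeE unlock.
have h0 : measurable_fun setT (fun r : R => `|r|%:E).
  by apply/measurable_EFinP; exact: normr_measurable.
transitivity (\int[P]_w `|ptime x (x + v) w|%:E)%E.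
  by apply: eq_integral => w _; rewrite ger0_norm // ptime_ge0.
transitivity (\int[P]_w `|fpp_time tau v w|%:E)%E; last first.
  by apply: eq_integral => w _; rewrite ger0_norm // ptime_ge0.
apply: (@eq_law_integral _ _ _ P (ptime x (x + v)) (fpp_time tau v) (fun r => `|r|%:E)) => //.
- exact: measurable_ptime.
- exact: measurable_ptime.
- by move=> B mB; have := @ptime_law 0 v x B mB; rewrite add0r [v + x]addrC.
Qed.

Lemma mean_time_ge0 v : 0 <= f v.
Proof. by apply: fine_ge0; apply: expectation_ge0 => w; exact: ptime_ge0. Qed.

Lemma mean_time0 : f 0 = 0.
Proof.
rewrite /f (_ : fpp_time tau 0 = cst 0) ?expectation_cst //.
by apply/funext => w; exact: ptime_self.
Qed.

Lemma mean_time_sub u v : f (u + v) <= f u + f v.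
Proof.
rewrite -lee_fin EFinD -(mean_time_integral (u + v) 0) -(mean_time_integral u 0).
rewrite -(mean_time_integral v u) !add0r -ge0_integralD //; last 4 first.
- by move=> w _; rewrite lee_fin ptime_ge0.
- by apply/measurable_EFinP; exact: measurable_ptime.
- by move=> w _; rewrite lee_fin ptime_ge0.
- by apply/measurable_EFinP; exact: measurable_ptime.
apply: ge0_le_integral => //.
- by move=> w _; rewrite lee_fin ptime_ge0.
- by apply/measurable_EFinP; exact: measurable_ptime.
- by apply: emeasurable_funD; apply/measurable_EFinP; exact: measurable_ptime.
- by move=> w _; rewrite -EFinD lee_fin ptime_triangle.
Qed.

Lemma mean_time_linear : exists C : R, forall v, f v <= C * vn v.
Proof.
exact: subadditive_linear_bound mean_time_ge0 mean_time_sub mean_time0.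
Qed.

Lemma pow_le_expR (x : R) (K : nat) : 0 <= x -> x ^+ K <= K`!%:R * expR x.
Proof.
case: K => [|K] x0; first by rewrite expr0 fact0 mul1r -expR0 ler_expR.
rewrite -ler_pdivrMl ?ltr0n ?fact_gt0 // mulrC.
by apply: le_trans (expR_ge1Dxn K x0); rewrite lerDr.
Qed.

Lemma central_moment chi' K : chi < chi' -> exists2 C : R, 0 <= C &
  forall v, v != 0 -> (\int[P]_w (`|ptime 0 v w - f v| ^+ K)%:E <= (C * (vn v `^ chi') ^+ K)%:E)%E.
Proof.
move=> hchi; have xi1 : xi < xi + 1 by rewrite ltrDl.
have [alpha [M [a0 M0 hM]]] := exp_moments hchi xi1.
exists (K`!%:R * M / alpha ^+ K) => [|v vN0].
  by rewrite divr_ge0 ?exprn_ge0 ?mulr_ge0 // ltW.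
have [{}hM _] := hM v vN0; set r := vn v `^ chi' in hM *.
have r0 : 0 < r by rewrite powR_gt0 // vnorm_gt0.
have mT : measurable_fun setT (fun w => `|ptime 0 v w - f v|).
  apply: measurableT_comp; first exact: normr_measurable.
  by apply: measurable_funB; [exact: measurable_ptime|exact: measurable_cst].
pose c := K`!%:R * (r / alpha) ^+ K.
have c0 : 0 <= c by rewrite mulr_ge0 // exprn_ge0 // divr_ge0 // ltW.
have -> : K`!%:R * M / alpha ^+ K * r ^+ K = c * M.
  by rewrite /c exprMn exprVn; ring.
pose F w := (expR (alpha / r * `|ptime 0 v w - f v|))%:E.
have mF : measurable_fun setT F.
  apply/measurable_EFinP; apply: measurableT_comp; first exact: measurable_expR.
  by apply: measurable_funM => //; exact: measurable_cst.
apply: (@le_trans _ _ (\int[P]_w (c%:E * F w))%E).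
  apply: ge0_le_integral.
  - exact: measurableT.
  - by move=> w _; rewrite lee_fin exprn_ge0.
  - by apply/measurable_EFinP; exact: measurable_funX.
  - exact: measurable_funeM.
  - move=> w _; rewrite -EFinM lee_fin /c.
    set x := `|_|; have x0 : 0 <= x by exact: normr_ge0.
    have ax0 : 0 <= alpha / r * x by rewrite mulr_ge0 // divr_ge0 // ltW.
    have h := pow_le_expR K ax0.
    have -> : x ^+ K = (r / alpha) ^+ K * (alpha / r * x) ^+ K.
      by rewrite -exprMn; congr (_ ^+ K); field; rewrite !gt_eqF.
    rewrite -[_ * _ * expR _]mulrA [leRHS]mulrCA; apply: ler_wpM2l => //.
    by rewrite exprn_ge0 // divr_ge0 // ltW.
rewrite ge0_integralZl_EFin //; last by move=> w _; rewrite lee_fin expR_ge0.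
rewrite (EFinM c M); apply: lee_wpmul2l; first by rewrite lee_fin.
apply: le_trans hM.
by rewrite mean_timeE le_eqVlt; apply/orP; left; apply/eqP/eq_integral.
Qed.

Lemma measurable_fluctuation x y (a t : R) : measurable [set w | t <= `|ptime x y w - a|].
Proof.
rewrite -[X in measurable X]setTI; apply: measurable_fun_le => //.
apply: measurableT_comp; first exact: normr_measurable.
by apply: measurable_funB; [exact: measurable_ptime|exact: measurable_cst].
Qed.

Lemma fluctuation_tail chi' K : chi < chi' -> 0 <= chi' -> exists2 C : R, 0 <= C &
  forall N x v t, vn v <= N -> 0 < t ->
    pr [set w | t <= `|ptime x (x + v) w - f v|] <= C * (N `^ chi' / t) ^+ K.
Proof.
move=> hchi chi0; have [C C0 hC] := central_moment K hchi; exists C => // N x v t vN t0.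
have N0 : 0 <= N by apply: le_trans vN; exact: vnorm_ge0.
have rhs0 : 0 <= C * (N `^ chi' / t) ^+ K.
  by rewrite mulr_ge0 // exprn_ge0 // divr_ge0 ?powR_ge0 // ltW.
have [->|vN0] := eqVneq v 0.
  rewrite (_ : [set w | _] = set0) ?/pr ?measure0 //.
  by apply/seteqP; split=> w //=; rewrite addr0 ptime_self mean_time0 subrr normr0 leNgt t0.
have -> : pr [set w | t <= `|ptime x (x + v) w - f v|] = pr [set w | t <= `|ptime 0 v w - f v|].
  have mB : measurable [set r : R | t <= `|r - f v|].
    rewrite -[X in measurable X]setTI; apply: measurable_fun_le => //.
    by apply: measurableT_comp; [exact: normr_measurable|exact: measurable_funB].
  rewrite /pr; congr fine; have := @ptime_law 0 v x _ mB.
  by rewrite add0r [v + x]addrC.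
have tK : 0 < t ^+ K by rewrite exprn_gt0.
apply: (@le_trans _ _ (C * (vn v `^ chi') ^+ K / t ^+ K)).
  apply: (@markov_pr _ _ _ P (fun w => (`|ptime 0 v w - f v| ^+ K)%:E)).
  - apply/measurable_EFinP; apply: measurable_funX; apply: measurableT_comp; first exact: normr_measurable.
    by apply: measurable_funB; [exact: measurable_ptime|exact: measurable_cst].
  - by move=> w; rewrite lee_fin exprn_ge0.
  - exact: hC.
  - exact: measurable_fluctuation.
  - exact: tK.
  - by move=> w /= tw; rewrite lee_fin lerXn2r // ?nnegrE // ltW.
rewrite exprMn exprVn mulrA ler_wpM2r ?invr_ge0 ?(ltW tK) // ler_wpM2l //.
rewrite lerXn2r ?nnegrE ?powR_ge0 //.
by apply: ge0_ler_powR; rewrite ?nnegrE ?vnorm_ge0.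
Qed.

End fpp_model.

(** * Geodesics and variances *)

Section geodesics_and_variance.
Variables (R : realType) (d : nat) (disp : measure_display).
Variables (T : measurableType disp) (P : probability T R) (mu : probability R R).
Variable tau : edge d -> {RV P >-> R}.
Hypothesis tau_ge0 : forall e w, 0 <= tau e w.
Hypothesis tau_iid : iid tau mu.
Local Notation vn := (@vertex_norm R d).
Local Notation rv := (@to_real R d).
Local Notation pr := (pr P).
Local Notation f := (mean_time tau).
Local Notation ptime := (ptime tau).
Variables (chi xi chib xib : R).
Hypothesis h_up : upper_exponents tau chi xi.
Hypothesis h_low : lower_exponents tau chib xib.

Local Notation weights w := (fun e => tau e w).

Lemma measurable_geodesic x y g : measurable [set w | geodesic (weights w) x y g].
Proof.
have [gp|gN] := boolP (path_containing x y g); last first.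
  rewrite (_ : [set w | _] = set0) //; apply/seteqP; split=> w //= -[gp].
  by move: gN; rewrite gp.
rewrite (_ : [set w | _] = [set w | path_time (weights w) g <= ptime x y w]); last first.
  apply/seteqP; split=> w /=; first by move=> [_ ->].
  move=> h; split => //; apply/eqP; rewrite eq_le h.
  exact: passage_le.
rewrite -[X in measurable X]setTI; apply: measurable_fun_le => //.
  by apply: measurable_sum => e; exact: measurable_funP.
exact: measurable_ptime.
Qed.

Lemma measurable_no_geodesic x y :
  measurable [set w | forall g, ~ geodesic (weights w) x y g].
Proof.
rewrite (_ : [set w | _] = ~` \bigcup_(g : seq (edge d)) [set w | geodesic (weights w) x y g]).
  apply: measurableC; apply: countable_bigcupT_measurable => [|g]; first exact: countableP.
  exact: measurable_geodesic.
by apply/seteqP; split=> w /= h; [move=> [g _]; exact: h|move=> g gg; apply: h; exists g].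
Qed.

Lemma measurable_deviation v : measurable_fun setT (fpp_deviation tau v).
Proof.
apply: (measurability _ (ErealGenOInfty.measurableE R)) => // _ [_ [r ->] <-].
pose far (g : seq (edge d)) := exists (e : edge d) (p : 'rV[R]_d),
  [/\ e \in g, edge_segment e p & r < dist_to (segment 0 (rv v)) p].
rewrite setTI (_ : _ @^-1` _ = \bigcup_(g : seq (edge d))
   (if `[< far g >] then [set w | geodesic (weights w) 0 v g] else set0)).
  apply: countable_bigcupT_measurable => [|g]; first exact: countableP.
  by case: ifP => // _; exact: measurable_geodesic.
apply/seteqP; split=> w /=; rewrite in_itv /= andbT.
  move=> /ereal_sup_gt[_ [p [g [e [gg eg ep]]] <-]]; rewrite lte_fin => rp.
  by exists g => //; case: asboolP => // -[]; exists e, p.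
move=> [g _]; case: asboolP => // -[e [p [eg ep rp]]] gg.
apply: lt_le_trans (ereal_sup_ubound _); last by exists p; [exists g, e|].
by rewrite lte_fin.
Qed.

(** Without a geodesic the deviation is the supremum of the empty set.  If this
    happened with positive probability, the negative part of the deviation would
    have infinite integral and the mean deviation could not be positive. *)
Lemma geodesic_exists_ae v : v != 0 -> P [set w | forall g, ~ geodesic (weights w) 0 v g] = 0%E.
Proof.
move=> vN0; set N := [set w | _].
have mN : measurable N by exact: measurable_no_geodesic.
apply/eqP/negPn/negP => PN.
have [] := @h_low (chib - 1) (xib - 1) _ _; rewrite ?ltrBlDr ?ltrDl // => _.
set S := ereal_inf _ => S0.
have : (0 < (\int[P]_w fpp_deviation tau v w) * ((vn v `^ (xib - 1))^-1)%:E)%E.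
  by apply: lt_le_trans S0 _; apply: ereal_inf_lbound; exists v.
suff -> : (\int[P]_w fpp_deviation tau v w = -oo)%E.
  by rewrite gt0_mulNye // lte_fin invr_gt0 powR_gt0 // vnorm_gt0.
have mD := measurable_deviation v.
rewrite integralE; suff -> : (\int[P]_w (fpp_deviation tau v)^\- w = +oo)%E by rewrite addeNy.
apply/eqP; rewrite -leye_eq.
have <- : (\int[P]_(w in N) (+oo : \bar R) = +oo)%E.
  transitivity (+oo * P N)%E; first exact: integral_cst.
  by rewrite gt0_mulye // lt_def PN measure_ge0.
apply: (@le_trans _ _ (\int[P]_(w in N) (fpp_deviation tau v)^\- w)%E).
  rewrite le_eqVlt; apply/orP; left; apply/eqP; apply: eq_integral => w; rewrite inE => Nw.
  rewrite funenegE /fpp_deviation /geodesic_deviation (_ : [set _ | _ in _] = set0).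
    by rewrite ereal_sup0 /= max_l // leey.
  by apply/seteqP; split=> x //= -[p [g [e [gg _ _]]]]; case: (Nw g).
apply: ge0_subset_integral => //; first exact: measurable_funeneg.
Qed.

Definition tube v (rho : R) : pred (edge d) :=
  fun e => `[< forall p, edge_segment e p -> dist_to (segment 0 (rv v)) p <= rho >].

(** Outside a null event a geodesic exists, and leaving the tube means a deviation
    above [rho]; the exponential moment bounds its tail by any power. *)
Lemma geodesic_in_tube xi' K : xi < xi' -> exists2 C : R, 0 <= C &
  forall v rho, v != 0 -> 0 < rho ->
   pr (~` [set w | geodesic_within (tube v rho) 0 v (sample tau w)]) <=
     C * (vn v `^ xi' / rho) ^+ K.
Proof.
move=> hxi; have chi1 : chi < chi + 1 by rewrite ltrDl.
have [alpha [M [a0 M0 hM]]] := exp_moments h_up chi1 hxi.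
exists (K`!%:R * M / alpha ^+ K) => [|v rho vN0 rho0].
  by rewrite divr_ge0 ?exprn_ge0 ?mulr_ge0 // ltW.
have [_ {}hM] := hM v vN0; set r := vn v `^ xi' in hM *.
have r0 : 0 < r by rewrite powR_gt0 // vnorm_gt0.
set N := [set w | forall g, ~ geodesic (weights w) 0 v g].
have mD := measurable_deviation v.
set A := [set w | (rho%:E < fpp_deviation tau v w)%E].
have mA : measurable A.
  by rewrite -[X in measurable X]setTI; exact: emeasurable_fun_o_infty.
have mN : measurable N by exact: measurable_no_geodesic.
set G := [set w | geodesic_within _ _ _ _].
have mG : measurable G.
  apply: (preimage_config_measurable (measurable_sample tau)).
  exact: measurable_geodesic_within.
have sub : ~` G `<=` N `|` A.
  move=> w nG; apply: contrapT => /not_orP[nN nA]; apply: nG.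
  have [g gg] : exists g, geodesic (weights w) 0 v g by apply: contrapT => /forallNP.
  have Drho : (fpp_deviation tau v w <= rho%:E)%E by rewrite leNgt; apply/negP.
  exists g; split; first by case: gg.
    apply/allP => e eg; apply/asboolP => p ep; rewrite -lee_fin.
    by apply: le_trans Drho; apply: ereal_sup_ubound; exists p => //; exists g, e.
  rewrite /sample (abs_weight_sample tau_ge0 id).
  by case: gg => _ ->.
have mGc := measurableC mG.
have prN : pr N = 0 by rewrite /pr geodesic_exists_ae.
apply: le_trans (le_pr P mGc (measurableU _ _ mN mA) sub) _.
apply: le_trans (pr_setU P mN mA) _; rewrite prN add0r.
have ar0 : 0 < alpha / r by rewrite divr_gt0.
apply: le_trans (_ : M / expR (alpha / r * rho) <= _).
  apply: (@markov_pr _ _ _ P (fun w => expeR ((alpha / r)%:E * fpp_deviation tau v w))).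
  - apply: (@measurableT_comp _ _ _ _ _ _ (@expeR R) setT
      (fun w => ((alpha / r)%:E * fpp_deviation tau v w)%E)); first exact: measurable_expeR.
    exact: measurable_funeM.
  - by move=> w; exact: expeR_ge0.
  - exact: hM.
  - exact: mA.
  - exact: expR_gt0.
  - move=> w /= Dw; rewrite -[leLHS]/(expeR (alpha / r * rho)%:E) lee_expeR EFinM.
    by apply: lee_wpmul2l; rewrite ?lee_fin ltW.
have x0 : 0 < alpha / r * rho by rewrite mulr_gt0.
have := pow_le_expR K (ltW x0).
set y := alpha / r * rho in x0 *; set E := expR y => yE.
have E0 : 0 < E by exact: expR_gt0.
have -> : K`!%:R * M / alpha ^+ K * (r / rho) ^+ K = M * (K`!%:R / y ^+ K).
  rewrite /y !exprMn !exprVn; field.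
  by rewrite !expf_neq0 // gt_eqF.
rewrite ler_wpM2l // ler_pdivlMr ?exprn_gt0 // mulrC.
by rewrite ler_pdivrMr.
Qed.

Lemma variance_integral v :
  'V_P[fpp_time tau v] = (\int[P]_w ((ptime 0 v w - f v) ^+ 2)%:E)%E.
Proof.
rewrite /variance unlock; rewrite unlock /mean_time unlock.
by apply: eq_integral => w _; congr (_%:E); rewrite expr2.
Qed.

(** The mean minimizes the mean square deviation.  Linear terms with nonnegative
    coefficients are added on both sides, so that all the integrals involved are
    integrals of nonnegative functions and the variance may be infinite. *)
Lemma variance_le v c : 0 <= c ->
  ('V_P[fpp_time tau v] <= \int[P]_w ((ptime 0 v w - c) ^+ 2)%:E)%E.
Proof.
move=> c0; rewrite variance_integral.
set a := Num.max (f v - c) 0; set b := Num.max (c - f v) 0.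
have a0 : 0 <= a by rewrite le_max lexx orbT.
have b0 : 0 <= b by rewrite le_max lexx orbT.
have ab : a - b = f v - c by rewrite /a /b; case: (leP (f v - c) 0); case: (leP (c - f v) 0); lra.
have f0 : 0 <= f v by exact: mean_time_ge0.
have mX : measurable_fun setT (ptime 0 v) by exact: measurable_ptime.
have intX k : 0 <= k -> (\int[P]_w (k * ptime 0 v w)%:E = (k * f v)%:E)%E.
  move=> k0; under eq_integral do rewrite EFinM.
  rewrite ge0_integralZl_EFin //; last 2 first.
  - by move=> w _; rewrite lee_fin ptime_ge0.
  - exact/measurable_EFinP.
  rewrite EFinM; congr (_ * _)%E.
  by have := mean_time_integral tau_ge0 tau_iid h_up v 0; rewrite add0r.
have sq (z k l : R) : 0 <= k -> 0 <= l ->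
    (\int[P]_w ((ptime 0 v w - z) ^+ 2 + (k * ptime 0 v w + l))%:E =
     \int[P]_w ((ptime 0 v w - z) ^+ 2)%:E + (k * f v + l)%:E)%E.
  move=> k0 l0.
  have m1 : measurable_fun setT (fun w => ((ptime 0 v w - z) ^+ 2)%:E).
    apply/measurable_EFinP; apply: measurable_funX; exact: measurable_funB.
  have m2 : measurable_fun setT (fun w => (k * ptime 0 v w)%:E).
    by apply/measurable_EFinP; exact: measurable_funM.
  have p1 w : setT w -> (0 <= ((ptime 0 v w - z) ^+ 2)%:E)%E by rewrite lee_fin sqr_ge0.
  have p2 w : setT w -> (0 <= (k * ptime 0 v w)%:E)%E by rewrite lee_fin mulr_ge0 // ptime_ge0.
  have p3 w : setT w -> (0 <= (k * ptime 0 v w)%:E + l%:E)%E by rewrite -EFinD lee_fin addr_ge0 // mulr_ge0 // ptime_ge0.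
  have p4 (w : T) : setT w -> (0 <= l%:E)%E by rewrite lee_fin.
  have m4 : measurable_fun setT (fun _ : T => l%:E) by exact: measurable_cst.
  have m3 : measurable_fun setT (fun w => (k * ptime 0 v w)%:E + l%:E)%E by exact: emeasurable_funD.
  under eq_integral do rewrite EFinD EFinD.
  rewrite (ge0_integralD P measurableT p1 m1 p3 m3); congr (_ + _)%E.
  rewrite (ge0_integralD P measurableT p2 m2 p4 m4) intX // EFinD; congr (_ + _)%E.
  transitivity (l%:E * P setT)%E; first exact: integral_cst.
  by rewrite probability_setT mule1.
have a2 : 0 <= 2 * a by rewrite mulr_ge0.
have b2 : 0 <= 2 * b by rewrite mulr_ge0.
have e1 := sq (f v) (2 * a) ((f v - c) ^+ 2 + 2 * b * f v) a2
  (addr_ge0 (sqr_ge0 _) (mulr_ge0 b2 f0)).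
have e2 := sq c (2 * b) (2 * a * f v) b2 (mulr_ge0 a2 f0).
set I1 := (\int[P]_w _)%E; set I2 := (\int[P]_w _)%E.
rewrite -/I1 in e1; rewrite -/I2 in e2.
have e3 : (I1 + (2 * a * f v + ((f v - c) ^+ 2 + 2 * b * f v))%:E =
    I2 + (2 * b * f v + 2 * a * f v)%:E)%E.
  rewrite -e1 -e2; apply: eq_integral => w _; congr (_%:E).
  have -> : a = f v - c + b by lra.
  by ring.
have e4 : (I2 + (2 * b * f v + 2 * a * f v)%:E = I1 + ((f v - c) ^+ 2)%:E + (2 * b * f v + 2 * a * f v)%:E)%E.
  by rewrite -e3 -addeA -EFinD; congr (_ + _%:E)%E; ring.
have -> : I2 = (I1 + ((f v - c) ^+ 2)%:E)%E.
  have := congr1 (fun x => x - (2 * b * f v + 2 * a * f v)%:E)%E e4.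
  by rewrite !addeK.
by rewrite leeDl // lee_fin sqr_ge0.
Qed.

Lemma variance_lower chi'' : chi'' < chib -> exists2 c : R, 0 < c &
  forall v, v != 0 -> ((c * vn v `^ (2 * chi''))%:E <= 'V_P[fpp_time tau v])%E.
Proof.
move=> hchi; have [] := @h_low chi'' (xib - 1) hchi _; first by rewrite ltrBlDr ltrDl.
set S := ereal_inf _ => S0 _.
have [c c0 cS] : exists2 c : R, 0 < c & (c%:E <= S)%E.
  case: (S) S0 => [r|_|//]; first by rewrite lte_fin => r0; exists r.
  by exists 1 => //; rewrite leey.
exists c => // v vN0.
have p0 : 0 < vn v `^ (2 * chi'') by rewrite powR_gt0 // vnorm_gt0.
have : (c%:E <= 'V_P[fpp_time tau v] * ((vn v `^ (2 * chi''))^-1)%:E)%E.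
  by apply: le_trans cS _; apply: ereal_inf_lbound; exists v.
move=> /(lee_wpmul2r (ltW p0 : (0 <= (vn v `^ (2 * chi''))%:E)%E)).
by rewrite -muleA -!EFinM mulVf ?gt_eqF // mule1.
Qed.

Lemma sqr_sum_le n (a : 'I_n -> R) : (\sum_i a i) ^+ 2 <= n%:R * \sum_i a i ^+ 2.
Proof.
pose x : 'rV[R]_n := \row_i a i; pose y : 'rV[R]_n := const_mx 1.
have xy : dot x y = \sum_i a i by apply: eq_bigr => i _; rewrite !mxE mulr1.
have yy : dot y y = n%:R.
  rewrite /dot; under eq_bigr do rewrite !mxE mulr1.
  by rewrite sumr_const card_ord.
have xx : dot x x = \sum_i a i ^+ 2 by apply: eq_bigr => i _; rewrite !mxE expr2.
rewrite -xy -yy -xx -!sqr_enorm -exprMn -(real_normK (num_real (dot x y))).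
rewrite ler_pXn2r ?nnegrE ?mulr_ge0 ?enorm_ge0 // mulrC.
exact: normr_dot.
Qed.

Lemma ptime_line x (e : 'rV[int]_d) n w :
  ptime x (x + e *+ n) w <= \sum_(i < n) ptime (x + e *+ i) (x + e *+ i + e) w.
Proof.
elim: n => [|n IH]; first by rewrite mulr0n addr0 big_ord0 /ptime passage_self.
rewrite big_ord_recr /= mulrSr addrA.
by apply: le_trans (ptime_triangle tau_ge0 _ (x + e *+ n) _ _) _; rewrite lerD2r.
Qed.

(** By the triangle inequality the passage time over [n] unit steps is at most a
    sum of [n] variables of the same law, whose second moment is of order
    [n ^ 2]. *)
Lemma variance_exponent_le1 : (0 < d)%N -> chib <= 1.
Proof.
move=> d0; rewrite leNgt; apply/negP => chib1.
pose e : 'rV[int]_d := delta_mx 0 (Ordinal d0).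
have ve : vn e = 1 by exact: vnorm_delta.
have eN0 : e != 0 by apply/eqP => h; have := ve; rewrite h vnorm0 => /eqP; rewrite eq_sym oner_eq0.
have chi1 : chi < chi + 1 by rewrite ltrDl.
have [C C0 /(_ e eN0)] := central_moment tau_ge0 h_up 2 chi1.
rewrite ve powR1 expr1n mulr1 => hC.
pose M := 2 * C + 2 * f e ^+ 2.
have sq_m x y : measurable_fun setT (fun w => ((ptime x y w) ^+ 2)%:E).
  by apply/measurable_EFinP; apply: measurable_funX; exact: measurable_ptime.
have step x : (\int[P]_w ((ptime x (x + e) w) ^+ 2)%:E <= M%:E)%E.
  have -> : (\int[P]_w ((ptime x (x + e) w) ^+ 2)%:E = \int[P]_w ((ptime 0 e w) ^+ 2)%:E)%E.
    apply: (@eq_law_integral _ _ _ P (ptime x (x + e)) (ptime 0 e) (fun r => (r ^+ 2)%:E)).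
    - exact: measurable_ptime.
    - exact: measurable_ptime.
    - move=> B mB; have := ptime_law tau_ge0 tau_iid 0 e x mB.
      by rewrite add0r [e + x]addrC.
    - by apply/measurable_EFinP; apply: measurable_funX; exact: measurable_id.
    - by move=> r; rewrite lee_fin sqr_ge0.
  have m1 : measurable_fun setT (fun w => (`|ptime 0 e w - f e| ^+ 2)%:E).
    apply/measurable_EFinP; apply: measurable_funX; apply: measurableT_comp.
      exact: normr_measurable.
    by apply: measurable_funB; [exact: measurable_ptime|exact: measurable_cst].
  have p0 w : setT w -> (0 <= (`|ptime 0 e w - f e| ^+ 2)%:E)%E.
    by rewrite lee_fin sqr_ge0.
  have p1 w : setT w -> (0 <= 2%:E * (`|ptime 0 e w - f e| ^+ 2)%:E)%E.
    by rewrite -EFinM lee_fin mulr_ge0 // sqr_ge0.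
  have p2 (w : T) : setT w -> (0 <= (2 * f e ^+ 2)%:E)%E by rewrite lee_fin mulr_ge0 // sqr_ge0.
  have m2 : measurable_fun setT (fun w => 2%:E * (`|ptime 0 e w - f e| ^+ 2)%:E)%E.
    exact: measurable_funeM.
  have m3 : measurable_fun setT (fun _ : T => (2 * f e ^+ 2)%:E) by exact: measurable_cst.
  apply: (@le_trans _ _ (\int[P]_w (2%:E * (`|ptime 0 e w - f e| ^+ 2)%:E + (2 * f e ^+ 2)%:E))%E).
    apply: ge0_le_integral => //.
    - by move=> w _; rewrite lee_fin sqr_ge0.
    - exact: emeasurable_funD.
    - move=> w _; rewrite -EFinM -EFinD lee_fin real_normK ?num_real //.
      have := sqr_ge0 (ptime 0 e w - 2 * f e); lra.
  rewrite (ge0_integralD P measurableT p1 m2 p2 m3).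
  rewrite (ge0_integralZl_EFin P measurableT p0 m1 (ler0n R 2)).
  rewrite /M (EFinD (2 * C)); apply: leeD; first by rewrite (EFinM 2 C); apply: lee_wpmul2l.
  rewrite le_eqVlt; apply/orP; left; apply/eqP.
  transitivity ((2 * f e ^+ 2)%:E * P setT)%E; first exact: integral_cst.
  by rewrite probability_setT mule1.
have M0 : 0 <= M by rewrite addr_ge0 // mulr_ge0 // sqr_ge0.
have upper n : ('V_P[fpp_time tau (e *+ n)] <= (n%:R ^+ 2 * M)%:E)%E.
  apply: le_trans (variance_le _ (lexx 0)) _.
  apply: (@le_trans _ _ (\int[P]_w (n%:R%:E * \sum_(i < n) ((ptime (e *+ i) (e *+ i + e) w) ^+ 2)%:E))%E).
    apply: ge0_le_integral => //.
    - by move=> w _; rewrite lee_fin sqr_ge0.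
    - apply/measurable_EFinP; apply: measurable_funX; apply: measurable_funB.
        exact: measurable_ptime.
      exact: measurable_cst.
    - by apply: measurable_funeM; exact: emeasurable_sum.
    - move=> w _; rewrite sumEFin -EFinM lee_fin subr0.
      apply: le_trans (sqr_sum_le _); rewrite ler_pXn2r ?nnegrE ?sumr_ge0 ?ptime_ge0 //.
        by have := ptime_line 0 e n w; under eq_bigr do rewrite add0r; rewrite add0r.
      by move=> i _; rewrite ptime_ge0.
  rewrite ge0_integralZl_EFin //; last 2 first.
  - by move=> w _; rewrite sume_ge0 // => i _; rewrite lee_fin sqr_ge0.
  - exact: emeasurable_sum.
  rewrite ge0_integral_sum //; last by move=> i w _; rewrite lee_fin sqr_ge0.
  have -> : (n%:R ^+ 2 * M)%:E = (n%:R%:E * (n%:R * M)%:E)%E by rewrite -EFinM expr2 mulrA.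
  apply: lee_wpmul2l; first by rewrite lee_fin.
  have -> : (n%:R * M)%:E = (\sum_(i < n) M%:E)%E.
    by rewrite sumEFin sumr_const card_ord mulr_natl.
  by apply: lee_sum => i _; exact: step.
pose q := (1 + chib) / 2.
have q1 : 1 < q by rewrite /q; lra.
have qchib : q < chib by rewrite /q; lra.
have [c c0 lower] := variance_lower qchib.
have q2 : 2 < 2 * q by lra.
have [N [N1 hN]] := powR_dominates ((M + 1) / c) q2.
pose n := (Num.truncn N).+1; have nN : N < n%:R by exact: truncnS_gt.
have vne : vn (e *+ n) = n%:R by rewrite vnormMn ve mulr1.
have n0 : e *+ n != 0.
  by apply/eqP => h; have := vne; rewrite h vnorm0 => /esym/eqP; rewrite pnatr_eq0.
have := le_trans (lower _ n0) (upper n); rewrite lee_fin vne leNgt => /negP; apply.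
have := hN _ (ltW nN); rewrite powR_mulrn // mulrAC ler_pdivrMr // mulrC => h.
apply: (@lt_le_trans _ _ (n%:R ^+ 2 * (M + 1))); last by lra.
by rewrite ltr_pM2l ?exprn_gt0 ?ltr0n // ltrDl.
Qed.

End geodesics_and_variance.

(** * Tubes and uniform estimates *)

Lemma exists_exponent (R : realType) (e p q : R) : e < 0 ->
  exists K : nat, q + e * K%:R < - p.
Proof.
move=> e0; pose K := (Num.truncn (`|p + q| / - e)).+1; exists K.
have ne0 : 0 < - e by rewrite oppr_gt0.
have : `|p + q| / - e < K%:R by exact: truncnS_gt.
rewrite ltr_pdivrMr //; have := ler_norm (p + q); lra.
Qed.

Lemma powR_natK (R : realType) (x e : R) (K : nat) : (x `^ e) ^+ K = x `^ (e * K%:R).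
Proof. by rewrite powRrM powR_mulrn // powR_ge0. Qed.

Section tube_geometry.
Variables (R : realType) (d : nat).
Local Notation vn := (@vertex_norm R d).
Local Notation rv := (@to_real R d).

Lemma mem_edge_segment (e : edge d) a : a \in endpoints e -> edge_segment e (rv a).
Proof.
rewrite mem_endpoints => /orP[/eqP ->|/eqP ->].
  by exists 0; rewrite ?scale0r ?addr0 //= in_itv /= lexx ler01.
by exists 1; rewrite ?scale1r 1?addrC ?subrK //= in_itv /= lexx ler01.
Qed.

Lemma tube_endpoint v rho e a : e \in tube v rho -> a \in endpoints e ->
  exists2 s : R, 0 <= s <= 1 & euclidean_norm (rv a - s *: rv v) <= rho + 1.
Proof.
move=> /asboolP/[swap] /mem_edge_segment ea /(_ _ ea) le_rho.
set S := [set euclidean_norm (rv a - q) | q in segment 0 (rv v)].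
have hS : has_inf S.
  split; last by exists 0 => _ [q _ <-]; exact: enorm_ge0.
  exists (euclidean_norm (rv a - 0)); exists 0 => //; exists 0.
    by rewrite /= in_itv /= lexx ler01.
  by rewrite scale0r addr0.
have [_ [_ [s s01 <-] <-]] := inf_adherent ltr01 hS.
rewrite add0r subr0 => /ltW h; exists s; first by move: s01; rewrite /= in_itv.
by apply: le_trans h _; rewrite lerD2r.
Qed.

(** Signed distance travelled in the direction of [v]. *)
Definition level v a : R := dot (rv a) (rv v) / vn v.

Lemma level_link v e a b : v != 0 -> link e a b -> level v b <= level v a + 1.
Proof.
move=> vN0 l; rewrite -lerBlDl /level -mulrBl ler_pdivrMr ?vnorm_gt0 // mul1r.
rewrite -dotNl -dotDl -to_realN -to_realD; apply: le_trans (ler_norm _) _.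
apply: le_trans (normr_dot _ _) _; rewrite ler_piMl ?enorm_ge0 //.
rewrite -[euclidean_norm _]/(vn _); case/orP: l => /andP[/eqP -> /eqP ->].
  by rewrite addrAC subrr add0r vnorm_delta.
by rewrite opprD addrA subrr sub0r vnormN vnorm_delta.
Qed.

(** The level of [a] and its projection to the axis agree up to the distance [r]
    of [a] from the axis. *)
Lemma near_axis v a s c r : v != 0 -> euclidean_norm (rv a - s *: rv v) <= r ->
  c <= level v a <= c + 1 ->
  euclidean_norm (rv a - (c / vn v) *: rv v) <= 2 * r + 1.
Proof.
move=> vN0 ar /andP[ca ac]; have v0 := vnorm_gt0 R vN0.
have la : `|level v a - s * vn v| <= r.
  apply: le_trans ar; have -> : level v a - s * vn v = dot (rv a - s *: rv v) (rv v) / vn v.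
    rewrite dotDl dotNl dotZl -sqr_enorm -[euclidean_norm (rv v)]/(vn v) /level.
    by field; rewrite gt_eqF.
  rewrite normrM normfV (gtr0_norm v0) ler_pdivrMr //.
  exact: normr_dot.
have sc : `|(s - c / vn v) * vn v| <= r + 1.
  have -> : (s - c / vn v) * vn v = s * vn v - c by field; rewrite gt_eqF.
  move: la; rewrite !ler_norml; lra.
have -> : rv a - (c / vn v) *: rv v = (rv a - s *: rv v) + (s - c / vn v) *: rv v.
  by rewrite scalerBl addrA subrK.
apply: le_trans (enormD _ _) _; rewrite enormZ.
by move: sc; rewrite normrM (gtr0_norm v0) -[euclidean_norm (rv v)]/(vn v); lra.
Qed.

Lemma geodesic_split (t : edge d -> R) v rho g c1 c2 : (forall e, 0 <= t e) ->
  v != 0 -> path_containing 0 v g -> all (tube v rho) g ->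
  path_time t g <= passage_time t 0 v -> 0 <= c1 -> c1 <= c2 -> c2 <= vn v ->
  exists a b, [/\ euclidean_norm (rv a - (c1 / vn v) *: rv v) <= 2 * rho + 3,
    euclidean_norm (rv b - (c2 / vn v) *: rv v) <= 2 * rho + 3 &
    passage_time t 0 a + passage_time t a b + passage_time t b v <= passage_time t 0 v].
Proof.
move=> t0 vN0 gp gt gle c10 c12 c2v.
have v0 := vnorm_gt0 R vN0.
have [||||a [b [ga gb la lb tab]]] := path_time_split (L := level v) (c1 := c1) (c2 := c2)
    t0 (fun e a b => @level_link v e a b vN0) gp.
- by rewrite eq_sym.
- by rewrite /level to_real0 -(scale0r 0) dotZl mul0r mul0r.
- by [].
- by apply: le_trans c2v _; rewrite /level -sqr_enorm -[euclidean_norm (rv v)]/(vn v) expr2 mulfK // gt_eqF.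
have near z c : visits g z -> c <= level v z <= c + 1 ->
    euclidean_norm (rv z - (c / vn v) *: rv v) <= 2 * rho + 3.
  move=> /hasP[e eg ze] lz; have et : e \in tube v rho by exact: (allP gt).
  have [s _ sz] := tube_endpoint et ze.
  by apply: le_trans (near_axis vN0 sz lz) _; lra.
exists a, b; split; [exact: near|exact: near|exact: le_trans gle].
Qed.

End tube_geometry.

Section mean_time_estimates.
Variables (R : realType) (d : nat) (disp : measure_display).
Variables (T : measurableType disp) (P : probability T R) (mu : probability R R).
Variable tau : edge d -> {RV P >-> R}.
Hypothesis tau_ge0 : forall e w, 0 <= tau e w.
Hypothesis tau_iid : iid tau mu.
Local Notation vn := (@vertex_norm R d).
Local Notation rv := (@to_real R d).
Local Notation pr := (pr P).
Local Notation f := (mean_time tau).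
Local Notation ptime := (ptime tau).
Variables (chi xi chib xib : R).
Hypothesis h_up : upper_exponents tau chi xi.
Hypothesis h_low : lower_exponents tau chib xib.

(** A union bound over polynomially many endpoints: the tail estimate decays
    faster than any power of [m]. *)
Lemma uniform_fluctuation chi' A p : 0 <= chi -> chi < chi' -> 1 <= A ->
  exists M : R, 1 <= M /\ forall m, M <= m -> forall x, exists B : set T,
   [/\ measurable B, pr B <= m `^ (- p) &
     forall w, ~ B w -> forall b, vn b <= A * m ->
       `|ptime x (x + b) w - f b| < m `^ chi' /\
       `|ptime (x - b) x w - f b| < m `^ chi'].
Proof.
move=> chi0 hchi A1; pose chi1 := (chi + chi') / 2.
have c1 : chi < chi1 by rewrite /chi1; lra.
have c2 : chi1 - chi' < 0 by rewrite /chi1; lra.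
have c10 : 0 <= chi1 by rewrite /chi1; lra.
have [K hK] := exists_exponent p (d%:R) c2.
have [C C0 hC] := fluctuation_tail tau_ge0 tau_iid h_up K c1 c10.
pose D := 2 * C * (5 * A) ^+ d * (A `^ chi1) ^+ K.
have [M [M1 hM]] := powR_dominates D hK.
exists M; split => // m mM x.
have m1 : 1 <= m by apply: le_trans mM.
have m0 : 0 < m by lra.
have A0 : 0 < A by lra.
have Am1 : 1 <= A * m by nra.
pose k := (Num.truncn (A * m)).+1.
pose s := [seq b <- cube d k | vn b <= A * m].
pose F b := [set w | m `^ chi' <= `|ptime x (x + b) w - f b|].
pose G b := [set w | m `^ chi' <= `|ptime (x - b) x w - f b|].
have mF b : measurable (F b) by exact: measurable_fluctuation.
have mG b : measurable (G b) by exact: measurable_fluctuation.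
exists (\big[setU/set0]_(b <- s) (F b `|` G b)); split.
- by apply: bigsetU_measurable => b _; exact: measurableU.
- apply: le_trans (pr_bigU P _ _) _; first by move=> b; exact: measurableU.
  have t0 : 0 < m `^ chi' by rewrite powR_gt0.
  pose E := C * ((A * m) `^ chi1 / m `^ chi') ^+ K.
  have step b : b \in s -> pr (F b `|` G b) <= 2 * E.
    rewrite mem_filter => /andP[bA _]; apply: le_trans (pr_setU P (mF b) (mG b)) _.
    have h1 := hC _ x b _ bA t0; have h2 := hC _ (x - b) b _ bA t0.
    rewrite subrK in h2; rewrite -/E in h1 h2; rewrite -[X in X <= _]/(pr (F b) + pr (G b)).
    have h1' : pr (F b) <= E := h1; have h2' : pr (G b) <= E := h2; lra.
  apply: (@le_trans _ _ (\sum_(b <- s) 2 * E)).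
    by rewrite big_seq [leRHS]big_seq; apply: ler_sum => b /step.
  rewrite big_const_seq count_predT iter_addr_0 -[_ *+ size s]mulr_natl.
  have E0 : 0 <= 2 * E by rewrite !mulr_ge0 // exprn_ge0 // divr_ge0 ?powR_ge0.
  have size_s : (size s)%:R <= (5 * A) ^+ d * m ^+ d.
    apply: (@le_trans _ _ ((k.*2.+1 ^ d)%N%:R)).
      by rewrite ler_nat -size_cube size_filter count_size.
    rewrite natrX -exprMn; apply: lerXn2r; rewrite ?nnegrE //; first by rewrite !mulr_ge0 // ltW.
    have : k.-1%:R <= A * m.
      by rewrite /k /=; have /andP[] := truncn_itv (le_trans ler01 Am1).
    rewrite /k /=; set q := Num.truncn _ => qA.
    have -> : (q.+1.*2.+1)%:R = 2 * q%:R + 3 :> R.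
      by rewrite -mul2n -natr1 natrM -natr1; ring.
    lra.
  apply: le_trans (ler_wpM2r E0 size_s) _.
  apply: le_trans (hM _ mM).
  rewrite /E powRM ?(ltW A0) ?(ltW m0) //.
  have -> : A `^ chi1 * m `^ chi1 / m `^ chi' = A `^ chi1 * m `^ (chi1 - chi').
    rewrite -mulrA; congr (_ * _); rewrite powRD ?powRN //.
    by rewrite (gt_eqF m0) implybT.
  rewrite [(A `^ chi1 * _) ^+ K]exprMn [(m `^ _) ^+ K]powR_natK /D.
  have -> : m `^ (d%:R + (chi1 - chi') * K%:R) = m ^+ d * m `^ ((chi1 - chi') * K%:R).
    rewrite powRD ?powR_mulrn ?(ltW m0) //; by rewrite (gt_eqF m0) implybT.
  by rewrite le_eqVlt; apply/orP; left; apply/eqP; ring.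
move=> w; rewrite -bigcup_seq => nB b bA.
have bs : b \in s.
  rewrite mem_filter bA; apply: (@mem_cube R); apply: le_trans bA _.
  by apply: ltW; exact: truncnS_gt.
by split; rewrite ltNge; apply/negP => h; apply: nB; exists b => //; [left|right].
Qed.

Lemma tube_probability xi' A gam sig p : xi < xi' -> 0 <= xi' -> 0 <= A -> 0 <= gam ->
  gam * xi' < sig ->
  exists M : R, 1 <= M /\ forall m, M <= m -> forall v, v != 0 -> vn v <= A * m `^ gam ->
    pr (~` [set w | geodesic_within (tube v (m `^ sig)) 0 v (sample tau w)]) <= m `^ (- p).
Proof.
move=> hxi xi0 A0 gam0 hs; have e0 : gam * xi' - sig < 0 by lra.
have [K hK] := exists_exponent p 0 e0; rewrite add0r in hK.
have [C C0 hC] := geodesic_in_tube tau_ge0 h_up h_low K hxi.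
have [M [M1 hM]] := powR_dominates (C * (A `^ xi') ^+ K) hK.
exists M; split => // m mM v vN0 vA.
have m0 : 0 < m by apply: lt_le_trans mM; lra.
apply: le_trans (hC v _ vN0 _) _; first by rewrite powR_gt0.
apply: le_trans (hM _ mM); rewrite -mulrA ler_wpM2l // -powR_natK -exprMn.
have q0 : 0 < m `^ sig by rewrite powR_gt0.
apply: lerXn2r.
- by rewrite nnegrE divr_ge0 ?powR_ge0.
- by rewrite nnegrE mulr_ge0 ?powR_ge0.
have -> : m `^ (gam * xi' - sig) = (m `^ gam) `^ xi' / m `^ sig.
  by rewrite -powRrM powRD ?powRN // (gt_eqF m0) implybT.
rewrite mulrA ler_wpM2r ?invr_ge0 ?(ltW q0) // -powRM ?powR_ge0 //.
by apply: ge0_ler_powR; rewrite ?nnegrE ?vnorm_ge0 ?mulr_ge0 ?powR_ge0.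
Qed.

(** With positive probability all the passage times involved are close to their
    means and the geodesic from [0] to [w] stays in a thin tube; cutting it near
    its midpoint compares the means. *)
Lemma mean_time_split chi' theta : 0 <= chi -> chi < chi' -> xi < theta -> 0 < theta ->
  theta < 1 -> exists M0 : R, forall w, M0 <= vn w ->
  exists a, vn (a *+ 2 - w) <= vn w `^ theta /\ f a + f (w - a) <= f w + vn w `^ chi'.
Proof.
move=> chi0 hchi hxi th0 th1.
pose chi2 := (chi + chi') / 2; pose xim := Num.max xi 0.
have xim0 : 0 <= xim by rewrite le_max lexx orbT.
have ximth : xim < theta by rewrite gt_max hxi.
pose xi2 := (xim + theta) / 2; pose xi1 := (xim + xi2) / 2.
have xi1P : xi < xi1.
  have : xi <= xim by rewrite le_max lexx.
  by rewrite /xi1 /xi2; lra.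
have c2 : chi < chi2 by rewrite /chi2; lra.
have c3 : chi2 < chi' by rewrite /chi2; lra.
have x10 : 0 <= xi1 by rewrite /xi1 /xi2; lra.
have x12 : 1 * xi1 < xi2 by rewrite /xi1 /xi2; lra.
have x2t : xi2 < theta by rewrite /xi2; lra.
have [M1 [M11 hM1]] := uniform_fluctuation 2 chi0 c2 (ler1n R 3 : 1 <= 3).
have [M2 [M21 hM2]] := tube_probability 2 xi1P x10 ler01 ler01 x12.
have [M3 [M31 hM3]] := powR_dominates 3 c3.
have [M4 [M41 hM4]] := powR_dominates 20 x2t.
have [M5 [M51 hM5]] := powR_dominates 1 th1.
exists (Num.max M1 (Num.max M2 (Num.max M3 (Num.max M4 (Num.max M5 2))))) => v.
rewrite !ge_max => /and5P[n1 n2 n3 n4 /andP[n5 n6]]; set n := vn v in n1 n2 n3 n4 n5 n6 *.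
have n0 : 0 < n by lra.
have vN0 : v != 0 by apply: contraTN n0 => /eqP v0; rewrite /n v0 vnorm0 ltxx.
have [B1 [mB1 pB1 hB1]] := hM1 n n1 0.
have [B2 [mB2 pB2 hB2]] := hM1 n n1 v.
set rho := n `^ xi2 in hM2.
have := hM2 n n2 v vN0; rewrite powRr1 ?(ltW n0) // mul1r lexx => /(_ isT).
set G := [set w | geodesic_within _ _ _ _] => pG.
have mG : measurable G.
  apply: (preimage_config_measurable (measurable_sample tau)).
  exact: measurable_geodesic_within.
have p2 : n `^ (- 2) <= 4^-1.
  rewrite powRN powR_mulrn ?(ltW n0) // lef_pV2 ?posrE ?exprn_gt0 //.
  have -> : (4 : R) = 2 ^+ 2 by rewrite expr2; lra.
  by apply: lerXn2r; rewrite ?nnegrE // ltW.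
have mU := measurableU _ _ (measurableU _ _ mB1 mB2) (measurableC mG).
have [w] : exists w, (~` (B1 `|` B2 `|` ~` G)) w.
  apply: (@pr_exists _ _ _ P); first exact: measurableC.
  rewrite pr_setC // subr_gt0.
  have := pr_setU P (measurableU _ _ mB1 mB2) (measurableC mG).
  have := pr_setU P mB1 mB2; rewrite /pr in pG pB1 pB2 *; lra.
rewrite !setCU setCK => -[[nB1 nB2] [g [gp gt gle]]].
have [||a [b [a1 _ Tab]]] := @geodesic_split R d _ v rho g (n / 2) (n / 2)
    (abs_weight_ge0 (sample tau w)) vN0 gp gt gle _ (lexx _).
- by rewrite divr_ge0 // ltW.
- by rewrite -/n ler_pdivrMr //; lra.
have half : n / 2 / vn v = 2^-1 by rewrite -/n; field; rewrite gt_eqF.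
rewrite half in a1.
rewrite -!ptimeE // in Tab.
have rho1 : 1 <= rho.
  by rewrite -(powRr0 n); apply: ler_powR; rewrite /xi2; lra.
have r1 : 20 * rho <= n `^ theta by exact: hM4.
have r2 : n `^ theta <= n by have := hM5 n n5; rewrite mul1r powRr1 // ltW.
have a2 : vn (a *+ 2 - v) <= n `^ theta.
  have -> : vn (a *+ 2 - v) = 2 * euclidean_norm (rv a - 2^-1 *: rv v).
    rewrite /vertex_norm to_realB to_realMn -[X in X * euclidean_norm _]gtr0_norm //.
    by rewrite -enormZ scalerBr scalerA divff // scale1r.
  lra.
have a3 : vn a <= 3 * n.
  have : vn (a *+ 2) <= n `^ theta + n.
    by rewrite -(subrK v (a *+ 2)); apply: le_trans (vnormD _ _ _) _; rewrite lerD2r.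
  by rewrite vnormMn; lra.
have a4 : vn (v - a) <= 3 * n.
  have : vn ((v - a) *+ 2) <= n + n `^ theta.
    have -> : (v - a) *+ 2 = v - (a *+ 2 - v) by rewrite mulrnBl mulr2n opprB addrA.
    by apply: le_trans (vnormB _ _ _) _; rewrite lerD2l.
  by rewrite vnormMn; lra.
exists a; split => //.
have [+ _] := hB1 w nB1 a a3; rewrite add0r => h1.
have [_ h2] := hB2 w nB2 (v - a) a4; rewrite subKr in h2.
have v3 : vn v <= 3 * n by rewrite -/n; lra.
have [+ _] := hB1 w nB1 v v3; rewrite add0r => h3.
have h4 := ptime_triangle tau_ge0 a b v w.
have h5 := hM3 n n3.
move: h1 h2 h3; rewrite !ltr_norml; lra.
Qed.

End mean_time_estimates.

(** * Disjoint tubes and concentration *)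

Section disjoint_tubes.
Variables (R : realType) (d : nat).
Local Notation vn := (@vertex_norm R d).
Local Notation rv := (@to_real R d).

Lemma orthogonal_vector (x : 'rV[R]_d) : (1 < d)%N ->
  exists2 y : 'rV[R]_d, y != 0 & dot x y = 0.
Proof.
move=> d2; pose i0 := Ordinal (ltnW d2); pose i1 := Ordinal d2.
have dotE (z : 'rV[R]_d) i : dot z (delta_mx 0 i) = z 0 i.
  rewrite /dot (bigD1 i) //= big1 ?addr0; first by rewrite mxE !eqxx mulr1.
  by move=> j ji; rewrite mxE (negPf ji) andbF mulr0.
have [x0|x0] := eqVneq (x 0 i0) 0.
  exists (delta_mx 0 i0); last by rewrite dotE.
  by apply/eqP => /rowP/(_ i0); rewrite !mxE !eqxx => /eqP; rewrite oner_eq0.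
exists (x 0 i1 *: delta_mx 0 i0 - x 0 i0 *: delta_mx 0 i1).
  apply: contraNneq x0 => /rowP/(_ i1); rewrite !mxE !eqxx /= mulr0 mulr1 sub0r.
  by move/eqP; rewrite oppr_eq0.
by rewrite dotDr dotNr !dotZr !dotE mulrC subrr.
Qed.

Lemma orthogonal_vertex v r : (1 < d)%N -> 0 <= r -> exists y,
  [/\ `|dot (rv v) (rv y)| <= d%:R * vn v, r <= vn y & vn y <= r + 2 * d%:R].
Proof.
move=> d2 r0; have [x xN0 vx] := orthogonal_vector (rv v) d2.
have x0 : 0 < euclidean_norm x.
  rewrite lt_def enorm_ge0 andbT; apply: contra xN0 => /eqP h.
  by apply/eqP/enorm_eq0.
pose x' := ((r + d%:R) / euclidean_norm x) *: x.
have x'n : euclidean_norm x' = r + d%:R.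
  rewrite enormZ ger0_norm; last by rewrite divr_ge0 ?addr_ge0 // ltW.
  by rewrite divfK // gt_eqF.
have [y yx] := round_vector x'; exists y.
have e : rv y = x' + (rv y - x') by rewrite addrC subrK.
split.
- rewrite e dotDr dotZr vx mulr0 add0r; apply: le_trans (normr_dot _ _) _.
  by rewrite mulrC ler_wpM2r ?enorm_ge0.
- have : euclidean_norm x' <= vn y + d%:R.
    have -> : x' = rv y + (x' - rv y) by rewrite addrC subrK.
    by apply: le_trans (enormD _ _) _; rewrite lerD2l enormBC.
  by rewrite x'n lerD2r.
- rewrite /vertex_norm e; apply: le_trans (enormD _ _) _; rewrite x'n; lra.
Qed.

(** A common edge would put [y] within [2 rho + 2] of the line spanned by [v],
    which is impossible for a longer vector nearly orthogonal to [v]. *)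
Lemma tube_disjoint v y rho (e : edge d) : `|dot (rv v) (rv y)| <= d%:R * vn v ->
  0 <= rho -> 2 * rho + 3 + d%:R <= vn y ->
  tube v rho e -> ~~ tube v rho (shift_edge (- y) e).
Proof.
move=> orth rho0 ylarge et; apply/negP => et'.
have e1 : e.1 \in endpoints e by rewrite mem_endpoints eqxx.
have e2 : e.1 - y \in endpoints (shift_edge (- y) e) by rewrite mem_endpoints eqxx.
have [s _ hs] := tube_endpoint et e1.
have [s' _ hs'] := tube_endpoint et' e2.
have h : euclidean_norm (rv y - (s - s') *: rv v) <= 2 * rho + 2.
  have -> : rv y - (s - s') *: rv v =
      (rv e.1 - s *: rv v) - (rv (e.1 - y) - s' *: rv v).
    rewrite to_realB; apply/rowP => i; rewrite !mxE; ring.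
  by apply: le_trans (enormB _ _) _; lra.
set t := s - s' in h.
have sq : euclidean_norm (rv y - t *: rv v) ^+ 2 =
    vn y ^+ 2 - 2 * t * dot (rv v) (rv y) + t ^+ 2 * vn v ^+ 2.
  rewrite /vertex_norm !sqr_enorm dotDl !dotDr !dotNl !dotNr !dotZl !dotZr (dotC (rv y)); ring.
have h2 : euclidean_norm (rv y - t *: rv v) ^+ 2 <= (2 * rho + 2) ^+ 2.
  by apply: lerXn2r; rewrite ?nnegrE ?enorm_ge0 //; lra.
have h3 : t * dot (rv v) (rv y) <= `|t| * (d%:R * vn v).
  by apply: le_trans (ler_norm _) _; rewrite normrM ler_wpM2l.
have h4 : (2 * rho + 2 + d%:R + 1) ^+ 2 <= vn y ^+ 2.
  have d0 : 0 <= (d%:R : R) by [].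
  by apply: lerXn2r; rewrite ?nnegrE ?vnorm_ge0 //; lra.
have h5 := sqr_ge0 (`|t| * vn v - d%:R).
have h6 : (`|t| * vn v) ^+ 2 = t ^+ 2 * vn v ^+ 2 by rewrite exprMn real_normK ?num_real.
have d0 : 0 <= (d%:R : R) by [].
have h7 : 0 <= rho * d%:R by rewrite mulr_ge0.
move: h2; rewrite sq -h6; set z := `|t| * vn v in h3 h5 h6 *.
have e3 : `|t| * (d%:R * vn v) = d%:R * z by rewrite /z; ring.
rewrite e3 in h3.
move: h4 h5; rewrite !expr2; lra.
Qed.

End disjoint_tubes.

Section concentration.
Variables (R : realType) (d : nat) (disp : measure_display).
Variables (T : measurableType disp) (P : probability T R) (mu : probability R R).
Variable tau : edge d -> {RV P >-> R}.
Hypothesis tau_ge0 : forall e w, 0 <= tau e w.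
Hypothesis tau_iid : iid tau mu.
Local Notation pr := (pr P).
Local Notation ptime := (ptime tau).

Let pt_restr (S : pred (edge d)) w g : all S g ->
  path_time (abs_weight (restricted_sample tau S w)) g = path_time (abs_weight (sample tau w)) g.
Proof.
move=> /allP gS; rewrite /path_time big_seq [RHS]big_seq; apply: eq_bigr => e /gS eS.
by rewrite /abs_weight /restricted_sample eS.
Qed.

Let fast_restr (S : pred (edge d)) x y c : (sample tau) @^-1` fast_path S x y c =
  (restricted_sample tau S) @^-1` fast_path S x y c.
Proof.
by apply/seteqP; split=> w /= [g [gp gS gc]]; exists g; split => //; move: gc; rewrite pt_restr.
Qed.

Let measurable_fast (S : pred (edge d)) x y c : measurable ((sample tau) @^-1` fast_path S x y c).
Proof.
by apply: (preimage_config_measurable (measurable_sample tau)); exact: measurable_fast_path.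
Qed.

Lemma fast_path_indep (S S' : pred (edge d)) (x y x' y' : 'rV[int]_d) (c c' : R) :
  (forall e, S e -> ~~ S' e) ->
  pr ((sample tau) @^-1` fast_path S x y c `&` (sample tau) @^-1` fast_path S' x' y' c') =
  pr ((sample tau) @^-1` fast_path S x y c) * pr ((sample tau) @^-1` fast_path S' x' y' c').
Proof.
move=> SS'; apply: EFin_inj; rewrite EFinM -!prE //; last exact: measurableI.
rewrite !fast_restr; apply: (restricted_sample_indep tau_iid SS');
exact: measurable_fast_path.
Qed.

Lemma measurable_ptime_le x y c : measurable [set w | ptime x y w <= c].
Proof.
rewrite -[X in measurable X]setTI; apply: measurable_fun_le => //.
exact: measurable_ptime.
Qed.

Lemma measurable_far_ptime x y c r : measurable [set w | r < `|ptime x y w - c|].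
Proof.
rewrite (_ : [set w | _] = ~` [set w | `|ptime x y w - c| <= r]).
  apply: measurableC; rewrite -[X in measurable X]setTI; apply: measurable_fun_le => //.
  apply: measurableT_comp; first exact: normr_measurable.
  by apply: measurable_funB; [exact: measurable_ptime|exact: measurable_cst].
by apply/seteqP; split=> w /=; rewrite ltNge => /negP.
Qed.

(** Two independent copies of a random variable, one of which is unlikely to
    exceed the other by [s], are both concentrated near a median: at a level [c]
    below which the second copy lies with probability bounded from below, the
    first must lie below [c + s] with probability close to one.  The passage
    times [0 -> v] and [y -> v + y] play the role of the two copies, being
    determined with high probability by the weights in disjoint tubes. *)
Lemma passage_time_concentration (v y : 'rV[int]_d) (rho s delta : R) : 0 < s -> delta <= 16^-1 ->
  (forall e, tube v rho e -> ~~ tube v rho (shift_edge (- y) e)) ->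
  pr (~` [set w | geodesic_within (tube v rho) 0 v (sample tau w)]) <= delta ->
  pr [set w | s < ptime 0 v w - ptime y (v + y) w] <= delta ->
  (exists k : nat, 2^-1 <= pr [set w | ptime 0 v w <= k%:R * s]) ->
  exists2 c : R, 0 <= c & pr [set w | 2 * s < `|ptime 0 v w - c|] <= 16 * delta.
Proof.
move=> s0 delta16 disj; set G := [set w | geodesic_within _ _ _ _] => prG prX exk.
set S := tube v rho in disj G prG *.
pose S' e := S (shift_edge (- y) e).
pose E c := (sample tau) @^-1` fast_path S 0 v c.
pose E' c := (sample tau) @^-1` fast_path S' y (v + y) c.
pose F c := pr [set w | ptime 0 v w <= c].
have mE c : measurable (E c) by exact: measurable_fast.
have mE' c : measurable (E' c) by exact: measurable_fast.
have mF := measurable_ptime_le 0 v.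
have mG : measurable G.
  apply: (preimage_config_measurable (measurable_sample tau)).
  exact: measurable_geodesic_within.
have mB : measurable [set w | s < ptime 0 v w - ptime y (v + y) w].
  rewrite (_ : [set w | _] = ~` [set w | ptime 0 v w - ptime y (v + y) w <= s]).
    apply: measurableC; rewrite -[X in measurable X]setTI; apply: measurable_fun_le => //.
    by apply: measurable_funB; exact: measurable_ptime.
  by apply/seteqP; split=> w /=; rewrite ltNge => /negP.
have delta0 : 0 <= delta by apply: le_trans prG; exact: pr_ge0.
have EF c : E c `<=` [set w | ptime 0 v w <= c].
  move=> w [g [gp _ gc]] /=; rewrite (ptimeE tau_ge0); apply: le_trans gc.
  by apply: passage_le => // e; exact: abs_weight_ge0.
have FE c : [set w | ptime 0 v w <= c] `<=` E c `|` ~` G.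
  move=> w /= wc; have [[g [gp gS gle]]|] := pselect (G w); [left|by right].
  by exists g; split => //; apply: le_trans gle _; rewrite -(ptimeE tau_ge0).
have E'shift c : pr (E' c) = pr (E c).
  rewrite /pr; congr fine; rewrite -(shift_law tau_iid y (measurable_fast_path S 0 v c)).
  congr (P _); apply/seteqP; split=> w /= [g [gp gS gc]].
    exists (map (shift_edge (- y)) g); split.
    - by rewrite -(path_containing_shift y) add0r -map_comp map_id_in // => e _; exact: shift_edgeNK.
    - by rewrite all_map.
    - apply: le_trans gc; rewrite /path_time big_map le_eqVlt; apply/orP; left.
      apply/eqP/eq_bigr => e _.
      by rewrite /abs_weight /sample shift_edgeNK.
  exists (map (shift_edge y) g); split.
  - by rewrite -[X in path_containing X](add0r y) path_containing_shift.
  - by rewrite all_map; apply: sub_all gS => e; rewrite /S' /= shift_edgeK.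
  - by apply: le_trans gc; rewrite /path_time big_map.
have prEF c : pr (E c) <= F c by apply: le_pr.
have prFE c : F c <= pr (E c) + delta.
  apply: le_trans (le_pr P (mF c) (measurableU _ _ (mE c) (measurableC mG)) (@FE c)) _.
  by apply: le_trans (pr_setU P (mE c) (measurableC mG)) _; rewrite lerD2l.
have key c : (F c - delta) * (1 - F (c + s)) <= 2 * delta.
  have sub : E' c `\` E (c + s) `<=` [set w | s < ptime 0 v w - ptime y (v + y) w] `|` ~` G.
    move=> w [[g [gp _ gc]] nE]; have [Gw|] := pselect (G w); [left|by right].
    have X' : ptime y (v + y) w <= c.
      rewrite (ptimeE tau_ge0); apply: le_trans gc.
      by apply: passage_le => // e; exact: abs_weight_ge0.
    have X : c + s < ptime 0 v w.
      by rewrite ltNge; apply/negP => /(FE (c + s))[|].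
    by rewrite /=; lra.
  have mD := measurableD (mE' c) (mE (c + s)).
  have h1 : pr (E' c `\` E (c + s)) <= 2 * delta.
    apply: le_trans (le_pr P mD (measurableU _ _ mB (measurableC mG)) sub) _.
    by apply: le_trans (pr_setU P mB (measurableC mG)) _; lra.
  have h2 : pr (E' c `\` E (c + s)) = pr (E c) * (1 - pr (E (c + s))).
    have ind : pr (E (c + s) `&` E' c) = pr (E (c + s)) * pr (E' c).
      exact: fast_path_indep.
    have : pr (E' c `\` E (c + s)) = pr (E' c) - pr (E' c `&` E (c + s)).
      apply: EFin_inj; rewrite EFinB -!prE //; last exact: measurableI.
      by rewrite measureD // ltey_eq fin_num_measure.
    by rewrite setIC ind E'shift => ->; ring.
  apply: le_trans h1; rewrite h2.
  have e1 : F c - delta <= pr (E c) by rewrite lerBlDr.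
  have e2 : 1 - F (c + s) <= 1 - pr (E (c + s)) by rewrite lerD2l lerN2.
  have e3 : 0 <= 1 - F (c + s).
    by rewrite subr_ge0 -lee_fin /F -prE //; exact: probability_le1.
  have e4 := pr_ge0 P (E c).
  apply: le_trans (_ : pr (E c) * (1 - F (c + s)) <= _); first exact: ler_wpM2r.
  exact: ler_wpM2l.
(* [k s] plays the role of the median: the distribution function crosses [1/2]
   between [(k - 1) s] and [k s]. *)
pose k := ex_minn exk; have [k1 k2] : 2^-1 <= F (k%:R * s) /\
    forall j, 2^-1 <= F (j%:R * s) -> (k <= j)%N.
  by rewrite /k; case: ex_minnP => j h1 h2; split => // i; exact: h2.
exists (k%:R * s); first by rewrite mulr_ge0 // ltW.
have up : 1 - F ((k%:R + 1) * s) <= 8 * delta.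
  have := key (k%:R * s).
  have -> : k%:R * s + s = (k%:R + 1) * s by ring.
  move=> h.
  have q0 : 0 <= 1 - F ((k%:R + 1) * s).
    by rewrite subr_ge0 -lee_fin /F -prE //; exact: probability_le1.
  nra.
pose Low := if (k < 2)%N then set0 else [set w | ptime 0 v w <= (k%:R - 2) * s].
have mLow : measurable Low by rewrite /Low; case: ifP.
have low : pr Low <= 8 * delta.
  rewrite /Low; case: ifP => k_2.
    by rewrite /pr measure0 mulr_ge0.
  have k2' : (2 <= k)%N by rewrite leqNgt k_2.
  have Fk : F ((k%:R - 1) * s) < 2^-1.
    rewrite ltNge; apply/negP => h.
    have : (k <= k.-1)%N by apply: k2; rewrite -subn1 natrB // ltnW.
    by rewrite leqNgt prednK ?leqnn // ltnW.
  have := key ((k%:R - 2) * s).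
  have -> : (k%:R - 2) * s + s = (k%:R - 1) * s by ring.
  rewrite -/(F _); set A := F _ in Fk *; set A' := F _ => h; nra.
have mUp := mF ((k%:R + 1) * s).
have sub : [set w | 2 * s < `|ptime 0 v w - k%:R * s|] `<=`
    ~` [set w | ptime 0 v w <= (k%:R + 1) * s] `|` Low.
  move=> w /= h; have [le|gt] := boolP (ptime 0 v w <= (k%:R + 1) * s); last first.
    by left => le; case/negP: gt.
  right; rewrite /Low.
  have lt : ptime 0 v w < (k%:R - 2) * s.
    move: h; have [p|p] := leP 0 (ptime 0 v w - k%:R * s).
      by rewrite ger0_norm //; lra.
    by rewrite ltr0_norm //; lra.
  case: ifP => k_2 /=; last exact: ltW.
  have kk : (k%:R : R) <= 1 by rewrite -[1]/(1%:R) ler_nat -ltnS.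
  have p0 : 0 <= ptime 0 v w by exact: ptime_ge0.
  nra.
have mL := measurable_far_ptime 0 v (k%:R * s) (2 * s).
apply: le_trans (le_pr P mL (measurableU _ _ (measurableC mUp) mLow) sub) _.
apply: le_trans (pr_setU P (measurableC mUp) mLow) _.
rewrite pr_setC //; have := low; have := up; rewrite /F; lra.
Qed.

End concentration.

(** * Parallel passage times *)

Section parallel_passage_times.
Variables (R : realType) (d : nat) (disp : measure_display).
Variables (T : measurableType disp) (P : probability T R) (mu : probability R R).
Variable tau : edge d -> {RV P >-> R}.
Hypothesis tau_ge0 : forall e w, 0 <= tau e w.
Hypothesis tau_iid : iid tau mu.
Local Notation vn := (@vertex_norm R d).
Local Notation rv := (@to_real R d).
Local Notation pr := (pr P).
Local Notation f := (mean_time tau).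
Local Notation ptime := (ptime tau).
Variables (chi xi chib xib : R).
Hypothesis h_up : upper_exponents tau chi xi.
Hypothesis h_low : lower_exponents tau chib xib.

(** The geodesic of the shifted passage time leaves [y + v] and arrives at
    [y + V - v] up to the tube width.  Rerouting its two ends to start at [0] and
    finish at [V] only changes the passage times over the distance [|v|], where
    flatness bounds the change of the means. *)
Lemma reroute_ends (t : edge d -> R) v V y rho D e c N : (forall e, 0 <= t e) ->
  V = v *+ N -> (2 <= N)%N -> v != 0 ->
  (exists g, [/\ path_containing 0 V g, all (tube V rho) g &
     path_time (fun e => t (shift_edge y e)) g <=
     passage_time (fun e => t (shift_edge y e)) 0 V]) ->
  (forall u, vn u <= 2 * rho + 3 -> f (v + u + y) <= f (v + u) + D /\
      f (v + u - y) <= f (v + u) + D) ->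
  (forall b, vn b <= vn v + (2 * rho + 3) + vn y ->
    [/\ `|passage_time t y (y + b) - f b| < e,
        `|passage_time t 0 b - f b| < e,
        `|passage_time t (V - b) V - f b| < e &
        `|passage_time t (V + y - b) (V + y) - f b| < e]) ->
  2 * D + 4 * e <= c ->
  passage_time t 0 V - passage_time t y (V + y) <= c.
Proof.
move=> t0 VE N2 vN0 [g [gp gt gle]] flat fluc Dc.
have v0 := vnorm_gt0 R vN0.
have vV : vn V = N%:R * vn v by rewrite VE vnormMn.
have N0 : 0 < N%:R :> R by rewrite ltr0n (leq_trans _ N2).
have N2' : 2 <= N%:R :> R by rewrite -[2]/(2%:R) ler_nat.
have VN0 : V != 0 by apply: contraTneq (mulr_gt0 N0 v0) => V0; rewrite -vV V0 vnorm0 ltxx.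
have c12 : vn v <= vn V - vn v by rewrite vV; nra.
have [|a0 [b0 [a1 b1 Tab]]] := geodesic_split (fun e => t0 (shift_edge y e)) VN0 gp gt gle (vnorm_ge0 R v) c12.
  by rewrite lerBlDr lerDl vnorm_ge0.
have ax1 : (vn v / vn V) *: rv V = rv v.
  by rewrite vV VE to_realMn scalerA; have -> : vn v / (N%:R * vn v) * N%:R = 1;
     rewrite ?scale1r //; field; rewrite !gt_eqF.
have ax2 : ((vn V - vn v) / vn V) *: rv V = rv (V - v).
  rewrite mulrBl divff ?gt_eqF ?vnorm_gt0 // scalerBl scale1r ax1 to_realB //.
rewrite ax1 -to_realB -[euclidean_norm _]/(vn _) in a1.
rewrite ax2 -to_realB -[euclidean_norm _]/(vn _) in b1.
rewrite -!passage_time_shift add0r in Tab.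
set u := a0 - v in a1; pose u' := V - b0 - v.
have a0E : a0 = v + u by rewrite /u addrC subrK.
have u'n : vn u' <= 2 * rho + 3.
  by move: b1; rewrite -vnormN; congr (vn _ <= _); rewrite /u' !opprB; apply/rowP => i; rewrite !mxE; ring.
have [f1 _] := flat u a1; have [_ f2] := flat u' u'n.
have nv (z : 'rV[int]_d) : vn z <= 2 * rho + 3 -> vn (v + z) <= vn v + (2 * rho + 3) + vn y.
  move=> zn; have := vnormD R v z; have := vnorm_ge0 R y; lra.
have [q1 _ _ _] := fluc (v + u) (nv u a1).
have [_ q2 _ _] : [/\ True, `|passage_time t 0 (v + u + y) - f (v + u + y)| < e, True & True].
  split => //; have [] // := fluc (v + u + y) _.
  have := vnormD R (v + u) y; have := vnormD R v u; lra.
have [_ _ q3 _] : [/\ True, True, `|passage_time t (V - (v + u' - y)) V - f (v + u' - y)| < e & True].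
  split => //; have [] // := fluc (v + u' - y) _.
  have := vnormB R (v + u') y; have := vnormD R v u'; lra.
have [_ _ _ q4] := fluc (v + u') (nv u' u'n).
have e1 : a0 + y = y + (v + u) by rewrite a0E addrC.
have e2 : a0 + y = v + u + y by rewrite a0E.
have e3 : b0 + y = V - (v + u' - y) by rewrite /u'; apply/rowP => i; rewrite !mxE; ring.
have e4 : b0 + y = V + y - (v + u') by rewrite /u'; apply/rowP => i; rewrite !mxE; ring.
have tri1 := passage_triangle t0 0 (a0 + y) V.
have tri2 := passage_triangle t0 (a0 + y) (b0 + y) V.
rewrite -e1 in q1; rewrite -e2 in q2; rewrite -e3 in q3; rewrite -e4 in q4.
move: q1 q2 q3 q4 Dc f1 f2 Tab tri1 tri2.
rewrite -e2; rewrite !ltr_norml.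
set F1 := f (v + u); set F2 := f (a0 + y).
set F3 := f (v + u'); set F4 := f (v + u' - y).
move=> /andP[q11 q12] /andP[q21 q22] /andP[q31 q32] /andP[q41 q42] Dc f1 f2 Tab tri1 tri2.
clear - q11 q22 q32 q41 Dc f1 f2 Tab tri1 tri2; lra.
Qed.

(** The scale [m `^ q] exceeds every error of the comparison: the fluctuations
    [m `^ chi'], the error [m `^ eta] of the means at a flat vertex and their
    curvature term [m `^ (2 sig - 1)].  Each of the five exceptional events, one
    for each endpoint of the two segments and one for the tube, has probability
    at most [m `^ (- p)]. *)
Lemma parallel_passage_times chi' eta q xi1 sig kap p : (1 < d)%N ->
  0 <= chi -> chi < chi' -> chi' < q -> eta < q -> 2 * sig - 1 < q -> 0 < sig -> sig < 1 ->
  xi < xi1 -> 0 <= xi1 -> 0 < kap -> (1 + kap) * xi1 < sig ->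
  has_flat_vertices f eta ->
  exists c C M : R, [/\ 0 < c, 0 <= C, 1 <= M & forall m, M <= m -> exists V y,
    [/\ c * m `^ (1 + kap) <= vn V, vn V <= C * m `^ (1 + kap),
     forall e, tube V (m `^ sig) e -> ~~ tube V (m `^ sig) (shift_edge (- y) e),
     pr (~` [set w | geodesic_within (tube V (m `^ sig)) 0 V (sample tau w)]) <= m `^ (- p) &
     pr [set w | m `^ q < ptime 0 V w - ptime y (V + y) w] <= 5 * m `^ (- p)]].
Proof.
move=> d2 chi0 hchi hchiq hetaq hsigq sig0 sig1 hxi xi0 kap0 hkap [C [c1 [M0 [c10 M01 C0 flat]]]].
pose A := C + 3; have A1 : 1 <= A by rewrite /A; lra.
have [M1 [M11 hM1]] := uniform_fluctuation tau_ge0 tau_iid h_up p chi0 hchi A1.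
have C30 : 0 <= 3 * C by lra.
have k0 : 0 <= 1 + kap by lra.
have [M2 [M21 hM2]] := tube_probability tau_ge0 h_up h_low p hxi xi0 C30 k0 hkap.
have [M3 [M31 hM3]] := powR_dominates 6 sig1.
have [M4 [M41 hM4]] := powR_dominates (3 + 3 * d%:R) sig0.
have [M5 [M51 hM5]] := powR_dominates (6 * C) hetaq.
have [M6 [M61 hM6]] := powR_dominates (216 * C) hsigq.
have [M7 [M71 hM7]] := powR_dominates 12 hchiq.
pose M := Num.max M0 (Num.max M1 (Num.max M2 (Num.max M3 (Num.max M4 (Num.max M5 (Num.max M6 M7)))))).
exists c1, (3 * C), M; split => //; first by rewrite le_max M01.
move=> m; rewrite !ge_max => /and4P[m0' m1 m2 /and5P[m3 m4 m5 m6 m7]].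
have m1' : 1 <= m by lra.
have m0 : 0 < m by lra.
have [v [v_lo v_hi v_flat]] := flat m m0'.
have v0 : 0 < vn v by apply: lt_le_trans v_lo; rewrite mulr_gt0.
have vN0 : v != 0 by apply: contraTneq v0 => ->; rewrite vnorm0 ltxx.
set rho := m `^ sig.
have rho_m : 6 * rho <= m by have := hM3 m m3; rewrite powRr1 // ltW.
have rho_d : 3 + 3 * d%:R <= rho by have := hM4 m m4; rewrite powRr0 mulr1.
have dR : 0 <= d%:R :> R by [].
have rho0 : 0 <= rho by rewrite powR_ge0.
pose N := (Num.truncn (m `^ kap)).+2.
have mk1 : 1 <= m `^ kap by rewrite -(powRr0 m); apply: ler_powR => //; exact: ltW.
have /andP[Nlo Nhi] := truncn_itv (le_trans ler01 mk1).
have NE : N%:R = (Num.truncn (m `^ kap)).+1%:R + 1 :> R by rewrite /N -natr1.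
have N1 : m `^ kap <= N%:R by rewrite NE; lra.
have N2 : N%:R <= 3 * m `^ kap by rewrite NE -natr1; lra.
pose V := v *+ N; have vV : vn V = N%:R * vn v by rewrite vnormMn.
have mk : m `^ (1 + kap) = m `^ kap * m.
  by rewrite powRD ?powRr1 ?(ltW m0) 1?mulrC // (gt_eqF m0) implybT.
have V_lo : c1 * m `^ (1 + kap) <= vn V.
  rewrite vV mk; apply: le_trans (_ : m `^ kap * vn v <= _); last by rewrite ler_wpM2r // ltW.
  by rewrite mulrCA ler_wpM2l // powR_ge0.
have V_hi : vn V <= 3 * C * m `^ (1 + kap).
  rewrite vV mk; apply: le_trans (ler_wpM2r (ltW v0) N2) _.
  have -> : 3 * C * (m `^ kap * m) = 3 * m `^ kap * (C * m) by ring.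
  by rewrite ler_wpM2l // mulr_ge0 // powR_ge0.
have VN0 : V != 0.
  by apply: contraTneq (lt_le_trans (mulr_gt0 c10 (powR_gt0 (1 + kap) m0)) V_lo) => ->; rewrite vnorm0 ltxx.
have r0 : 0 <= 2 * rho + 3 + d%:R by lra.
have [y [y_orth y_lo y_hi]] := orthogonal_vertex v d2 r0.
have orthV : `|dot (rv V) (rv y)| <= d%:R * vn V.
  by rewrite to_realMn dotZl normrM ger0_norm // vV mulrCA ler_wpM2l.
exists V, y; split => //.
- by move=> e; apply: tube_disjoint.
- exact: hM2.
have ym : vn y <= m by clear - tau_ge0 tau_iid h_up h_low y_hi rho_m rho_d rho0; lra.
have near u : vn u <= 2 * rho + 3 -> vn u <= m by move=> un; clear - tau_ge0 tau_iid h_up h_low un rho_m rho_d dR rho0; lra.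
have cur u : vn u <= 2 * rho + 3 -> (vn u + vn y) ^+ 2 / m <= (6 * rho) ^+ 2 / m.
  move=> un; rewrite ler_wpM2r ?invr_ge0 ?(ltW m0) //.
  have un0 := vnorm_ge0 R u; have y0 := vnorm_ge0 R y.
  by apply: lerXn2r; rewrite ?nnegrE; clear - tau_ge0 tau_iid h_up h_low un un0 y0 y_hi rho_d rho0 dR; lra.
have ends b : vn b <= vn v + (2 * rho + 3) + vn y -> vn b <= A * m.
  by move=> bn; rewrite /A; clear - tau_ge0 tau_iid h_up h_low bn v_hi y_hi rho_m rho_d dR rho0 m0; lra.
pose D := C * (m `^ eta + (6 * rho) ^+ 2 / m).
have total : 2 * D + 4 * m `^ chi' <= m `^ q.
  have h5 := hM5 m m5; have h6 := hM6 m m6; have h7 := hM7 m m7.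
  have rr : rho ^+ 2 / m = m `^ (2 * sig - 1).
    rewrite powRD ?(gt_eqF m0) ?implybT // powRN powRr1 ?(ltW m0) //.
    by rewrite [2 * sig]mulrC powRrM powR_mulrn ?powR_ge0.
  have -> : D = C * m `^ eta + 36 * C * m `^ (2 * sig - 1) by rewrite -rr /D; ring.
  clear - tau_ge0 tau_iid h_up h_low h5 h6 h7; lra.
have [B1 [mB1 pB1 hB1]] := hM1 m m1 y.
have [B2 [mB2 pB2 hB2]] := hM1 m m1 0.
have [B3 [mB3 pB3 hB3]] := hM1 m m1 V.
have [B4 [mB4 pB4 hB4]] := hM1 m m1 (V + y).
set Gc := ~` [set t : config R (edge d) | geodesic_within (tube V rho) 0 V t].
have mGc : measurable Gc by apply: measurableC; exact: measurable_geodesic_within.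
pose B5 := [set w | Gc (fun e => tau (shift_edge y e) w)].
have mB5 : measurable B5.
  apply: (@preimage_config_measurable _ _ _ _ (fun w e => tau (shift_edge y e) w)) => //.
  by apply: measurable_config => e; exact: measurable_funP.
have pB5 : pr B5 <= m `^ (- p).
  rewrite /pr /B5 (shift_law tau_iid y mGc).
  exact: (hM2 m m2 V VN0 V_hi).
have mq : measurable [set w | m `^ q < ptime 0 V w - ptime y (V + y) w].
  rewrite (_ : [set w | _] = ~` [set w | ptime 0 V w - ptime y (V + y) w <= m `^ q]).
    apply: measurableC; rewrite -[X in measurable X]setTI; apply: measurable_fun_le => //.
    by apply: measurable_funB; exact: measurable_ptime.
  by apply/seteqP; split=> w /=; rewrite ltNge => /negP.
have mU2 := measurableU _ _ mB1 mB2.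
have mU3 := measurableU _ _ mU2 mB3.
have mU4 := measurableU _ _ mU3 mB4.
have mU5 := measurableU _ _ mU4 mB5.
have sub : [set w | m `^ q < ptime 0 V w - ptime y (V + y) w] `<=` B1 `|` B2 `|` B3 `|` B4 `|` B5.
  move=> w /= wq; apply: contrapT => nU.
  have [nB1 nB2 nB3 nB4 nB5] : [/\ ~ B1 w, ~ B2 w, ~ B3 w, ~ B4 w & ~ B5 w].
    by split=> h; apply: nU; [do 4 left|do 3 left; right|do 2 left; right|left; right|right].
  move: wq; apply/negP; rewrite -leNgt.
  apply: (@reroute_ends (fun e => tau e w) v V y rho D (m `^ chi') _ N) => //.
  - have [g [gp gS gle]] : geodesic_within (tube V rho) 0 V
        ((fun e => tau (shift_edge y e) w) : config R (edge d)) by exact: contrapT.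
    exists g; split => //.
    by move: gle; rewrite (abs_weight_sample tau_ge0 (shift_edge y)).
  - move=> u un; split.
      apply: le_trans (v_flat u y (near u un) ym y_orth) _.
      by rewrite lerD2l ler_wpM2l // lerD2l cur.
    apply: le_trans (v_flat u (- y) (near u un) _ _) _; rewrite ?vnormN //.
      by rewrite to_realN dotNr normrN.
    by rewrite lerD2l ler_wpM2l // lerD2l cur.
  - move=> b /ends bA.
    have [h1 _] := hB1 w nB1 b bA; have [h2 _] := hB2 w nB2 b bA.
    have [_ h3] := hB3 w nB3 b bA; have [_ h4] := hB4 w nB4 b bA.
    by rewrite add0r in h2; split.
apply: le_trans (le_pr P mq mU5 sub) _.
have u5 := pr_setU P mU4 mB5; have u4 := pr_setU P mU3 mB4.
have u3 := pr_setU P mU2 mB3; have u2 := pr_setU P mB1 mB2.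
clear - u2 u3 u4 u5 pB1 pB2 pB3 pB4 pB5; lra.
Qed.

End parallel_passage_times.

(** * The scaling inequality *)

Section variance_bound.
Variables (R : realType) (d : nat) (disp : measure_display).
Variables (T : measurableType disp) (P : probability T R) (mu : probability R R).
Variable tau : edge d -> {RV P >-> R}.
Hypothesis tau_ge0 : forall e w, 0 <= tau e w.
Hypothesis tau_iid : iid tau mu.
Local Notation vn := (@vertex_norm R d).
Local Notation pr := (pr P).
Local Notation f := (mean_time tau).
Local Notation ptime := (ptime tau).
Variables (chi xi chib xib : R).
Hypothesis h_up : upper_exponents tau chi xi.
Hypothesis h_low : lower_exponents tau chib xib.

(** Outside the concentration event the square is controlled by [L ^ 2] plus a
    fourth moment divided by [L ^ 2]. *)
Lemma variance_of_concentration v c s L beta M4 : 0 <= c -> 0 < L ->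
  `|f v - c| <= L -> pr [set w | 2 * s < `|ptime 0 v w - c|] <= beta ->
  (\int[P]_w (`|ptime 0 v w - f v| ^+ 4)%:E <= M4%:E)%E ->
  ('V_P[fpp_time tau v] <= (4 * s ^+ 2 + 4 * L ^+ 2 * beta + 2 / L ^+ 2 * M4)%:E)%E.
Proof.
move=> c0 L0 fc prB h4; apply: le_trans (variance_le tau_ge0 tau_iid h_up v c0) _.
set B := [set w | _] in prB.
have mX : measurable_fun setT (ptime 0 v) by exact: measurable_ptime.
have mB : measurable B by exact: measurable_far_ptime.
pose g1 (w : T) : \bar R := (4 * s ^+ 2)%:E.
pose g2 (w : T) : \bar R := ((4 * L ^+ 2)%:E * (\1_B w)%:E)%E.
pose g3 (w : T) : \bar R := ((2 / L ^+ 2)%:E * (`|ptime 0 v w - f v| ^+ 4)%:E)%E.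
have L2 : 0 < L ^+ 2 by rewrite exprn_gt0.
have c3 : 0 <= 2 / L ^+ 2 by rewrite divr_ge0 // ltW.
have c2 : 0 <= 4 * L ^+ 2 by rewrite mulr_ge0 // ltW.
have mi : measurable_fun setT (fun w => (\1_B w)%:E : \bar R).
  by apply/measurable_EFinP; exact: measurable_indic.
have m4 : measurable_fun setT (fun w => (`|ptime 0 v w - f v| ^+ 4)%:E).
  apply/measurable_EFinP; apply: measurable_funX; apply: measurableT_comp.
    exact: normr_measurable.
  exact: measurable_funB.
have m1 : measurable_fun setT g1 by exact: measurable_cst.
have m2 : measurable_fun setT g2 by exact: measurable_funeM.
have m3 : measurable_fun setT g3 by exact: measurable_funeM.
have p0 w : setT w -> (0 <= (\1_B w)%:E :> \bar R)%E by rewrite lee_fin.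
have p4 w : setT w -> (0 <= (`|ptime 0 v w - f v| ^+ 4)%:E)%E by rewrite lee_fin exprn_ge0.
have p1 w : setT w -> (0 <= g1 w)%E by rewrite lee_fin mulr_ge0 // sqr_ge0.
have p2 w : setT w -> (0 <= g2 w)%E by rewrite /g2 -EFinM lee_fin mulr_ge0.
have p3 w : setT w -> (0 <= g3 w)%E by rewrite /g3 -EFinM lee_fin mulr_ge0 // exprn_ge0.
have p23 w : setT w -> (0 <= g2 w + g3 w)%E by move=> _; rewrite adde_ge0 ?p2 ?p3.
have m23 : measurable_fun setT (fun w => g2 w + g3 w)%E by exact: emeasurable_funD.
apply: (@le_trans _ _ (\int[P]_w (g1 w + (g2 w + g3 w)))%E).
  apply: ge0_le_integral => //.
  - by move=> w _; rewrite lee_fin sqr_ge0.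
  - by apply/measurable_EFinP; apply: measurable_funX; exact: measurable_funB.
  - exact: emeasurable_funD.
  - move=> w _; rewrite /g1 /g2 /g3 -!EFinM -!EFinD lee_fin indicE.
    set x := ptime 0 v w - f v.
    have x4 : 0 <= `|x| ^+ 4 by rewrite exprn_ge0.
    have [wB|wB] := boolP (w \in B); rewrite ?mulr1 ?mulr0 ?add0r.
      have -> : ptime 0 v w - c = x + (f v - c) by rewrite /x; ring.
      have h1 : x ^+ 2 <= L ^+ 2 + `|x| ^+ 4 / L ^+ 2.
        have -> : `|x| ^+ 4 = (x ^+ 2) ^+ 2 by rewrite -[4%N]/(2 * 2)%N exprM real_normK ?num_real.
        have -> : L ^+ 2 + (x ^+ 2) ^+ 2 / L ^+ 2 = (L ^+ 2 * L ^+ 2 + x ^+ 2 * x ^+ 2) / L ^+ 2.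
          by field; rewrite gt_eqF.
        rewrite ler_pdivlMr //; have := sqr_ge0 (x ^+ 2); have := sqr_ge0 x.
        set X := x ^+ 2; set Y := L ^+ 2 in L2 *; nra.
      have h2 : (f v - c) ^+ 2 <= L ^+ 2.
        by rewrite -(real_normK (num_real (f v - c))); apply: lerXn2r; rewrite ?nnegrE // ltW.
      have h3 : (x + (f v - c)) ^+ 2 <= 2 * x ^+ 2 + 2 * (f v - c) ^+ 2.
        have := sqr_ge0 (x - (f v - c)); lra.
      have h5 := sqr_ge0 s.
      have -> : 2 / L ^+ 2 * `|x| ^+ 4 = 2 * (`|x| ^+ 4 / L ^+ 2) by ring.
      clear - h1 h2 h3 h5; lra.
    have le2s : `|ptime 0 v w - c| <= 2 * s.
      by rewrite leNgt; apply: contra wB => h; rewrite inE.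
    have h1 : (ptime 0 v w - c) ^+ 2 <= 4 * s ^+ 2.
      have -> : 4 * s ^+ 2 = (2 * s) ^+ 2 by ring.
      rewrite -(real_normK (num_real (ptime 0 v w - c))).
      by apply: lerXn2r; rewrite ?nnegrE //; apply: le_trans le2s.
    by apply: le_trans h1 _; rewrite lerDl mulr_ge0.
rewrite (ge0_integralD P measurableT p1 m1 p23 m23) (ge0_integralD P measurableT p2 m2 p3 m3).
rewrite (ge0_integralZl_EFin P measurableT p0 mi c2) (ge0_integralZl_EFin P measurableT p4 m4 c3).
have eB : (\int[P]_w (\1_B w)%:E = (pr B)%:E)%E.
  transitivity (P B); last exact: prE.
  by rewrite integral_indic // setIT.
rewrite eB -[4 * s ^+ 2 + _ + _]addrA (EFinD (4 * s ^+ 2)) (EFinD (4 * L ^+ 2 * beta)).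
apply: leeD.
  rewrite le_eqVlt; apply/orP; left; apply/eqP.
  transitivity ((4 * s ^+ 2)%:E * P setT)%E; first exact: integral_cst.
  by rewrite probability_setT mule1.
apply: leeD; first by rewrite -EFinM lee_fin ler_wpM2l.
by rewrite (EFinM (2 / L ^+ 2) M4); apply: lee_wpmul2l; rewrite ?lee_fin.
Qed.

End variance_bound.

Section conclusion.
Variables (R : realType) (d : nat) (disp : measure_display).
Variables (T : measurableType disp) (P : probability T R) (mu : probability R R).
Variable tau : edge d -> {RV P >-> R}.
Hypothesis tau_ge0 : forall e w, 0 <= tau e w.
Hypothesis tau_iid : iid tau mu.
Local Notation vn := (@vertex_norm R d).
Local Notation pr := (pr P).
Local Notation f := (mean_time tau).
Local Notation ptime := (ptime tau).
Variables (chi xi xib : R).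
Hypothesis h_up : upper_exponents tau chi xi.
Hypothesis h_low : lower_exponents tau chi xib.
Hypotheses (d2 : (1 < d)%N) (chi_gt0 : 0 < chi).

(** The value [c] near which the passage time is concentrated is within [L] of the
    mean, because with positive probability the passage time is close to both. *)
Lemma variance_of_parallel_times (V y : 'rV[int]_d) (rho s L delta M4 : R) : 0 < s -> 4 * s <= L ->
  delta <= 320^-1 ->
  (forall e, tube V rho e -> ~~ tube V rho (shift_edge (- y) e)) ->
  pr (~` [set w | geodesic_within (tube V rho) 0 V (sample tau w)]) <= delta ->
  pr [set w | s < ptime 0 V w - ptime y (V + y) w] <= delta ->
  pr [set w | L / 2 <= `|ptime 0 V w - f V|] <= 4^-1 ->
  (\int[P]_w (`|ptime 0 V w - f V| ^+ 4)%:E <= M4%:E)%E ->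
  ('V_P[fpp_time tau V] <= (4 * s ^+ 2 + 4 * L ^+ 2 * (16 * delta) + 2 / L ^+ 2 * M4)%:E)%E.
Proof.
move=> s0 sL delta_small disj prG prX prL mom.
have L0 : 0 < L by lra.
have delta16 : delta <= 16^-1 by lra.
have mFl := measurable_fluctuation tau_ge0 0 V (f V) (L / 2).
have exk : exists k : nat, 2^-1 <= pr [set w | ptime 0 V w <= k%:R * s].
  exists (Num.truncn ((f V + L) / s)).+1.
  have ks : f V + L <= (Num.truncn ((f V + L) / s)).+1%:R * s.
    by rewrite -ler_pdivrMr //; apply: ltW; exact: truncnS_gt.
  apply: le_trans (_ : pr (~` [set w | L / 2 <= `|ptime 0 V w - f V|]) <= _).
    by rewrite pr_setC //; lra.
  apply: le_pr; [exact: measurableC|exact: measurable_ptime_le|].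
  move=> w /= /negP; rewrite -ltNge ltr_norml => /andP[_ h]; apply: le_trans ks; lra.
have [c c0 prc] := passage_time_concentration tau_ge0 tau_iid s0 delta16 disj prG prX exk.
have mc := measurable_far_ptime tau_ge0 0 V c (2 * s).
suff fc : `|f V - c| <= L.
  exact: (variance_of_concentration tau_ge0 tau_iid h_up c0 L0 fc prc mom).
have mU := measurableU _ _ mFl mc.
have [w] : exists w, (~` ([set w | L / 2 <= `|ptime 0 V w - f V|] `|`
    [set w | 2 * s < `|ptime 0 V w - c|])) w.
  apply: (@pr_exists _ _ _ P); first exact: measurableC.
  by rewrite pr_setC // subr_gt0; have := pr_setU P mFl mc; lra.
rewrite setCU => -[/negP + /negP]; rewrite -ltNge -leNgt.
rewrite ltr_norml !ler_norml; lra.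
Qed.

(** With the exponent [1] the linear growth of [f] is enough. *)
Lemma linear_flat_vertices : has_flat_vertices f 1.
Proof.
have d0 := ltnW d2; have [C hC] := mean_time_linear tau_ge0 tau_iid h_up.
pose K := `|C|; have K0 : 0 <= K by exact: normr_ge0.
have fK v : f v <= K * vn v.
  by apply: le_trans (hC v) _; rewrite ler_wpM2r ?vnorm_ge0 // ler_norm.
exists (3 * K + 1), 2^-1, 2; split; [by rewrite invr_gt0|lra|lra|].
move=> m m2; have m0 : 0 <= m by lra.
pose v : 'rV[int]_d := delta_mx 0 (Ordinal d0) *+ Num.truncn m.
have [mlo mhi] := andP (truncn_itv m0); rewrite -natr1 in mhi.
have vE : vn v = (Num.truncn m)%:R by rewrite vnormMn vnorm_delta mulr1.
exists v; rewrite vE; split; [lra|nra|move=> u y um ym _].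
have le3 : vn (v + u + y) <= 3 * m.
  have := vnormD R (v + u) y; have := vnormD R v u; rewrite vE; lra.
apply: le_trans (fK _) _; rewrite powRr1 //.
have h1 := mean_time_ge0 tau_ge0 (v + u).
have h2 : K * vn (v + u + y) <= K * (3 * m) by rewrite ler_wpM2l.
have h3 : 0 <= (vn u + vn y) ^+ 2 / m by rewrite divr_ge0 ?sqr_ge0.
have h4 : 0 <= (3 * K + 1) * ((vn u + vn y) ^+ 2 / m) by rewrite mulr_ge0 //; lra.
clear - h1 h2 h4 m0; lra.
Qed.

Lemma flat_vertices_exist q : chi < q -> xi < 1 -> exists2 eta, eta < q & has_flat_vertices f eta.
Proof.
move=> hq hxi; have [chi1|chi1] := leP 1 chi.
  by exists 1; [exact: le_lt_trans hq|exact: linear_flat_vertices].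
pose eta := (chi + Num.min 1 q) / 2.
have mn : [/\ Num.min 1 q <= 1, Num.min 1 q <= q & chi < Num.min 1 q].
  by rewrite !ge_min !lexx orbT lt_min chi1 hq.
case: mn => mn1 mn2 mn3.
have e1 : chi < eta by rewrite /eta; lra.
have e2 : eta < 1 by rewrite /eta; lra.
have e3 : eta < q by rewrite /eta; lra.
pose theta := (1 + Num.max xi 0) / 2.
have mx : [/\ xi <= Num.max xi 0, 0 <= Num.max xi 0 & Num.max xi 0 < 1].
  by rewrite !le_max !lexx orbT gt_max hxi ltr01.
case: mx => mx1 mx2 mx3.
have t1 : xi < theta by rewrite /theta; lra.
have t2 : 0 < theta by rewrite /theta; lra.
have t3 : theta < 1 by rewrite /theta; lra.
have [M0 split] := mean_time_split tau_ge0 tau_iid h_up h_low (ltW chi_gt0) e1 t1 t2 t3.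
have f0 := mean_time_ge0 tau_ge0; have fs := mean_time_sub tau_ge0 tau_iid h_up.
have [C fC] := mean_time_linear tau_ge0 tau_iid h_up.
have eta0 : 0 < eta by exact: lt_trans e1.
have [A A0 fg] := nonrandom_fluctuation_bound f0 fs fC eta0 e2 t3 (ltW t2) split.
by exists eta => //; exact: (flat_vertex f0 fs fC eta0 A0 fg (ltnW d2)).
Qed.

Theorem exponent_inequality : chi <= 2 * xi - 1.
Proof.
have [xi1|xi1] := leP 1 xi.
  by have := variance_exponent_le1 tau_ge0 tau_iid h_up h_low (ltnW d2); lra.
rewrite leNgt; apply/negP => hlt; have chi0 := chi_gt0.
(* [top] is the largest admissible tube exponent, [s0] the smallest one *)
pose top := Num.min 1 ((1 + chi) / 2); pose s0 := Num.max xi 0.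
have [t1 t2 st] : [/\ top <= 1, top <= (1 + chi) / 2 & s0 < top].
  rewrite /top /s0 !ge_min !lexx orbT lt_min !gt_max xi1 ltr01 /=; split => //.
  by apply/andP; split; lra.
have [s1 s2] : xi <= s0 /\ 0 <= s0 by rewrite /s0 !le_max !lexx orbT.
pose xi' := (2 * s0 + top) / 3; pose sig := (s0 + 2 * top) / 3.
have x1 : xi < xi' by rewrite /xi'; lra.
have x2 : 0 < xi' by rewrite /xi'; lra.
have x3 : xi' < sig by rewrite /xi' /sig; lra.
have g1 : sig < 1 by rewrite /sig; lra.
have g2 : 2 * sig - 1 < chi by rewrite /sig; lra.
have g0 : 0 < sig by lra.
(* [kap] is so small that tubes of width [m `^ sig] still contain the geodesics to
   distance [m `^ (1 + kap)] *)
pose kap := (sig - xi') / (2 * xi').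
have k0 : 0 < kap by rewrite divr_gt0 ?subr_gt0 // mulr_gt0.
have kx : (1 + kap) * xi' < sig.
  have -> : (1 + kap) * xi' = (sig + xi') / 2 by rewrite /kap; field; rewrite gt_eqF.
  lra.
(* [s = m `^ q] exceeds the fluctuations at distance [m], but its square is smaller
   than the variance at distance [m `^ (1 + kap)], which is at least of order
   [m `^ ((1 + kap) (2 chi''))] *)
pose q := chi * (1 + kap / 2); pose chi' := chi * (1 + kap / 4).
pose chi'' := chi * (1 + 3 * kap / 4) / (1 + kap).
have ck : 0 < chi * kap by rewrite mulr_gt0.
have c1 : chi < chi' by rewrite /chi'; lra.
have c2 : chi' < q by rewrite /chi' /q; lra.
have c3 : chi'' < chi by rewrite /chi'' ltr_pdivrMr; lra.
have chi''0 : 0 <= 2 * chi''.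
  by rewrite mulr_ge0 // /chi'' divr_ge0 ?mulr_ge0 //; lra.
have c4 : (1 + kap) * (2 * chi'') = 2 * chi * (1 + 3 * kap / 4).
  by rewrite /chi''; field; rewrite gt_eqF //; lra.
have c5 : 2 * q < (1 + kap) * (2 * chi'') by rewrite c4 /q; lra.
have [eta eta_q flat] := flat_vertices_exist (lt_trans c1 c2) xi1.
(* [L = m `^ a] is a crude bound for the passage time minus its mean at distance
   [m `^ (1 + kap)]; events of probability [m `^ (- p)] contribute [O(1)] to the
   variance since [p = 2 a] *)
pose a := 2 * (1 + kap) * chi' + q + 1; pose p := 2 * a.
have chi'0 : 0 < chi' by lra.
have kc : 0 < (1 + kap) * chi' by rewrite mulr_gt0 //; lra.
have q0 : 0 < q by lra.
have a0 : 0 < a by rewrite /a; lra.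
have p0 : 0 < p by rewrite /p; lra.
have g3 : 2 * sig - 1 < q by lra.
have [b [C [M [b0 C0 M1 hM]]]] := parallel_passage_times tau_ge0 tau_iid h_up h_low p d2
   (ltW chi_gt0) c1 c2 eta_q g3 g0 g1 x1 (ltW x2) k0 kx flat.
have [C1 C10 tail] := fluctuation_tail tau_ge0 tau_iid h_up 1 c1 (ltW chi'0).
have [C4 C40 mom] := central_moment tau_ge0 h_up 4 c1.
have [c c0 low] := variance_lower h_low c3.
have e1 : (1 + kap) * chi' < a by rewrite /a; lra.
have e2 : q < a by rewrite /a; lra.
have e3 : (1 + kap) * chi' * 4%:R < 2 * a by rewrite /a; lra.
have [N1 [N11 hN1]] := powR_dominates (8 * C1 * C `^ chi') e1.
have [N2 [N21 hN2]] := powR_dominates 4 e2.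
have [N3 [N31 hN3]] := powR_dominates (2 * C4 * (C `^ chi') ^+ 4) e3.
have [N4 [N41 hN4]] := powR_dominates 1600 p0.
have [N5 [N51 hN5]] := powR_dominates (400 / (c * b `^ (2 * chi''))) c5.
pose m := Num.max M (Num.max N1 (Num.max N2 (Num.max N3 (Num.max N4 N5)))).
have /and4P[mM m1 m2 /and3P[m3 m4 m5]] : [&& M <= m, N1 <= m, N2 <= m & [&& N3 <= m, N4 <= m & N5 <= m]].
  by rewrite /m !le_max !lexx !orbT.
move: {hN1 hN2 hN3 hN4 hN5} (hN1 m m1) (hN2 m m2) (hN3 m m3) (hN4 m m4) (hN5 m m5) => h1 h2 h3 h4 h5.
have m_ge1 : 1 <= m by apply: le_trans mM.
have m_gt0 : 0 < m by apply: lt_le_trans m_ge1.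
have [V [y [V_lo V_hi disj prG prX]]] := hM m mM.
have b_gt0 : 0 < b * m `^ (1 + kap) by rewrite mulr_gt0 // powR_gt0.
have V_gt0 : 0 < vn V by apply: lt_le_trans V_lo.
have VN0 : V != 0 by apply: contraTneq V_gt0 => ->; rewrite vnorm0 ltxx.
pose L := m `^ a; have L0 : 0 < L by rewrite powR_gt0.
pose s := m `^ q; have s_gt0 : 0 < s by rewrite powR_gt0.
have s_ge1 : 1 <= s by rewrite -(powRr0 m); apply: ler_powR => //; exact: ltW.
have VC : vn V `^ chi' <= C `^ chi' * m `^ ((1 + kap) * chi').
  rewrite powRrM -powRM ?powR_ge0 //; apply: ge0_ler_powR (V_hi).
  - exact: ltW.
  - by rewrite nnegrE vnorm_ge0.
  - by rewrite nnegrE mulr_ge0 ?powR_ge0.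
have prL : pr [set w | L / 2 <= `|ptime 0 V w - f V|] <= 4^-1.
  have L2 : 0 < L / 2 by rewrite divr_gt0.
  have := tail (vn V) 0 V (L / 2) (lexx _) L2; rewrite add0r expr1 => h.
  apply: le_trans h _.
  have -> : C1 * (vn V `^ chi' / (L / 2)) = 2 * C1 * vn V `^ chi' / L by field; rewrite gt_eqF.
  rewrite ler_pdivrMr //.
  have : C1 * vn V `^ chi' <= C1 * (C `^ chi' * m `^ ((1 + kap) * chi')).
    exact: (ler_wpM2l C10 VC).
  by move: h1; rewrite -/L => h1 h6; clear - h1 h6; lra.
have mp : m `^ (- p) = (L ^+ 2)^-1.
  by rewrite powRN /p mulrC powRrM powR_mulrn ?powR_ge0.
have delta_small : 5 * m `^ (- p) <= 320^-1.
  move: h4; rewrite powRr0 mulr1 => h4.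
  have zx : m `^ p * m `^ (- p) = 1.
    by rewrite -powRD ?subrr ?powRr0 // (gt_eqF m_gt0) implybT.
  have := ler_wpM2r (powR_ge0 m (- p)) h4; rewrite zx => {}h4.
  clear - h4; lra.
have prG' : pr (~` [set w | geodesic_within (tube V (m `^ sig)) 0 V (sample tau w)]) <= 5 * m `^ (- p).
  by apply: le_trans prG _; rewrite ler_peMl ?powR_ge0 // ler1n.
have := variance_of_parallel_times s_gt0 h2 delta_small disj prG' prX prL (mom V VN0).
have := low V VN0 => /le_trans/[apply]; rewrite lee_fin => hV.
have lowV : 400 * s ^+ 2 <= c * vn V `^ (2 * chi'').
  have bp : 0 < b `^ (2 * chi'') by rewrite powR_gt0.
  have sE : s ^+ 2 = m `^ (2 * q).
    by rewrite /s [2 * q]mulrC (powRrM m q 2) powR_mulrn // powR_ge0.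
  have hm : 400 * m `^ (2 * q) <= c * (b `^ (2 * chi'') * m `^ ((1 + kap) * (2 * chi''))).
    move: h5; rewrite mulrAC ler_pdivrMr ?mulr_gt0 // => h5.
    by rewrite [leRHS]mulrA [leRHS]mulrC.
  rewrite sE; apply: le_trans hm _; rewrite ler_wpM2l ?(ltW c0) // (powRrM m).
  rewrite -powRM ?powR_ge0 ?(ltW b0) //.
  by apply: ge0_ler_powR; rewrite ?nnegrE ?vnorm_ge0 ?(ltW b_gt0).
have L2 : 0 < L ^+ 2 by rewrite exprn_gt0.
have second : 4 * L ^+ 2 * (16 * (5 * m `^ (- p))) = 320.
  by rewrite mp; field; rewrite gt_eqF.
have third : 2 / L ^+ 2 * (C4 * (vn V `^ chi') ^+ 4) <= 1.
  rewrite mulrAC ler_pdivrMr // mul1r.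
  have LE : L ^+ 2 = m `^ (2 * a) by rewrite /L [2 * a]mulrC (powRrM m a 2) powR_mulrn ?powR_ge0.
  rewrite LE; apply: le_trans h3.
  rewrite [leRHS](_ : _ = 2 * (C4 * (C `^ chi' * m `^ ((1 + kap) * chi')) ^+ 4)); last first.
    by rewrite exprMn [(m `^ _) ^+ 4]powR_natK; ring.
  rewrite ler_wpM2l // ler_wpM2l //.
  by apply: lerXn2r; rewrite ?nnegrE ?mulr_ge0 ?powR_ge0.
have sq_ge1 : 1 <= s ^+ 2 by apply: exprn_ege1.
rewrite second in hV; move: hV lowV third sq_ge1; set X := c * _; set Y := 2 / _ * _; set Z := s ^+ 2.
lra.
Qed.

End conclusion.

Theorem theorem2p1 (R : realType) (d : nat) (hd : (2 <= d)%N)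
    (disp : measure_display) (T : measurableType disp) (P : probability T R)
    (mu : probability R R) (tau : edge d -> {RV P >-> R})
    (tau_ge0 : forall e w, 0 <= tau e w)
    (tau_iid : iid tau mu)
    (mu_inf : (mu [set inf (msupport mu)] < (critical_probability R d)%:E)%E)
    (chi_a chi_b xi_a xi_b : R)
    (hexp : global_exponents tau chi_a chi_b xi_a xi_b)
    (hchi : chi_a = chi_b) (chi_gt0 : 0 < chi_a) :
  chi_a <= 2 * xi_a - 1.
Proof.
case: hexp => h_up h_low; rewrite -hchi in h_low.
exact: (exponent_inequality tau_ge0 tau_iid h_up h_low hd chi_gt0).
Qed.
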